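(* Let $|\gamma|<1$ and assume $\mu$ is not normalized Lebesgue measure. For $f\in L^2(\mu)$ write $\Phi_\gamma^*f=(g_1,g_2)\in\mathcal K_{\theta_\gamma}$ and put $g_-^\gamma:=\overline{\theta_\gamma}g_1+\Delta_\gamma g_2$ (which lies in $H^2_-=L^2\ominus H^2$). Then, a.e. on $\mathbb T$, $$g_-^\gamma=(1-|\gamma|^2)^{-1/2}\big(\overline{\theta_\gamma}+\overline\gamma\big)\frac{T_-f}{T_-\mathbf 1}=\frac{(1-|\gamma|^2)^{1/2}\,\overline{\theta_0}}{1-\gamma\overline{\theta_0}}\cdot\frac{T_-f}{T_-\mathbf 1}.$$
   Context: $\mathbb T=\{|z|=1\}$, normalized Lebesgue measure. Let $\mu$ be a Borel probability measure on $\mathbb T$, $U=M_\xi$ on $L^2(\mu)$, $b=\mathbf 1$, $b_1(\xi)=\overline\xi$, $U_\gamma=U+(\gamma-1)(\,\cdot\,,b_1)_{L^2(\mu)}b$. For $\lambda\in\mathbb D$, $R_2\mu(\lambda)=\int\frac{1+\overline\xi\lambda}{1-\overline\xi\lambda}d\mu(\xi)$, $\theta_\gamma=\frac{(1-\gamma)R_2\mu-(1+\gamma)}{(1-\overline\gamma)R_2\mu+(1+\overline\gamma)}$ (boundary values also denoted $\theta_\gamma$), $\Delta_\gamma=(1-|\theta_\gamma|^2)^{1/2}$ on $\mathbb T$. Model space $\mathcal K_\theta=(H^2\oplus\operatorname{clos}\Delta L^2)\ominus\{(\theta h,\Delta h):h\in H^2\}$, model operator $\mathcal M_\theta=P_{\mathcal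 K_\theta}M_z|_{\mathcal K_\theta}$. Defect vectors $c^\gamma(z)=(1-|\theta_\gamma(0)|^2)^{-1/2}(1-\overline{\theta_\gamma(0)}\theta_\gamma(z),-\overline{\theta_\gamma(0)}\Delta_\gamma(z))^T$, $c_1^\gamma(z)=(1-|\theta_\gamma(0)|^2)^{-1/2}(z^{-1}(\theta_\gamma(z)-\theta_\gamma(0)),z^{-1}\Delta_\gamma(z))^T$. $\Phi_\gamma^*:L^2(\mu)\to\mathcal K_{\theta_\gamma}$ is the unitary operator with $\Phi_\gamma^*U_\gamma=\mathcal M_{\theta_\gamma}\Phi_\gamma^*$, $\Phi_\gamma^*b=c^\gamma$, $\Phi_\gamma^*b_1=c_1^\gamma$. $T_rf(z)=\int\frac{f(\xi)d\mu(\xi)}{1-r\overline\xi z}$ ($r\ne1$) and $T_-f=\lim_{r\to1^+}T_rf$ Lebesgue-a.e. *)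

(* Defs.v *)
(* mathcomp-analysis (measure theory, Lebesgue integral)
   + complex numbers R[i] from mathcomp-real-closed. *)
From HB Require Import structures.
From mathcomp Require Import all_boot all_order all_algebra.
From mathcomp Require Import all_classical all_reals all_analysis.
From mathcomp Require Import complex.
Set Implicit Arguments. Unset Strict Implicit. Unset Printing Implicit Defensive.
Import Order.TTheory GRing.Theory Num.Theory numFieldNormedType.Exports.
Local Open Scope ring_scope.
Local Open Scope classical_set_scope.
Local Open Scope complex_scope.

(* Conventions.  The unit circle T is parametrised by t in [0,1) through   *)
(* t |-> expi t = exp(2 pi i t).  This is a Borel isomorphism [0,1) -> T    *)
(* carrying Lebesgue measure on [0,1) to normalized Lebesgue measure on T. *)
(* A Borel probability measure on T is thus a Borel measure mu on R with   *)
(* mu R = 1 and mu (R \ [0,1)) = 0; functions on T are functions R -> C   *)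
(* whose values on [0,1) matter.                                           *)

Definition I01 {R : realType} : set (measurableTypeR R) := `[0%R, 1%R[%classic.

Definition expi {R : realType} (t : R) : R[i] :=
  (cos (2 * pi * t)) +i* (sin (2 * pi * t)).

(* normalized Lebesgue measure on T, i.e. Lebesgue measure on R (used on [0,1)) *)
Notation leb := (@lebesgue_measure _).

(* |z|^2 as a real number *)
Definition cabs2 {R : realType} (z : R[i]) : R := complex.Re (z * z^*).

(* integral of a complex valued function *)
Definition cint {R : realType} (mu : {measure set (measurableTypeR R) -> \bar R}) (D : set (measurableTypeR R))
  (f : R -> R[i]) : R[i] :=
  (Rintegral mu D (fun x => complex.Re (f x))) +i*
  (Rintegral mu D (fun x => complex.Im (f x))).

Definition cmeasurable {R : realType} (f : R -> R[i]) : Prop :=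
  measurable_fun setT (fun x => complex.Re (f x)) /\
  measurable_fun setT (fun x => complex.Im (f x)).

(* f in L^2(mu) *)
Definition L2mu {R : realType} (mu : {measure set (measurableTypeR R) -> \bar R}) (f : R -> R[i]) : Prop :=
  cmeasurable f /\ (\int[mu]_x (cabs2 (f x))%:E < +oo)%E.

(* f in L^2(T, m) *)
Definition L2m {R : realType} (f : R -> R[i]) : Prop :=
  cmeasurable f /\ (\int[leb]_(x in I01) (cabs2 (f x))%:E < +oo)%E.

(* equality m-a.e. on T *)
Definition aeeq {R : realType} (f g : R -> R[i]) : Prop :=
  {ae leb, forall t, I01 t -> f t = g t}.

Definition aeeq2 {R : realType} (g h : (R -> R[i]) * (R -> R[i])) : Prop :=
  aeeq g.1 h.1 /\ aeeq g.2 h.2.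

(* inner product of H^2 (+) clos(Delta L^2) \subset L^2 (+) L^2 *)
Definition ip2 {R : realType} (g h : (R -> R[i]) * (R -> R[i])) : R[i] :=
  cint leb I01 (fun t => g.1 t * (h.1 t)^* + g.2 t * (h.2 t)^*).

(* Hardy space H^2: L^2 functions whose negative Fourier coefficients vanish *)
Definition H2 {R : realType} (g : R -> R[i]) : Prop :=
  L2m g /\ forall n : nat, (0 < n)%N -> cint leb I01 (fun t => g t * expi t ^+ n) = 0.

(* Delta = (1 - |theta|^2)^{1/2} on T *)
Definition Delta {R : realType} (thb : R -> R[i]) (t : R) : R[i] :=
  sqrtC (1 - `|thb t| ^+ 2).

(* g in clos (D L^2) (closure in L^2(m)) *)
Definition closDL2 {R : realType} (D : R -> R[i]) (g : R -> R[i]) : Prop :=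
  L2m g /\ forall e : R, 0 < e -> exists h, L2m h /\
     (\int[leb]_(t in I01) (cabs2 (g t - D t * h t))%:E < e%:E)%E.

(* model space K_theta, theta given by its boundary function thb *)
Definition Kmodel {R : realType} (thb : R -> R[i]) (g : (R -> R[i]) * (R -> R[i])) : Prop :=
  H2 g.1 /\ closDL2 (Delta thb) g.2 /\
  forall h, H2 h -> ip2 g (fun t => thb t * h t, fun t => Delta thb t * h t) = 0.

(* p = P_{K_theta} g  (orthogonal projection onto K_theta) *)
Definition isProjK {R : realType} (thb : R -> R[i]) (g p : (R -> R[i]) * (R -> R[i])) : Prop :=
  Kmodel thb p /\
  forall k, Kmodel thb k -> ip2 (fun t => g.1 t - p.1 t, fun t => g.2 t - p.2 t) k = 0.

(* R_2 mu (lambda) *)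
Definition R2 {R : realType} (mu : {measure set (measurableTypeR R) -> \bar R}) (l : R[i]) : R[i] :=
  cint mu setT (fun s => (1 + (expi s)^* * l) / (1 - (expi s)^* * l)).

(* theta_gamma on the disc *)
Definition theta {R : realType} (mu : {measure set (measurableTypeR R) -> \bar R}) (gam l : R[i]) : R[i] :=
  ((1 - gam) * R2 mu l - (1 + gam)) / ((1 - gam^*) * R2 mu l + (1 + gam^*)).

(* complex limits along r -> 1^- and r -> 1^+ (r real) *)
Definition ccvg_left {R : realType} (F : R -> R[i]) (l : R[i]) : Prop :=
  ((fun r => complex.Re (F r)) x @[x --> 1^'-] --> complex.Re l) /\
  ((fun r => complex.Im (F r)) x @[x --> 1^'-] --> complex.Im l).

Definition ccvg_right {R : realType} (F : R -> R[i]) (l : R[i]) : Prop :=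
  ((fun r => complex.Re (F r)) x @[x --> 1^'+] --> complex.Re l) /\
  ((fun r => complex.Im (F r)) x @[x --> 1^'+] --> complex.Im l).

(* Fb is (a representative of) the radial boundary function of F : D -> C *)
Definition is_boundary {R : realType} (F : R[i] -> R[i]) (Fb : R -> R[i]) : Prop :=
  {ae leb, forall t, I01 t -> ccvg_left (fun r => F (r%:C * expi t)) (Fb t)}.

(* T_r f (z) *)
Definition Tr {R : realType} (mu : {measure set (measurableTypeR R) -> \bar R}) (r : R) (f : R -> R[i])
  (z : R[i]) : R[i] :=
  cint mu setT (fun s => f s / (1 - r%:C * (expi s)^* * z)).

(* Tf is (a representative of) T_- f = lim_{r -> 1^+} T_r f, a.e. on T *)
Definition is_Tminus {R : realType} (mu : {measure set (measurableTypeR R) -> \bar R}) (f : R -> R[i])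
  (Tf : R -> R[i]) : Prop :=
  {ae leb, forall t, I01 t -> ccvg_right (fun r => Tr mu r f (expi t)) (Tf t)}.

(* U_gamma f = xi f + (gamma - 1) (f, b1) b,  b = 1, b1 = conj xi *)
Definition Ugam {R : realType} (mu : {measure set (measurableTypeR R) -> \bar R}) (gam : R[i])
  (f : R -> R[i]) : R -> R[i] :=
  fun x => expi x * f x + (gam - 1) * cint mu setT (fun s => f s * (expi s)^*^*) * 1.

(* defect vectors c^gamma and c_1^gamma *)
Definition cgam {R : realType} (th0 : R[i]) (thb : R -> R[i]) : (R -> R[i]) * (R -> R[i]) :=
  (fun t => (sqrtC (1 - `|th0| ^+ 2))^-1 * (1 - th0^* * thb t),
   fun t => (sqrtC (1 - `|th0| ^+ 2))^-1 * (- th0^* * Delta thb t)).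

Definition c1gam {R : realType} (th0 : R[i]) (thb : R -> R[i]) : (R -> R[i]) * (R -> R[i]) :=
  (fun t => (sqrtC (1 - `|th0| ^+ 2))^-1 * ((expi t)^-1 * (thb t - th0)),
   fun t => (sqrtC (1 - `|th0| ^+ 2))^-1 * ((expi t)^-1 * Delta thb t)).

(* Phi is Phi_gamma^* : L^2(mu) -> K_{theta_gamma}, the unitary operator with
   Phi U_gamma = M_theta Phi, Phi b = c^gamma, Phi b1 = c_1^gamma.
   (Phi acts on representatives; it is required to respect mu-a.e. equality.) *)
Definition is_Phi {R : realType} (mu : {measure set (measurableTypeR R) -> \bar R}) (gam : R[i])
  (thb : R -> R[i]) (Phi : (R -> R[i]) -> (R -> R[i]) * (R -> R[i])) : Prop :=
  [/\ (* well defined on L^2(mu) classes *)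
      forall f g, L2mu mu f -> L2mu mu g -> {ae mu, forall x, f x = g x} ->
        aeeq2 (Phi f) (Phi g),
      (* linear *)
      forall (a : R[i]) f g, L2mu mu f -> L2mu mu g ->
        aeeq2 (Phi (fun x => a * f x + g x))
              (fun t => a * (Phi f).1 t + (Phi g).1 t,
               fun t => a * (Phi f).2 t + (Phi g).2 t),
      (* maps into K_theta, isometrically *)
      forall f, L2mu mu f -> Kmodel thb (Phi f) /\
        (\int[leb]_(t in I01) (cabs2 ((Phi f).1 t) + cabs2 ((Phi f).2 t))%:E
          = \int[mu]_x (cabs2 (f x))%:E)%E,
      (* onto K_theta *)
      forall g, Kmodel thb g -> exists f, L2mu mu f /\ aeeq2 (Phi f) g &
      (* intertwining: Phi U_gamma f = P_K (z Phi f) = M_theta Phi f *)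
      forall f, L2mu mu f ->
        isProjK thb (fun t => expi t * (Phi f).1 t, fun t => expi t * (Phi f).2 t)
                    (Phi (Ugam mu gam f)) /\
      (* Phi b = c^gamma, Phi b1 = c_1^gamma *)
      aeeq2 (Phi (fun _ => 1)) (cgam (theta mu gam 0) thb) /\
      aeeq2 (Phi (fun x => (expi x)^*)) (c1gam (theta mu gam 0) thb)].

(* Main.v *)
(* Let [A f] be the function [g_-] attached to [Phi^* f].  On the model space
   multiplication by [z] becomes [g_- |-> z g_- - const], and [U_gamma] is a
   rank-one perturbation of multiplication by [xi]; this gives
   [A (xi f) = z A f + beta (f, b_1)] with [beta = (1 - gamma) A 1 - s],
   [s = (1 - |gamma|^2)^(1/2)].  Applying it to [f / (xi - lambda)], [|lambda| > 1],
   and taking the Cauchy integral at [lambda], which kills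
   [(z - lambda) A (f / (xi - lambda))], shows that the Cauchy integral of [A f] is
   [T f(lambda)] times that of [beta], and the case [f = 1] evaluates the latter as
   [- s / (1 - (1 - gamma) T 1(lambda))].  Letting [lambda] tend radially to the
   circle gives [A f = - s T_- f / (1 - (1 - gamma) T_- 1)], and both formulas
   follow since [theta_gamma] is an explicit function of [T_- 1].

   Dividing by [T_- 1] requires [T_- 1 <> 0] a.e.  Its zeros are zeros of
   [A 1 = (conj theta_gamma + conj gamma) / s], a bounded function with negative
   spectrum; if they had positive measure, [A 1] would vanish identically (F. and
   M. Riesz, proved by Szego's extremal argument), the shift relation would kill
   all moments of [mu], and [mu] would be Lebesgue measure. *)

Require Import Defs.
From HB Require Import structures.
From mathcomp Require Import all_boot all_order all_algebra.
From mathcomp Require Import all_classical all_reals all_analysis.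
From mathcomp Require Import measurable_realfun complex.
From mathcomp Require Import ring lra zify.
Import Order.TTheory GRing.Theory Num.Theory numFieldNormedType.Exports.
Local Open Scope ring_scope.
Local Open Scope classical_set_scope.
Local Open Scope complex_scope.

(** [Tf] is given as a radial limit, so the Cauchy integral of [A f] is already known to converge
    pointwise and only its limit has to be identified with [A f]. Weak convergence in [L^2] does
    this, and it can be tested against trigonometric polynomials, because indicators of Borel sets
    are approximated in [L^1] of any finite measure by trigonometric polynomials with values in
    [[0, 1]]. The same approximation, for the sum of [mu] and Lebesgue measure, settles the moment
    problem.

    The boundary function [thb] is known only as a limit almost everywhere. It is exchanged for a
    measurable function bounded by [1] everywhere, and the integrals that define the model space
    must survive this exchange even where measurability of the integrand is unknown.

    In Szego's argument the squared moduli of a minimizing sequence tend weakly to a positive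
    constant, although every member vanishes on the zero set; this forces the zero set to be null.

    All denominators are controlled by [Re T_- 1 <= 1/2], which is the positivity of the Poisson
    kernel carried to the exterior of the disc. *)

Local Notation cRe := complex.Re.
Local Notation cIm := complex.Im.

(** * Real and imaginary parts, and the squared modulus *)

Section ComplexArithmetic.
Local Open Scope ring_scope.
Context {R : realType}.
Implicit Types x y z : R[i].

Lemma cReD x y : cRe (x + y) = cRe x + cRe y.
Proof. by case: x => ? ?; case: y. Qed.
Lemma cImD x y : cIm (x + y) = cIm x + cIm y.
Proof. by case: x => ? ?; case: y. Qed.
Lemma cReN x : cRe (- x) = - cRe x. Proof. by case: x. Qed.
Lemma cImN x : cIm (- x) = - cIm x. Proof. by case: x. Qed.
Lemma cReM x y : cRe (x * y) = cRe x * cRe y - cIm x * cIm y.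
Proof. by case: x => ? ?; case: y. Qed.
Lemma cImM x y : cIm (x * y) = cRe x * cIm y + cIm x * cRe y.
Proof. by case: x => ? ?; case: y. Qed.
Lemma cReJ x : cRe (x^*) = cRe x. Proof. by case: x. Qed.
Lemma cImJ x : cIm (x^*) = - cIm x. Proof. by case: x. Qed.

Definition cRIE := (cReD, cImD, cReN, cImN, cReM, cImM, cReJ, cImJ).

Lemma complex_eq x y : cRe x = cRe y -> cIm x = cIm y -> x = y.
Proof. by case: x => ? ?; case: y => ? ? /= -> ->. Qed.

Lemma conjcD x y : (x + y)^* = x^* + y^*. Proof. exact: rmorphD. Qed.
Lemma conjcN x : (- x)^* = - x^*. Proof. exact: rmorphN. Qed.
Lemma conjcM x y : (x * y)^* = x^* * y^*. Proof. exact: rmorphM. Qed.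
Lemma conjcV x : (x^-1)^* = (x^*)^-1. Proof. exact: fmorphV. Qed.
Lemma conj1 : (1 : R[i])^* = 1. Proof. exact: rmorph1. Qed.
Lemma conj0 : (0 : R[i])^* = 0. Proof. exact: rmorph0. Qed.

Definition conjE := (conjcD, conjcN, conjcM, conjcV, conj1, conj0).

Lemma conj_real (r : R) : (r%:C)^* = r%:C.
Proof. by apply: complex_eq; rewrite !cRIE //= oppr0. Qed.

Lemma cabs2E x : cabs2 x = cRe x ^+ 2 + cIm x ^+ 2.
Proof. by rewrite /cabs2 !cRIE; ring. Qed.

Lemma cabs2_ge0 x : 0 <= cabs2 x.
Proof. by rewrite cabs2E addr_ge0 ?sqr_ge0. Qed.

Lemma cabs2M x y : cabs2 (x * y) = cabs2 x * cabs2 y.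
Proof. by rewrite !cabs2E !cRIE; ring. Qed.

Lemma cabs2J x : cabs2 (x^*) = cabs2 x.
Proof. by rewrite !cabs2E !cRIE; ring. Qed.

Lemma cabs2N x : cabs2 (- x) = cabs2 x.
Proof. by rewrite !cabs2E !cRIE; ring. Qed.

Lemma cabs2_real (r : R) : cabs2 r%:C = r ^+ 2.
Proof. by rewrite cabs2E /=; ring. Qed.

Lemma cabs2_0 : cabs2 (0 : R[i]) = 0.
Proof. by rewrite (cabs2_real 0) expr0n. Qed.

Lemma cabs2_1 : cabs2 (1 : R[i]) = 1.
Proof. by rewrite (cabs2_real 1) expr1n. Qed.

Lemma cabs2D_le x y : cabs2 (x + y) <= 2 * cabs2 x + 2 * cabs2 y.
Proof.
rewrite !cabs2E !cRIE; have := sqr_ge0 (cRe x - cRe y).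
by have := sqr_ge0 (cIm x - cIm y); nra.
Qed.

Lemma cabs2B_le x y : cabs2 (x - y) <= 2 * cabs2 x + 2 * cabs2 y.
Proof. by rewrite -(cabs2N y); exact: cabs2D_le. Qed.

Lemma cabs2_eq0 x : cabs2 x = 0 -> x = 0.
Proof.
move=> /eqP; rewrite cabs2E paddr_eq0 ?sqr_ge0// !sqrf_eq0 => /andP[/eqP a /eqP b].
exact: complex_eq.
Qed.

Lemma mulcJE x : x * x^* = (cabs2 x)%:C.
Proof. by apply: complex_eq; rewrite ?cabs2E !cRIE /=; ring. Qed.

Lemma sqr_normE x : `|x| ^+ 2 = (cabs2 x)%:C.
Proof. by rewrite -add_Re2_Im2 cabs2E. Qed.

Lemma cabs2V x : cabs2 (x^-1) = (cabs2 x)^-1.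
Proof.
have [->|x0] := eqVneq x 0; first by rewrite invr0 cabs2_0 invr0.
have h : cabs2 x != 0 by apply: contra_neq x0; exact: cabs2_eq0.
by apply: (mulfI h); rewrite -cabs2M !mulfV// cabs2_1.
Qed.

Lemma cabs2_lt1 x : `|x| < 1 -> cabs2 x < 1.
Proof.
move=> h; have : `|x| ^+ 2 < 1 by rewrite expr_lt1.
by rewrite sqr_normE ltcE/= => /andP[].
Qed.

Lemma cRe_abs_le x (g : R) : 0 <= g -> cabs2 x <= g ^+ 2 -> `|cRe x| <= g.
Proof.
move=> g0; rewrite cabs2E => h; rewrite -[g]ger0_norm// -ler_sqr ?nnegrE//.
by rewrite !real_normK ?num_real//; nra.
Qed.

Lemma cIm_abs_le x (g : R) : 0 <= g -> cabs2 x <= g ^+ 2 -> `|cIm x| <= g.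
Proof.
move=> g0; rewrite cabs2E => h; rewrite -[g]ger0_norm// -ler_sqr ?nnegrE//.
by rewrite !real_normK ?num_real//; nra.
Qed.

Lemma cReV x : cRe (x^-1) = cRe x * (cabs2 x)^-1.
Proof. by case: x => a b; rewrite cabs2E. Qed.
Lemma cImV x : cIm (x^-1) = - (cIm x * (cabs2 x)^-1).
Proof. by case: x => a b; rewrite cabs2E. Qed.

End ComplexArithmetic.

(** * Measurability of complex-valued functions *)

Section Cmeasurable.
Local Open Scope ring_scope.
Context {R : realType}.
Implicit Types f g : R -> R[i].

Lemma cmeasurable_cst (c : R[i]) : cmeasurable (fun _ : R => c).
Proof. by split; exact: measurable_cst. Qed.

Lemma cmeasurableD f g : cmeasurable f -> cmeasurable g ->
  cmeasurable (fun t => f t + g t).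
Proof.
move=> [f1 f2] [g1 g2]; split.
- under eq_fun do rewrite cReD; exact: measurable_funD.
- under eq_fun do rewrite cImD; exact: measurable_funD.
Qed.

Lemma cmeasurableN f : cmeasurable f -> cmeasurable (fun t => - f t).
Proof.
move=> [f1 f2]; split.
- under eq_fun do rewrite cReN; exact: measurableT_comp.
- under eq_fun do rewrite cImN; exact: measurableT_comp.
Qed.

Lemma cmeasurableB f g : cmeasurable f -> cmeasurable g ->
  cmeasurable (fun t => f t - g t).
Proof. by move=> mf mg; apply: cmeasurableD => //; exact: cmeasurableN. Qed.

Lemma cmeasurableM f g : cmeasurable f -> cmeasurable g ->
  cmeasurable (fun t => f t * g t).
Proof.
move=> [f1 f2] [g1 g2]; split.
- under eq_fun do rewrite cReM.
  by apply: measurable_funB; exact: measurable_funM.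
- under eq_fun do rewrite cImM.
  by apply: measurable_funD; exact: measurable_funM.
Qed.

Lemma cmeasurableJ f : cmeasurable f -> cmeasurable (fun t => (f t)^*).
Proof.
move=> [f1 f2]; split.
- by under eq_fun do rewrite cReJ.
- under eq_fun do rewrite cImJ; exact: measurableT_comp.
Qed.

Lemma measurable_cabs2 f : cmeasurable f -> measurable_fun setT (cabs2 \o f).
Proof.
move=> [f1 f2]; rewrite /comp; under eq_fun do rewrite cabs2E.
by apply: measurable_funD; exact: measurable_funX.
Qed.

Lemma cmeasurable_real (h : R -> R) : measurable_fun setT h ->
  cmeasurable (fun t => (h t)%:C).
Proof. by move=> mh; split => //=; exact: measurable_cst. Qed.

Lemma cmeasurableV f : cmeasurable f -> cmeasurable (fun t => (f t)^-1).
Proof.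
move=> mf; have m2 : measurable_fun setT (fun t => (cabs2 (f t))^-1).
  (* Inversion of a nonnegative real is the power with exponent [-1], also at [0], where both are
     [0]; power functions are measurable. *)
  have -> : (fun t => (cabs2 (f t))^-1) = (@powR R ^~ (-1)) \o (cabs2 \o f).
    by apply/funext => t /=; rewrite powR_inv1 ?cabs2_ge0.
  apply: measurableT_comp; first exact: measurable_powR.
  exact: measurable_cabs2.
case: mf => f1 f2; split.
- under eq_fun do rewrite cReV; exact: measurable_funM.
- under eq_fun do rewrite cImV.
  apply: measurableT_comp => //; exact: measurable_funM.
Qed.

End Cmeasurable.

(** * Integrals of complex functions and the space [L^2] *)

Section Integration.
Local Open Scope ring_scope.
Context {R : realType}.
Implicit Types (nu : {measure set (measurableTypeR R) -> \bar R})
  (D : set (measurableTypeR R)) (u v w : R -> R) (f g h : R -> R[i]).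

Definition rI nu D u : Prop := nu.-integrable D (fun t => (u t)%:E).

Lemma rID nu D u v : measurable D -> rI nu D u -> rI nu D v ->
  rI nu D (fun t => u t + v t).
Proof. by move=> mD iu iv; exact: (integrableD mD iu iv). Qed.

Lemma rIZ nu D u (c : R) : measurable D -> rI nu D u ->
  rI nu D (fun t => c * u t).
Proof. by move=> mD iu; exact: (integrableZl mD _ iu). Qed.

Lemma rIN nu D u : measurable D -> rI nu D u -> rI nu D (fun t => - u t).
Proof.
by move=> mD iu; have := rIZ nu D u (-1) mD iu; under eq_fun do rewrite mulN1r.
Qed.

Lemma rIB nu D u v : measurable D -> rI nu D u -> rI nu D v ->
  rI nu D (fun t => u t - v t).
Proof. by move=> mD iu iv; apply: rID => //; exact: rIN. Qed.

Lemma rI_dom nu D u v : measurable D -> measurable_fun setT u -> rI nu D v ->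
  (forall t, D t -> `|u t| <= v t) -> rI nu D u.
Proof.
move=> mD mu iv uv; apply: le_integrable iv => //.
- by apply/measurable_EFinP; exact: measurable_funTS.
- move=> t Dt; rewrite !abse_EFin lee_fin; apply: (le_trans (uv t Dt)).
  exact: ler_norm.
Qed.

Lemma rI_cst nu D (c : R) : measurable D -> (nu D < +oo)%E ->
  rI nu D (fun _ => c).
Proof.
move=> mD fD; apply: (measurable_bounded_integrable (f := cst c)) => //.
exact: bounded_cst.
Qed.

Lemma rI_bounded nu D u (c : R) : measurable D -> (nu D < +oo)%E ->
  measurable_fun setT u -> (forall t, D t -> `|u t| <= c) -> rI nu D u.
Proof. by move=> mD fD mu uc; apply: (rI_dom _ _ _ _ mD mu (rI_cst nu D c mD fD)). Qed.

Lemma rI_ge0 nu D u : measurable D -> measurable_fun setT u ->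
  (forall t, 0 <= u t) ->
  (\int[nu]_(t in D) (u t)%:E < +oo)%E -> rI nu D u.
Proof.
move=> mD mu u0 fin; apply/integrableP; split.
  by apply/measurable_EFinP; exact: measurable_funTS.
by under eq_integral do rewrite gee0_abs ?lee_fin//.
Qed.

Lemma rI_EFin nu D u : measurable D -> rI nu D u ->
  (\int[nu]_(t in D) (u t)%:E)%E = (\int[nu]_(t in D) u t)%:E.
Proof. by move=> mD iu; rewrite fineK//; exact: integrable_fin_num. Qed.

Definition cI nu D f : Prop :=
  rI nu D (fun t => cRe (f t)) /\ rI nu D (fun t => cIm (f t)).

Lemma cID nu D f g : measurable D -> cI nu D f -> cI nu D g ->
  cI nu D (fun t => f t + g t).
Proof.
move=> mD [f1 f2] [g1 g2]; split.
- by under eq_fun do rewrite cReD; exact: rID.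
- by under eq_fun do rewrite cImD; exact: rID.
Qed.

Lemma cIZ nu D (c : R[i]) f : measurable D -> cI nu D f ->
  cI nu D (fun t => c * f t).
Proof.
move=> mD [f1 f2]; split.
- by under eq_fun do rewrite cReM; apply: rIB => //; exact: rIZ.
- by under eq_fun do rewrite cImM; apply: rID => //; exact: rIZ.
Qed.

Lemma cIB nu D f g : measurable D -> cI nu D f -> cI nu D g ->
  cI nu D (fun t => f t - g t).
Proof.
move=> mD If Ig; have := cID nu D f _ mD If (cIZ nu D (-1) g mD Ig).
by under eq_fun do rewrite mulN1r.
Qed.

(** Domination is stated through the square of the modulus, which keeps square roots out of all the
    estimates. *)
Lemma cI_dom nu D f u : measurable D -> cmeasurable f -> rI nu D u ->
  (forall t, D t -> 0 <= u t /\ cabs2 (f t) <= u t ^+ 2) -> cI nu D f.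
Proof.
move=> mD [m1 m2] iu fu; split.
- by apply: (rI_dom _ _ _ _ mD m1 iu) => t /fu[u0 ?]; exact: cRe_abs_le.
- by apply: (rI_dom _ _ _ _ mD m2 iu) => t /fu[u0 ?]; exact: cIm_abs_le.
Qed.

Lemma cintD nu D f g : measurable D -> cI nu D f -> cI nu D g ->
  cint nu D (fun t => f t + g t) = cint nu D f + cint nu D g.
Proof.
move=> mD [f1 f2] [g1 g2]; apply: complex_eq; rewrite !cRIE /=.
- by under eq_Rintegral do rewrite cReD; exact: RintegralD.
- by under eq_Rintegral do rewrite cImD; exact: RintegralD.
Qed.

Lemma cintZ nu D (c : R[i]) f : measurable D -> cI nu D f ->
  cint nu D (fun t => c * f t) = c * cint nu D f.
Proof.
move=> mD [f1 f2]; apply: complex_eq; rewrite !cRIE /=.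
- under eq_Rintegral do rewrite cReM.
  by rewrite RintegralB ?RintegralZl//; exact: rIZ.
- under eq_Rintegral do rewrite cImM.
  by rewrite RintegralD ?RintegralZl//; exact: rIZ.
Qed.

Lemma cintB nu D f g : measurable D -> cI nu D f -> cI nu D g ->
  cint nu D (fun t => f t - g t) = cint nu D f - cint nu D g.
Proof.
move=> mD [f1 f2] [g1 g2]; apply: complex_eq; rewrite !cRIE /=.
- by under eq_Rintegral do rewrite cReD cReN; exact: RintegralB.
- by under eq_Rintegral do rewrite cImD cImN; exact: RintegralB.
Qed.

Lemma eq_cint nu D f g : (forall t, D t -> f t = g t) ->
  cint nu D f = cint nu D g.
Proof.
move=> fg; apply: complex_eq => /=; apply: eq_Rintegral => t /set_mem Dt /=;
  by rewrite fg.
Qed.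

Lemma cintJ nu D f : measurable D -> cI nu D f ->
  cint nu D (fun t => (f t)^*) = (cint nu D f)^*.
Proof.
move=> mD [f1 f2]; apply: complex_eq; rewrite !cRIE /=.
- by under eq_Rintegral do rewrite cReJ.
- under eq_Rintegral do rewrite cImJ -mulN1r.
  by rewrite RintegralZl// mulN1r.
Qed.

Lemma cIJ nu D f : measurable D -> cI nu D f -> cI nu D (fun t => (f t)^*).
Proof.
move=> mD [f1 f2]; split.
- by under eq_fun do rewrite cReJ.
- by under eq_fun do rewrite cImJ; exact: rIN.
Qed.

Lemma cint_real nu D u : cint nu D (fun t => (u t)%:C) = (\int[nu]_(t in D) u t)%:C.
Proof.
apply: complex_eq => //=.
by rewrite /Rintegral integral0_eq.
Qed.

Lemma Rintegral_cst1 nu D (c : R) : measurable D -> nu D = 1%E ->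
  \int[nu]_(t in D) c = c.
Proof. by move=> mD nu1; rewrite Rintegral_cst// nu1 mulr1. Qed.

Lemma cint_cst nu D (c : R[i]) : measurable D -> nu D = 1%E ->
  cint nu D (fun _ => c) = c.
Proof.
by move=> mD nu1; apply: complex_eq => /=; exact: Rintegral_cst1.
Qed.

Lemma cint_abs_le nu D f u : measurable D -> cI nu D f -> rI nu D u ->
  (forall t, D t -> 0 <= u t /\ cabs2 (f t) <= u t ^+ 2) ->
  `|cRe (cint nu D f)| <= \int[nu]_(t in D) u t /\
  `|cIm (cint nu D f)| <= \int[nu]_(t in D) u t.
Proof.
move=> mD [f1 f2] iu fu; split => /=.
- apply: (le_trans (le_normr_Rintegral mD f1)).
  apply: le_Rintegral => //; first exact: (integrable_norm f1).
  by move=> t /fu[? ?]; exact: cRe_abs_le.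
- apply: (le_trans (le_normr_Rintegral mD f2)).
  apply: le_Rintegral => //; first exact: (integrable_norm f2).
  by move=> t /fu[? ?]; exact: cIm_abs_le.
Qed.

Lemma ae_eq_Rintegral nu D u v : measurable D ->
  measurable_fun setT u -> measurable_fun setT v ->
  {ae nu, forall t, D t -> u t = v t} ->
  \int[nu]_(t in D) u t = \int[nu]_(t in D) v t.
Proof.
move=> mD mu mv uv; congr fine; apply: ae_eq_integral => //.
- by apply/measurable_EFinP; exact: measurable_funTS.
- by apply/measurable_EFinP; exact: measurable_funTS.
- by apply: filterS uv => t /[apply] ->.
Qed.

(* Square-integrable functions; [L2mu mu] is [L2 mu setT] and [L2m] is
   [L2 leb I01]. *)
Definition L2 nu D f : Prop :=
  cmeasurable f /\ (\int[nu]_(t in D) (cabs2 (f t))%:E < +oo)%E.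

Definition nrm2 nu D f : R := \int[nu]_(t in D) cabs2 (f t).

Lemma L2_rI nu D f : measurable D -> L2 nu D f -> rI nu D (fun t => cabs2 (f t)).
Proof.
move=> mD [mf ff]; apply: rI_ge0 => //; first exact: measurable_cabs2.
by move=> t; exact: cabs2_ge0.
Qed.

Lemma rI_L2 nu D f : measurable D -> cmeasurable f ->
  rI nu D (fun t => cabs2 (f t)) -> L2 nu D f.
Proof.
move=> mD mf; move/integrableP => [_ fin]; split => //.
by under eq_integral do rewrite -[(cabs2 _)%:E]gee0_abs ?lee_fin ?cabs2_ge0//.
Qed.

Lemma L2D nu D f g : measurable D -> L2 nu D f -> L2 nu D g ->
  L2 nu D (fun t => f t + g t).
Proof.
move=> mD f2 g2; have mfg := cmeasurableD _ _ f2.1 g2.1; apply: rI_L2 => //.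
apply: (rI_dom _ _ _ (fun t => 2 * cabs2 (f t) + 2 * cabs2 (g t)) mD).
- exact: measurable_cabs2.
- by apply: rID => //; apply: rIZ => //; exact: L2_rI.
- by move=> t _; rewrite ger0_norm ?cabs2_ge0//; exact: cabs2D_le.
Qed.

Lemma L2_mul_bounded nu D b f (c : R) : measurable D -> cmeasurable b ->
  (forall t, D t -> cabs2 (b t) <= c) -> L2 nu D f ->
  L2 nu D (fun t => b t * f t).
Proof.
move=> mD mb bc f2; have mbf := cmeasurableM _ _ mb f2.1; apply: rI_L2 => //.
apply: (rI_dom _ _ _ (fun t => c * cabs2 (f t)) mD).
- exact: measurable_cabs2.
- by apply: rIZ => //; exact: L2_rI.
- move=> t Dt; rewrite ger0_norm ?cabs2_ge0// cabs2M ler_wpM2r ?cabs2_ge0//.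
  exact: bc.
Qed.

Lemma L2Z nu D (c : R[i]) f : measurable D -> L2 nu D f ->
  L2 nu D (fun t => c * f t).
Proof.
by move=> mD; apply: (L2_mul_bounded nu D _ f (cabs2 c)) => //; exact: cmeasurable_cst.
Qed.

Lemma L2B nu D f g : measurable D -> L2 nu D f -> L2 nu D g ->
  L2 nu D (fun t => f t - g t).
Proof.
move=> mD f2 g2; have := L2D nu D f _ mD f2 (L2Z nu D (-1) g mD g2).
by under eq_fun do rewrite mulN1r.
Qed.

Lemma L2J nu D f : measurable D -> L2 nu D f -> L2 nu D (fun t => (f t)^*).
Proof.
by move=> mD [mf ff]; split; [exact: cmeasurableJ | under eq_fun do rewrite cabs2J].
Qed.

Lemma L2_bounded nu D b (c : R) : measurable D -> (nu D < +oo)%E ->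
  cmeasurable b -> (forall t, D t -> cabs2 (b t) <= c) -> L2 nu D b.
Proof.
move=> mD fD mb bc; apply: rI_L2 => //; apply: (rI_bounded _ _ _ c) => //.
  exact: measurable_cabs2.
by move=> t Dt; rewrite ger0_norm ?cabs2_ge0//; exact: bc.
Qed.

Lemma L2_cst nu D (c : R[i]) : measurable D -> (nu D < +oo)%E ->
  L2 nu D (fun _ => c).
Proof.
by move=> mD fD; apply: (L2_bounded _ _ _ (cabs2 c)) => //; exact: cmeasurable_cst.
Qed.

Lemma L2_cIM nu D f g : measurable D -> L2 nu D f -> L2 nu D g ->
  cI nu D (fun t => f t * g t).
Proof.
move=> mD f2 g2.
(* The crude bound [|f g| <= |f|^2 + |g|^2] is enough for integrability. *)
apply: (cI_dom _ _ _ (fun t => cabs2 (f t) + cabs2 (g t)) mD).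
- exact: cmeasurableM f2.1 g2.1.
- by apply: rID => //; exact: L2_rI.
- move=> t _; rewrite cabs2M; have := cabs2_ge0 (f t); have := cabs2_ge0 (g t).
  by move=> ? ?; split; [exact: addr_ge0 | nra].
Qed.

Lemma L2_cI nu D f : measurable D -> (nu D < +oo)%E -> L2 nu D f -> cI nu D f.
Proof.
move=> mD fD f2; have := L2_cIM nu D f _ mD f2 (L2_cst nu D 1 mD fD).
by under eq_fun do rewrite mulr1.
Qed.

Lemma cint_mulJ nu D f : cint nu D (fun t => f t * (f t)^*) = (nrm2 nu D f)%:C.
Proof. by under eq_fun do rewrite mulcJE; rewrite cint_real. Qed.

Lemma nrm2_ge0 nu D f : 0 <= nrm2 nu D f.
Proof. by apply: Rintegral_ge0 => t _; exact: cabs2_ge0. Qed.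

Lemma nrm2D nu D f g : measurable D -> L2 nu D f -> L2 nu D g ->
  nrm2 nu D (fun t => f t + g t) =
  nrm2 nu D f + nrm2 nu D g + 2 * cRe (cint nu D (fun t => f t * (g t)^*)).
Proof.
move=> mD f2 g2; rewrite /nrm2.
have [i1 _] := L2_cIM nu D f _ mD f2 (L2J nu D g mD g2).
have -> : (fun t => cabs2 (f t + g t)) =
   (fun t => cabs2 (f t) + cabs2 (g t) + 2 * cRe (f t * (g t)^*)).
  by apply/funext => t; rewrite !cabs2E !cRIE; ring.
have r1 := L2_rI nu D f mD f2; have r2 := L2_rI nu D g mD g2.
rewrite RintegralD//; [|exact: rID|exact: rIZ].
by rewrite RintegralD// RintegralZl.
Qed.

Lemma nrm2Z nu D (c : R[i]) f : measurable D -> L2 nu D f ->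
  nrm2 nu D (fun t => c * f t) = cabs2 c * nrm2 nu D f.
Proof.
move=> mD f2; rewrite /nrm2; under eq_Rintegral do rewrite cabs2M.
by rewrite RintegralZl//; exact: L2_rI.
Qed.

Lemma nrm2_eq0 nu D f : measurable D -> L2 nu D f -> nrm2 nu D f = 0 ->
  {ae nu, forall t, D t -> f t = 0}.
Proof.
move=> mD f2 f0; have [mf _] := f2.
have /(ae_eq_integral_abs nu mD) : measurable_fun D (fun t => (cabs2 (f t))%:E).
  by apply/measurable_EFinP/measurable_funTS; exact: measurable_cabs2.
under eq_integral do rewrite gee0_abs ?lee_fin ?cabs2_ge0//.
rewrite rI_EFin//; last exact: L2_rI.
rewrite -[Rintegral _ _ _]/(nrm2 nu D f) f0 => -[/(_ erefl) h _].
apply: filterS h => t ht Dt; apply: cabs2_eq0.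
by move: (ht Dt) => /= [].
Qed.

End Integration.

(** * Characters of the circle and trigonometric polynomials *)

Section TrigonometricPolynomials.
Local Open Scope ring_scope.
Context {R : realType}.
Implicit Types (t : R) (j k : int) (n : nat) (f g : R -> R[i]) (q : R -> R).

Lemma expiD (s t : R) : expi (s + t) = expi s * expi t.
Proof.
apply: complex_eq; rewrite /expi !cRIE /= mulrDr; first by rewrite cosD.
by rewrite sinD; ring.
Qed.

Lemma expi0 : expi 0 = 1 :> R[i].
Proof. by apply: complex_eq; rewrite /expi /= mulr0 ?cos0 ?sin0. Qed.

Lemma expiN t : expi (- t) = (expi t)^*.
Proof. by apply: complex_eq; rewrite /expi !cRIE /= mulrN ?cosN ?sinN. Qed.

Lemma cabs2_expi t : cabs2 (expi t) = 1.
Proof. by rewrite cabs2E /expi /= cos2Dsin2. Qed.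

Lemma expiJM t : (expi t)^* * expi t = 1.
Proof. by rewrite -expiN -expiD addNr expi0. Qed.

Lemma expi_neq0 t : expi t != 0.
Proof.
apply/eqP => t0; have := cabs2_expi t.
by rewrite t0 cabs2_0 => /eqP; rewrite eq_sym oner_eq0.
Qed.

Lemma expiV t : (expi t)^-1 = (expi t)^*.
Proof. by apply: (mulIf (expi_neq0 t)); rewrite expiJM mulVf ?expi_neq0. Qed.

Lemma measurable_expi : cmeasurable (@expi R).
Proof.
have mlin : measurable_fun setT (fun t : R => 2 * pi * t).
  exact: measurable_funM.
split; rewrite /expi /=.
- by apply: measurableT_comp => //; apply: continuous_measurable_fun; exact: continuous_cos.
- by apply: measurableT_comp => //; apply: continuous_measurable_fun; exact: continuous_sin.
Qed.

(** The character [z^k]; dilating the argument treats both signs of [k] alike. *)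
Definition ek k t : R[i] := expi (k%:~R * t).

Lemma ekM j k t : ek j t * ek k t = ek (j + k) t.
Proof. by rewrite /ek -expiD -mulrDl -intrD. Qed.

Lemma ek0 t : ek 0 t = 1.
Proof. by rewrite /ek mul0r expi0. Qed.

Lemma ek1 t : ek 1 t = expi t.
Proof. by rewrite /ek mul1r. Qed.

Lemma ekJ k t : (ek k t)^* = ek (- k) t.
Proof. by rewrite /ek -expiN mulrNz mulNr. Qed.

Lemma ekX n t : expi t ^+ n = ek n t.
Proof.
elim: n => [|n IH]; first by rewrite expr0 ek0.
by rewrite exprS IH -ek1 ekM intS.
Qed.

Lemma cabs2_ek k t : cabs2 (ek k t) = 1.
Proof. exact: cabs2_expi. Qed.

Lemma measurable_ek k : cmeasurable (ek k).
Proof.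
have mlin : measurable_fun setT (fun t : R => k%:~R * t).
  exact: measurable_funM.
by case: measurable_expi => m1 m2; split;
  [exact: (measurableT_comp m1 mlin)|exact: (measurableT_comp m2 mlin)].
Qed.

(** An inductive predicate rather than a list of coefficients: a linear statement about
    trigonometric polynomials reduces by induction to single characters and sums. *)
Inductive trig : (R -> R[i]) -> Prop :=
| trig_ek (c : R[i]) k : trig (fun t => c * ek k t)
| trigD f g : trig f -> trig g -> trig (fun t => f t + g t).

Lemma trig_cst (c : R[i]) : trig (fun _ => c).
Proof.
have -> : (fun _ => c) = (fun t => c * ek 0 t).
  by apply/funext => t; rewrite ek0 mulr1.
exact: trig_ek.
Qed.

Lemma trigM f g : trig f -> trig g -> trig (fun t => f t * g t).
Proof.
elim=> [c k|f1 f2 _ IH1 _ IH2] tg; last first.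
  by under eq_fun do rewrite mulrDl; apply: trigD; [exact: IH1|exact: IH2].
elim: tg => [d j|g1 g2 _ IH1 _ IH2]; last first.
  by under eq_fun do rewrite mulrDr; exact: trigD.
have -> : (fun t => c * ek k t * (d * ek j t)) = (fun t => c * d * ek (k + j) t).
  by apply/funext => t; rewrite -ekM; ring.
exact: trig_ek.
Qed.

Lemma trig_measurable f : trig f -> cmeasurable f.
Proof.
elim=> [c k|f1 f2 _ IH1 _ IH2]; last exact: cmeasurableD.
by apply: cmeasurableM; [exact: cmeasurable_cst|exact: measurable_ek].
Qed.

Definition rtrig q := trig (fun t => (q t)%:C).

Lemma rtrig_cst (c : R) : rtrig (fun _ => c).
Proof. exact: trig_cst. Qed.

Lemma rtrigD p q : rtrig p -> rtrig q -> rtrig (fun t => p t + q t).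
Proof.
by move=> tp tq; rewrite /rtrig; under eq_fun do rewrite rmorphD; exact: trigD.
Qed.

Lemma rtrigM p q : rtrig p -> rtrig q -> rtrig (fun t => p t * q t).
Proof.
by move=> tp tq; rewrite /rtrig; under eq_fun do rewrite rmorphM; exact: trigM.
Qed.

Lemma rtrigB p q : rtrig p -> rtrig q -> rtrig (fun t => p t - q t).
Proof.
move=> tp tq; apply: rtrigD => //; under eq_fun do rewrite -mulN1r.
by apply: rtrigM => //; exact: rtrig_cst.
Qed.

Lemma rtrigX q n : rtrig q -> rtrig (fun t => q t ^+ n).
Proof.
move=> tq; elim: n => [|n IH].
  by under eq_fun do rewrite expr0; exact: rtrig_cst.
by under eq_fun do rewrite exprS; exact: rtrigM.
Qed.

Lemma rtrig_measurable q : rtrig q -> measurable_fun setT q.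
Proof. by move=> /trig_measurable[]. Qed.

Lemma rtrig_cos (c : R) : rtrig (fun t => cos (2 * pi * t + c)).
Proof.
pose d := (2^-1 : R)%:C * (cos c +i* sin c).
rewrite /rtrig; have -> : (fun t => (cos (2 * pi * t + c))%:C) =
    (fun t => d * ek 1 t + d^* * ek (-1) t).
  apply/funext => t; apply: complex_eq; rewrite -(ekJ 1) ek1 /d /expi !cRIE /=.
    by rewrite cosD; field.
  by field.
by apply: trigD; exact: trig_ek.
Qed.

Lemma mI01 : measurable (@I01 R).
Proof. exact: measurable_itv. Qed.

Lemma leb_I01 : leb (@I01 R) = 1%E.
Proof. by rewrite lebesgue_measure_itv /= lte_fin ltr01 oppr0 adde0. Qed.

Lemma leb_I01_fin : (leb (@I01 R) < +oo)%E.
Proof. by rewrite leb_I01 ltry. Qed.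

(** The fundamental theorem of calculus for an antiderivative with equal values at both ends; the
    bound on [g] provides the integrability with which [[0, 1[] is replaced by [[0, 1]]. *)
Let cintegral (G g : R -> R) : (forall x : R, is_derive x 1 G (g x)) ->
  continuous g -> G 1 = G 0 -> measurable_fun setT g -> (forall t, `|g t| <= 1) ->
  \int[leb]_(t in I01) g t = 0.
Proof.
move=> dG cg G10 mg g1.
have cG : continuous G.
  by move=> x; apply: differentiable_continuous; apply/derivable1_diffP; case: (dG x).
rewrite Rintegral_itv_bndo_bndc; last first.
  by apply: (rI_bounded _ _ _ 1 mI01 leb_I01_fin mg) => t _; exact: g1.
rewrite /Rintegral (@continuous_FTC2 _ g G)//.
- by rewrite G10 -EFinB subrr.
- exact: continuous_subspaceT.
- split.
  + by move=> x _; case: (dG x).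
  + exact: cvg_at_right_filter (cG 0).
  + exact: cvg_at_left_filter (cG 1).
- by move=> x _; rewrite derive1E; case: (dG x).
Qed.

Lemma cint_ek k : cint leb I01 (ek k) = (k == 0)%:R.
Proof.
have [->|k0] := eqVneq k 0.
  rewrite (eq_cint _ _ _ (fun _ => 1)) => [|t _]; last exact: ek0.
  exact: cint_cst mI01 leb_I01.
have [m1 m2] := measurable_ek k.
pose w : R := 2 * pi * k%:~R.
have w0 : w != 0.
  apply/mulf_neq0; last by rewrite intr_eq0.
  by apply/mulf_neq0; rewrite ?pnatr_eq0// gt_eqF ?pi_gt0.
have ekE : ek k = fun t => cos (w * t) +i* sin (w * t).
  by apply/funext => t; rewrite /ek /expi /w !mulrA.
have cl : continuous (fun t : R => w * t).
  by move=> x; apply: cvgM; [exact: cvg_cst|exact: cvg_id].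
have e1 : ek k 1 = 1.
  have x1 : expi 1 = 1 :> R[i] by rewrite /expi mulr1 mulrC mulr_natr cos2pi sin2pi.
  by case: (k) => n; rewrite ?NegzE -?ekJ -ekX x1 expr1n ?rmorph1.
have [c1 s1] : cos w = 1 /\ sin w = 0.
  by move: e1; rewrite ekE mulr1 => -[-> ->].
clearbody w; rewrite mulr0n ekE; apply: complex_eq => /=.
- apply: (cintegral (fun t => w^-1 * sin (w * t))).
  + move=> x; apply: is_derive_eq; rewrite /GRing.scale /=; by field.
  + by move=> x; apply: continuous_comp; [exact: cl|exact: continuous_cos].
  + by rewrite mulr1 mulr0 sin0 s1.
  + by move: m1; under eq_fun do rewrite ekE.
  + by move=> t; rewrite ler_norml cos_geN1 cos_le1.
- apply: (cintegral (fun t => - (w^-1 * cos (w * t)))).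
  + move=> x; apply: is_derive_eq; rewrite /GRing.scale /=; by field.
  + by move=> x; apply: continuous_comp; [exact: cl|exact: continuous_sin].
  + by rewrite mulr1 mulr0 cos0 c1.
  + by move: m2; under eq_fun do rewrite ekE.
  + by move=> t; rewrite ler_norml sin_geN1 sin_le1.
Qed.

End TrigonometricPolynomials.

(** * Approximation of indicators by trigonometric polynomials *)

Section Density.
Context {R : realType}.
Local Open Scope ring_scope.
Implicit Types (nu : {measure set (measurableTypeR R) -> \bar R})
  (D A : set (measurableTypeR R)) (h q u v y : R -> R).

Lemma cvgn_le_cst (u : nat -> R) (l c : R) :
  u n @[n --> \oo] --> l -> (forall n, u n <= c) -> l <= c.
Proof.
move=> ul uc; rewrite leNgt; apply/negP => cl.
have cl0 : 0 < l - c by rewrite subr_gt0.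
move/cvgrPdist_lt : ul => /(_ _ cl0)[N _ /(_ N (leqnn N))].
by have := uc N; have := ler_norm (l - u N); lra.
Qed.

Lemma Rintegral_dominated_cvg nu D (u_ : nat -> R -> R) u v : measurable D ->
  (forall n, measurable_fun setT (u_ n)) ->
  (forall t, D t -> u_ n t @[n --> \oo] --> u t) ->
  rI nu D v -> (forall n t, D t -> `|u_ n t| <= v t) ->
  \int[nu]_(t in D) u_ n t @[n --> \oo] --> \int[nu]_(t in D) u t.
Proof.
move=> mD mu uu iv uv.
have m n : measurable_fun D (fun t => (u_ n t)%:E).
  by apply/measurable_EFinP; exact: (measurable_funTS (mu n)).
have c t : D t -> (u_ n t)%:E @[n --> \oo] --> (u t)%:E.
  by move=> Dt; apply: cvg_EFin; [exact: nearW|exact: uu].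
have f t : D t -> (v t)%:E \is a fin_num by [].
have b n t : D t -> (`|(u_ n t)%:E| <= (v t)%:E)%E.
  by move=> Dt; rewrite abse_EFin lee_fin; exact: uv.
have iu : rI nu D u.
  apply: (le_integrable mD _ _ iv).
    apply/measurable_EFinP; apply: (@measurable_fun_cvg _ _ _ _ u_) => // n.
    exact: (measurable_funTS (mu n)).
  move=> t Dt; rewrite !abse_EFin lee_fin (ger0_norm (le_trans (normr_ge0 _) (uv 0%N t Dt))).
  apply: (cvgn_le_cst (fun n => `|u_ n t|)); first by apply: cvg_norm; exact: uu.
  by move=> n; exact: uv.
have := dominated_cvg mD m c f iv b.
by rewrite rI_EFin// => /fine_cvg.
Qed.

(** The constraint [0 <= q <= 1] makes approximability stable under products and is what the later
    weak-convergence estimates use. The measure is a parameter because both Lebesgue measure and its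
    sum with [mu] will occur. *)
Definition trig_approx nu h : Prop := forall e : R, 0 < e -> exists q,
  [/\ rtrig q, forall t, 0 <= q t <= 1 & \int[nu]_(t in I01) `|h t - q t| <= e].

Definition unit_valued h : Prop :=
  measurable_fun setT h /\ forall t, 0 <= h t <= 1.

Lemma unit_valued_indic A : measurable A -> unit_valued \1_A.
Proof.
move=> mA; split; first exact: measurable_indic.
by move=> t; rewrite indicE; case: (t \in A); rewrite ?lexx ?ler01.
Qed.

Section FiniteMeasure.
Context (nu : {measure set (measurableTypeR R) -> \bar R}).
Context (nu_fin : (nu I01 < +oo)%E).

Let rI_unit_dist h q : unit_valued h -> unit_valued q ->
  rI nu I01 (fun t => `|h t - q t|).
Proof.
move=> [mh h01] [mq q01]; apply: (rI_bounded _ _ _ 1) => //; first exact: mI01.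
  by apply: measurableT_comp => //; exact: measurable_funB.
move=> t _; rewrite normr_id ler_norml.
by move: (h01 t) (q01 t) => /andP[? ?] /andP[? ?]; apply/andP; split; lra.
Qed.

Lemma trig_approx_rtrig q : rtrig q -> (forall t, 0 <= q t <= 1) -> trig_approx nu q.
Proof.
move=> tq q01 e e0; exists q; split => //.
rewrite (@eq_Rintegral _ _ _ nu I01 (fun _ => 0)) => [|t _]; last by rewrite subrr normr0.
by rewrite Rintegral_cst ?mul0r ?ltW//; exact: mI01.
Qed.

Lemma trig_approx_lim (h_ : nat -> R -> R) h :
  (forall n, unit_valued (h_ n)) -> unit_valued h ->
  (forall n, trig_approx nu (h_ n)) ->
  (forall t, I01 t -> h_ n t @[n --> \oo] --> h t) -> trig_approx nu h.
Proof.
move=> u1 uh ah hh e e0.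
have : \int[nu]_(t in I01) `|h t - h_ n t| @[n --> \oo] --> (\int[nu]_(t in I01) (0 : R)).
  apply: (Rintegral_dominated_cvg _ _ _ _ (fun _ => 1)); first exact: mI01.
  - move=> n; apply: measurableT_comp => //; apply: measurable_funB.
      by case: uh.
    by case: (u1 n).
  - move=> t It; rewrite -(normr0 R) -(subrr (h t)); apply: cvg_norm.
    by apply: cvgB; [exact: cvg_cst|exact: hh].
  - by apply: rI_cst => //; exact: mI01.
  - move=> n t _; rewrite normr_id ler_norml.
    by move: (uh.2 t) ((u1 n).2 t) => /andP[? ?] /andP[? ?]; apply/andP; split; lra.
rewrite Rintegral_cst ?mul0r; last exact: mI01.
move=> /cvgrPdist_le /(_ (e / 2)) [|N _ /(_ N (leqnn N))]; first by rewrite divr_gt0.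
rewrite sub0r normrN ger0_norm ?Rintegral_ge0// => hN.
have [|q [tq q01 hq]] := ah N (e / 2); first by rewrite divr_gt0.
have uq : unit_valued q by split => //; exact: rtrig_measurable.
exists q; split => //; apply: (@le_trans _ _ (\int[nu]_(t in I01)
    (`|h t - h_ N t| + `|h_ N t - q t|))).
  apply: le_Rintegral; [exact: mI01|exact: rI_unit_dist| |].
    by apply: rID; [exact: mI01|exact: rI_unit_dist|exact: rI_unit_dist].
  by move=> t _; exact: ler_distD.
rewrite RintegralD; [|exact: mI01|exact: rI_unit_dist|exact: rI_unit_dist].
by rewrite (le_trans (lerD hN hq))// -splitr.
Qed.

Lemma trig_approxC h : unit_valued h -> trig_approx nu h ->
  trig_approx nu (fun t => 1 - h t).
Proof.
move=> uh ah e /ah[q [tq q01 hq]]; exists (fun t => 1 - q t); split.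
- by apply: rtrigB => //; exact: rtrig_cst.
- by move=> t; move: (q01 t) => /andP[? ?]; apply/andP; split; lra.
- apply: le_trans hq; rewrite le_eqVlt; apply/orP; left; apply/eqP.
  apply: eq_Rintegral => t _.
  have -> : 1 - h t - (1 - q t) = q t - h t by ring.
  by rewrite distrC.
Qed.

Lemma trig_approxM h k : unit_valued h -> unit_valued k ->
  trig_approx nu h -> trig_approx nu k -> trig_approx nu (fun t => h t * k t).
Proof.
move=> uh uk ah ak e e0; have e2 : 0 < e / 2 by rewrite divr_gt0.
have [q [tq q01 hq]] := ah _ e2; have [p [tp p01 kp]] := ak _ e2.
have uq : unit_valued q by split => //; exact: rtrig_measurable.
have up : unit_valued p by split => //; exact: rtrig_measurable.
have uM a b : unit_valued a -> unit_valued b -> unit_valued (fun t => a t * b t).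
  move=> [ma a01] [mb b01]; split; first exact: measurable_funM.
  move=> t; move: (a01 t) (b01 t) => /andP[? ?] /andP[? ?].
  by rewrite mulr_ge0//= mulr_ile1.
exists (fun t => q t * p t); split.
- exact: rtrigM.
- by move=> t; exact: (uM _ _ uq up).2.
- apply: (@le_trans _ _ (\int[nu]_(t in I01) (`|h t - q t| + `|k t - p t|))).
    apply: le_Rintegral; [exact: mI01|apply: rI_unit_dist; exact: uM| |].
      by apply: rID; [exact: mI01|exact: rI_unit_dist|exact: rI_unit_dist].
    move=> t _.
    have -> : h t * k t - q t * p t = (h t - q t) * k t + q t * (k t - p t) by ring.
    apply: (le_trans (ler_normD _ _)); rewrite !normrM; apply: lerD.
    + by rewrite ler_piMr// ger0_norm; case/andP: (uk.2 t).
    + by rewrite ler_piMl// ger0_norm; case/andP: (q01 t).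
  rewrite RintegralD; [|exact: mI01|exact: rI_unit_dist|exact: rI_unit_dist].
  by rewrite (le_trans (lerD hq kp))// -splitr.
Qed.

Lemma bernoulli (x : R) n : -1 <= x -> 1 + n%:R * x <= (1 + x) ^+ n.
Proof.
move=> x1; elim: n => [|n IH]; first by rewrite mul0r addr0 expr0.
rewrite exprS (le_trans _ (ler_wpM2l _ IH))//; last lra.
have n0 : 0 <= n%:R :> R by [].
by rewrite -natr1; nra.
Qed.

(* Stone's polynomials [(1 - x^m)^(2^m)] approximate the indicator of
   [x < 1/2]; letting the threshold tend to [1/2] together with [m] makes
   them converge also where [y = 0]. *)
Lemma trig_approx_pos y : rtrig y -> (forall t, `|y t| <= 1) ->
  trig_approx nu \1_[set t | 0 < y t].
Proof.
move=> ty y1.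
pose e n : R := n.+1%:R^-1.
have e01 n : 0 < e n <= 1.
  by rewrite /e invr_gt0 ltr0n/= invf_le1 ?ler1n ?ltr0n.
pose x n t := 1 - (y t - e n) / 2.
have x02 n t : 0 <= x n t <= 2.
  move: (y1 t) (e01 n); rewrite /x ler_norml => /andP[? ?] /andP[? ?].
  by apply/andP; split; lra.
(* Quadratic, so that [m n * e n = n + 1] still tends to infinity; this yields [p n t <= 2 * e n]
   where [y t <= 0]. *)
pose m n := (n.+1 ^ 2)%N.
pose w n t := (x n t / 2) ^+ m n.
have w01 n t : 0 <= w n t <= 1.
  move: (x02 n t) => /andP[? ?]; rewrite /w exprn_ge0 ?exprn_ile1//; lra.
pose p n t := (1 - w n t) ^+ (2 ^ m n).
have p01 n t : 0 <= p n t <= 1.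
  move: (w01 n t) => /andP[? ?]; rewrite /p exprn_ge0 ?exprn_ile1//; lra.
have tp n : rtrig (p n).
  apply: rtrigX; apply: rtrigB; first exact: rtrig_cst.
  apply: rtrigX; rewrite /x; apply: rtrigM; last exact: rtrig_cst.
  apply: rtrigB; first exact: rtrig_cst.
  apply: rtrigM; last exact: rtrig_cst.
  by apply: rtrigB => //; exact: rtrig_cst.
have xw n t : (2 ^ m n)%:R * w n t = x n t ^+ m n.
  by rewrite /w expr_div_n natrX mulrC divfK// expf_neq0.
have mpos : measurable [set t | 0 < y t].
  rewrite -[X in measurable X]setTI.
  have -> : [set t | 0 < y t] = y @^-1` `]0, +oo[%classic.
    by apply/seteqP; split => t /=; rewrite in_itv/= andbT.
  by apply: rtrig_measurable.
apply: (trig_approx_lim p).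
- by move=> n; split; [exact: rtrig_measurable|exact: p01].
- exact: unit_valued_indic.
- by move=> n; exact: trig_approx_rtrig.
- move=> t _; rewrite indicE; have [y0|y0] := ltP 0 (y t).
  + rewrite mem_set//=.
    (* Once [e n < y t / 2] one has [x n t <= r < 1], and Bernoulli's inequality bounds [p n t]
       below by [1 - r ^+ n]. *)
    pose r := 1 - y t / 4.
    have r01 : 0 <= r < 1.
      move: (y1 t); rewrite /r ler_norml => /andP[? ?].
      by apply/andP; split; lra.
    have re : r ^+ n @[n --> \oo] --> (0 : R).
      by apply: cvg_expr; rewrite ger0_norm; case/andP: r01.
    have e0 : e n @[n --> \oo] --> (0 : R) by exact: cvg_harmonic.
    apply: (@squeeze_cvgr _ _ _ _ (fun n => 1 - r ^+ n) (fun _ => 1)).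
    * have y20 : 0 < y t / 2 by rewrite divr_gt0.
      move/cvgrPdist_lt : e0 => /(_ _ y20); apply: filterS => n.
      rewrite sub0r normrN gtr0_norm; last by case/andP: (e01 n).
      move=> en; case/andP: (p01 n t) => _ ->; rewrite andbT.
      have xr : 0 <= x n t <= r.
        case/andP: (x02 n t) => -> _ /=; rewrite /x /r; lra.
      apply: (@le_trans _ _ (1 - x n t ^+ m n)).
        rewrite lerD2l lerN2; case/andP: r01 => r0 r1; case/andP: xr => x0 xr.
        apply: (@le_trans _ _ (r ^+ m n)); first by rewrite lerXn2r// nnegrE.
        apply: ler_wiXn2l => //; first exact: ltW.
        by rewrite /m expnS expn1 (leq_trans (leqnSn n))// leq_pmulr.
      rewrite -xw -mulrN /p; apply: bernoulli; case/andP: (w01 n t); lra.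
    * by rewrite -[X in _ --> X]subr0; apply: cvgB => //; exact: cvg_cst.
    * exact: cvg_cst.
  + rewrite memNset/=; last by rewrite ltNge y0.
    have e0 : 2 * e n @[n --> \oo] --> (0 : R).
      rewrite -[X in _ --> X](mulr0 2); apply: cvgM; first exact: cvg_cst.
      exact: cvg_harmonic.
    apply: (@squeeze_cvgr _ _ _ _ (fun _ => 0) (fun n => 2 * e n)) => //;
      last exact: cvg_cst.
    apply: nearW => n; case/andP: (p01 n t) => -> _ /=.
    case/andP: (w01 n t) => w0 w1.
    (* Since [(1 - w) (1 + w) <= 1], an upper bound on [p] follows from a lower bound on the power
       of [1 + w], to which Bernoulli's inequality applies. *)
    have h1 : p n t * (1 + w n t) ^+ (2 ^ m n) <= 1.
      rewrite /p -exprMn exprn_ile1//; nra.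
    have h2 : 1 + x n t ^+ m n <= (1 + w n t) ^+ (2 ^ m n).
      by rewrite -xw; apply: bernoulli; lra.
    have en : e n * n.+1%:R = 1 by rewrite /e mulVf.
    have h3 : 1 + (m n)%:R * (e n / 2) <= x n t ^+ m n.
      have xe : 1 + e n / 2 <= x n t by rewrite /x; lra.
      have e20 : 0 <= e n / 2 by case/andP: (e01 n) => ? _; lra.
      apply: (le_trans (bernoulli _ _ _)); first lra.
      by rewrite lerXn2r// nnegrE; lra.
    have h4 : (m n)%:R * (e n / 2) = n.+1%:R / 2.
      by rewrite /m natrX expr2 -mulrA (mulrA _ (e n)) (mulrC _ (e n)) en mul1r.
    have p0 : 0 <= p n t by case/andP: (p01 n t).
    have n0 : 0 < n.+1%:R :> R by rewrite ltr0n.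
    have h5 : p n t * (n.+1%:R / 2) <= 1.
      apply: le_trans h1; apply: ler_wpM2l => //; lra.
    have e0' : 0 < e n by case/andP: (e01 n).
    nra.
Qed.

Let ray (a : R) : 0 <= a -> trig_approx nu \1_(`]a, +oo[%classic).
Proof.
move=> a0; have mI : measurable (`]a, +oo[%classic : set R) by exact: measurable_itv.
have [a1|a1] := leP 1 a.
  apply: (trig_approx_lim (fun _ _ => 0)); last 1 first.
  - move=> t; rewrite /I01 /= in_itv/= => /andP[t0 t1]; rewrite indicE memNset.
      exact: cvg_cst.
    by rewrite /= in_itv/= andbT; apply/negP; rewrite -leNgt; lra.
  - by move=> n; split; [exact: measurable_cst|move=> t; rewrite lexx ler01].
  - exact: unit_valued_indic.
  - by move=> n; apply: trig_approx_rtrig; [exact: rtrig_cst|move=> t; rewrite lexx ler01].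
(* The half-frequency sines are not trigonometric polynomials of period [1], but their product is.
   On [[0, 1[] the second factor is nonnegative, and the product is positive exactly on []a, 1[]. *)
pose y t := sin (pi * (t - a)) * sin (pi * (1 - t)).
have ty : rtrig y.
  have -> : y = (fun t => (2^-1) * (cos (2 * pi * t + (- pi * (1 + a))) - cos (pi * (1 - a)))).
    apply/funext => t; rewrite /y.
    have -> : 2 * pi * t + - pi * (1 + a) = pi * (t - a) - pi * (1 - t) by ring.
    have -> : pi * (1 - a) = pi * (t - a) + pi * (1 - t) by ring.
    by rewrite cosB cosD; field.
  apply: rtrigM; first exact: rtrig_cst.
  by apply: rtrigB; [exact: rtrig_cos|exact: rtrig_cst].
have y1 t : `|y t| <= 1.
  by rewrite /y normrM mulr_ile1// ler_norml sin_geN1 sin_le1.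
have := trig_approx_pos y ty y1 => ay.
apply: (trig_approx_lim (fun _ => \1_[set t | 0 < y t])).
- move=> _; apply: unit_valued_indic.
  rewrite -[X in measurable X]setTI.
  have -> : [set t | 0 < y t] = y @^-1` `]0, +oo[%classic.
    by apply/seteqP; split => t /=; rewrite in_itv/= andbT.
  by apply: rtrig_measurable.
- exact: unit_valued_indic.
- by [].
- move=> t; rewrite /I01 /= in_itv/= => /andP[t0 t1].
  suff -> : \1_[set t | 0 < y t] t = \1_(`]a, +oo[%classic) t :> R by exact: cvg_cst.
  rewrite !indicE; congr (nat_of_bool _)%:R; apply/idP/idP; rewrite !inE /= in_itv/= andbT.
  + apply: contraPT; rewrite -leNgt => ta; apply/negP; rewrite -leNgt /y.
    rewrite mulr_le0_ge0//.
      rewrite -oppr_ge0 -sinN -mulrN opprB sin_ge0_pi//.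
      by have := pi_gt0 R; move=> pi0; apply/andP; split; nra.
    rewrite sin_ge0_pi//.
    by have := pi_gt0 R; move=> pi0; apply/andP; split; nra.
  + move=> ta; have pi0 := pi_gt0 R.
    by apply: mulr_gt0; apply: sin_gt0_pi; apply/andP; split; nra.
Qed.

(** The measurable sets with approximable indicator form a sigma-algebra, and it contains the rays
    that generate the Borel sets. *)
Lemma trig_approx_indic A : measurable A -> trig_approx nu \1_A.
Proof.
suff H : (RGenOInfty.G (R:=R)).-sigma.-measurable `<=`
    [set B : set (measurableTypeR R) | measurable B /\ trig_approx nu \1_B].
  by move=> mA; have [] : measurable A /\ trig_approx nu \1_A;
    [apply: H; rewrite -RGenOInfty.measurableE|].
apply: smallest_sub; last first.
  move=> _ [a ->]; split; first exact: measurable_itv.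
  have [a0|a0] := leP 0 a; first exact: ray.
  apply: (trig_approx_lim (fun _ _ => 1)).
  - by move=> n; split; [exact: measurable_cst|move=> t; rewrite lexx ler01].
  - by apply: unit_valued_indic; exact: measurable_itv.
  - by move=> n; apply: trig_approx_rtrig; [exact: rtrig_cst|move=> t; rewrite lexx ler01].
  - move=> t; rewrite /I01 /= in_itv/= => /andP[t0 t1]; rewrite indicE mem_set.
      exact: cvg_cst.
    by rewrite /= in_itv/= andbT (lt_le_trans a0).
have C B : measurable B -> trig_approx nu \1_B -> trig_approx nu \1_(~` B).
  move=> mB aB; have -> : \1_(~` B) = (fun t => 1 - \1_B t) :> (R -> R).
    by apply/funext => t; rewrite !indicE in_setC; case: (t \in B); rewrite ?subr0 ?subrr.
  by apply: trig_approxC => //; exact: unit_valued_indic.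
split.
- split; first exact: measurable0.
  have -> : \1_set0 = (fun _ => 0) :> (R -> R) by apply/funext => t; rewrite indic0.
  by apply: trig_approx_rtrig; [exact: rtrig_cst|move=> t; rewrite lexx ler01].
- by move=> B [mB aB]; rewrite setTD; split; [exact: measurableC|exact: C].
- move=> B hB; have mB n : measurable (B n) by case: (hB n).
  split; first exact: bigcupT_measurable.
  (* A countable union is reached as the limit of the complements of the finite intersections [P n],
     whose indicators are products. *)
  pose P n := \big[setI/setT]_(i < n) ~` B i.
  have PE n t : P n t <-> forall k, (k < n)%N -> ~ B k t.
    elim: n => [|n IH]; first by rewrite /P big_ord0.
    rewrite /P big_ord_recr /=; split => [[/IH Pn Bn] k|PB].
      by rewrite ltnS leq_eqVlt => /orP[/eqP ->|/Pn].
    by split; [apply/IH => k kn; apply: PB; exact: ltnW|exact: PB].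
  have mP n : measurable (P n).
    by apply: bigsetI_measurable => i _; exact: measurableC.
  have aP n : trig_approx nu \1_(P n).
    elim: n => [|n IH].
      rewrite /P big_ord0.
      have -> : \1_setT = (fun _ => 1) :> (R -> R) by apply/funext => t; rewrite indicT.
      by apply: trig_approx_rtrig; [exact: rtrig_cst|move=> t; rewrite lexx ler01].
    rewrite /P big_ord_recr /=.
    have -> : \1_(P n `&` ~` B n) = (fun t => \1_(P n) t * \1_(~` B n) t) :> (R -> R).
      by apply/funext => t; rewrite !indicE in_setI; case: (t \in P n); rewrite ?mul1r ?mul0r.
    apply: trig_approxM => //.
    + exact: (unit_valued_indic _ (mP n)).
    + exact: (unit_valued_indic _ (measurableC (mB n))).
    + by case: (hB n) => ? ?; exact: C.
  apply: (trig_approx_lim (fun n => \1_(~` P n))).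
  + by move=> n; exact: (unit_valued_indic _ (measurableC (mP n))).
  + by apply: unit_valued_indic; exact: bigcupT_measurable.
  + by move=> n; apply: C; [exact: mP|exact: aP].
  + move=> t _; have [[k _ Bk]|nB] := pselect ((\bigcup_k B k) t).
      rewrite indicE mem_set; last by exists k.
      apply: cvg_near_cst; exists k.+1 => // n /= kn; rewrite indicE mem_set//= => Pt.
      by move/PE : Pt => /(_ k kn).
    rewrite indicE memNset//; apply: cvg_near_cst; apply: nearW => n.
    rewrite indicE memNset//= => nP; apply: nP.
    by apply/PE => k _ Bk; apply: nB; exists k.
Qed.

End FiniteMeasure.
End Density.

(** * Limits of complex-valued functions along a filter *)

Section ComplexLimits.
Context {R : realType} {T : Type} (F : set_system T) {FF : ProperFilter F}.
Local Open Scope ring_scope.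
Implicit Types (f g : T -> R[i]) (a b : R[i]).

(* [ccvg_left] and [ccvg_right] are the instances [F = 1^'-] and [F = 1^'+]. *)
Definition ccvg f a : Prop :=
  (cRe (f x) @[x --> F] --> cRe a) /\ (cIm (f x) @[x --> F] --> cIm a).

Lemma ccvg_cst a : ccvg (fun _ => a) a.
Proof. by split; exact: cvg_cst. Qed.

Lemma ccvgD f g a b : ccvg f a -> ccvg g b -> ccvg (fun x => f x + g x) (a + b).
Proof.
move=> [f1 f2] [g1 g2]; split.
- by rewrite cReD; under eq_fun do rewrite cReD; exact: cvgD.
- by rewrite cImD; under eq_fun do rewrite cImD; exact: cvgD.
Qed.

Lemma ccvgM f g a b : ccvg f a -> ccvg g b -> ccvg (fun x => f x * g x) (a * b).
Proof.
move=> [f1 f2] [g1 g2]; split.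
- by rewrite cReM; under eq_fun do rewrite cReM; apply: cvgB; exact: cvgM.
- by rewrite cImM; under eq_fun do rewrite cImM; apply: cvgD; exact: cvgM.
Qed.

Lemma ccvgB f g a b : ccvg f a -> ccvg g b -> ccvg (fun x => f x - g x) (a - b).
Proof.
move=> fa gb; have := ccvgD _ _ _ _ fa (ccvgM _ _ _ _ (ccvg_cst (-1)) gb).
by rewrite mulN1r; under eq_fun do rewrite mulN1r.
Qed.

Lemma ccvgJ f a : ccvg f a -> ccvg (fun x => (f x)^*) (a^*).
Proof.
move=> [f1 f2]; split.
- by rewrite cReJ; under eq_fun do rewrite cReJ.
- by rewrite cImJ; under eq_fun do rewrite cImJ; exact: cvgN.
Qed.

Lemma ccvgV f a : a != 0 -> ccvg f a -> ccvg (fun x => (f x)^-1) (a^-1).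
Proof.
move=> a0 [f1 f2]; have c2 : (cabs2 (f x))^-1 @[x --> F] --> (cabs2 a)^-1.
  apply: cvgV; first by apply: contra_neq a0; exact: cabs2_eq0.
  rewrite cabs2E; under eq_fun do rewrite cabs2E.
  by apply: cvgD; rewrite expr2; under eq_fun do rewrite expr2; exact: cvgM.
split.
- by rewrite cReV; under eq_fun do rewrite cReV; exact: cvgM.
- by rewrite cImV; under eq_fun do rewrite cImV; apply: cvgN; exact: cvgM.
Qed.

Lemma ccvg_div f g a b : b != 0 -> ccvg f a -> ccvg g b ->
  ccvg (fun x => f x / g x) (a / b).
Proof. by move=> b0 fa gb; apply: ccvgM => //; exact: ccvgV. Qed.

Lemma ccvg_unique f a b : ccvg f a -> ccvg f b -> a = b.
Proof.
move=> [f1 f2] [g1 g2].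
by apply: complex_eq; [exact: (cvg_unique _ f1 g1)|exact: (cvg_unique _ f2 g2)].
Qed.

Lemma ccvg0 f (u : T -> R) : (forall x, 0 <= u x) ->
  (forall x, cabs2 (f x) <= u x ^+ 2) -> u x @[x --> F] --> (0 : R) -> ccvg f 0.
Proof.
move=> u0 fu uc; have uN : - u x @[x --> F] --> (0 : R).
  by rewrite -oppr0; exact: cvgN.
split; apply: (@squeeze_cvgr _ _ _ _ (fun x => - u x) u) => //; apply: nearW => x;
  by rewrite -ler_norml; first [exact: cRe_abs_le|exact: cIm_abs_le].
Qed.

End ComplexLimits.

(** * Weak limits and pointwise limits agree *)

Section UniquenessTheorems.
Context {R : realType}.
Local Open Scope ring_scope.
Implicit Types (A E : set (measurableTypeR R)) (q u y : R -> R).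
Local Notation mI := (@mI01 R).
Local Notation fI := (@leb_I01_fin R).

Lemma Rintegral_indic_mul E u : E `<=` I01 ->
  \int[leb]_(t in E) u t = \int[leb]_(t in I01) (\1_E t * u t).
Proof.
move=> EI; rewrite -[X in Rintegral _ X](setIidr EI) Rintegral_mkcondr.
apply: eq_Rintegral => t _; rewrite patchE indicE.
by case: (t \in E); rewrite ?mul1r ?mul0r.
Qed.

Lemma rI_sqr u : measurable_fun setT u -> rI leb I01 (fun t => u t ^+ 2) ->
  rI leb I01 u.
Proof.
move=> mu iu; apply: (rI_dom _ _ _ (fun t => 1 + u t ^+ 2) mI mu).
  by apply: rID => //; [exact: mI|apply: rI_cst; [exact: mI|exact: fI]].
move=> t _; rewrite -[_ ^+ 2]real_normK ?num_real//.
by have := normr_ge0 (u t); nra.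
Qed.

(** Replacing the indicator by a polynomial [q] costs the integral of [(\1_E - q) * u_ n]. Only an
    [L^1] bound on [\1_E - q] is available, but [|\1_E - q| <= 1], so a weighted AM-GM inequality
    separates it from the bounded [L^2] norm of [u_ n]. *)
Lemma weak_cvg_indic (u_ : nat -> R -> R) (K : R) E : measurable E -> E `<=` I01 ->
  (forall n, measurable_fun setT (u_ n)) ->
  (forall n, rI leb I01 (fun t => u_ n t ^+ 2)) ->
  (forall n, \int[leb]_(t in I01) (u_ n t ^+ 2) <= K) ->
  (forall q, rtrig q -> (\int[leb]_(t in I01) (q t * u_ n t)) @[n --> \oo] --> (0 : R)) ->
  \int[leb]_(t in E) u_ n t @[n --> \oo] --> (0 : R).
Proof.
move=> mE EI mu iu uK uq; apply/cvgrPdist_le => e e0.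
have K0 : 0 <= K.
  apply: le_trans (uK 0%N); apply: Rintegral_ge0 => t _; exact: sqr_ge0.
(* With this weight the [L^2] term [d / 2 * K] is at most [e / 4], and the accuracy [e * d / 2]
   asked of [q] makes the other term at most [e / 4]. Adding [1] to [K] covers [K = 0]. *)
pose d := e / (2 * (K + 1)).
have d0 : 0 < d by rewrite divr_gt0// mulr_gt0// ltr_pwDr.
have dK : d * (2 * (K + 1)) = e.
  by rewrite /d divfK// gt_eqF// mulr_gt0// ltr_pwDr.
have [|q [tq q01 qE]] := trig_approx_indic leb fI E mE (e * d / 2).
  by rewrite divr_gt0// mulr_gt0.
have e4 : 0 < e / 4 by rewrite divr_gt0.
have /cvgrPdist_le /(_ _ e4) := uq q tq; apply: filterS => n.
rewrite !sub0r !normrN => hn; rewrite Rintegral_indic_mul//.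
have mq := rtrig_measurable _ tq; have iun := rI_sqr _ (mu n) (iu n).
have mul1 (w : R -> R) : measurable_fun setT w -> (forall t, `|w t| <= 1) ->
    rI leb I01 (fun t => w t * u_ n t).
  move=> mw w1; apply: (rI_dom _ _ _ (fun t => `|u_ n t|) mI).
  - exact: measurable_funM.
  - exact: (integrable_norm iun).
  - by move=> t _; rewrite normrM ler_piMl.
have q1 t : `|q t| <= 1 by rewrite ger0_norm; case/andP: (q01 t).
have uE := unit_valued_indic E mE.
have E1 t : `|\1_E t| <= 1 :> R.
  by rewrite ger0_norm; case/andP: (uE.2 t).
have d1 t : `|\1_E t - q t| <= 1.
  rewrite ler_norml; move: (q01 t) (uE.2 t) => /andP[? ?] /andP[? ?].
  by apply/andP; split; lra.
have mdist : measurable_fun setT (fun t => \1_E t - q t).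
  by apply: measurable_funB => //; case: uE.
have -> : (fun t => \1_E t * u_ n t) =
    (fun t => q t * u_ n t + (\1_E t - q t) * u_ n t).
  by apply/funext => t; ring.
have i1 := mul1 _ mq q1; have i2 := mul1 _ mdist d1.
rewrite RintegralD//; last exact: mI.
have idist : rI leb I01 (fun t => `|\1_E t - q t|).
  apply: (rI_bounded _ _ _ 1 mI fI) => [|t _]; last by rewrite normr_id.
  exact: measurableT_comp.
have h2 : `|\int[leb]_(t in I01) ((\1_E t - q t) * u_ n t)| <=
    \int[leb]_(t in I01) ((2 * d)^-1 * `|\1_E t - q t| + d / 2 * u_ n t ^+ 2).
  apply: (le_trans (le_normr_Rintegral mI i2)); apply: le_Rintegral => //.
  - exact: mI.
  - exact: (integrable_norm i2).
  - by apply: rID; [exact: mI|apply: rIZ => //; exact: mI|apply: rIZ => //; exact: mI].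
  - (* AM-GM: [x w <= x / (2 d) + d w^2 / 2] when [0 <= x <= 1] *)
    move=> t _; rewrite normrM -[u_ n t ^+ 2]real_normK ?num_real//.
    have := normr_ge0 (u_ n t); have := normr_ge0 (\1_E t - q t); have := d1 t.
    set x := `|\1_E t - q t|; set w := `|u_ n t| => x1 x0 w0.
    rewrite invfM -subr_ge0.
    have -> : 2^-1 * d^-1 * x + d / 2 * w ^+ 2 - x * w =
      (2 * d)^-1 * (x * (1 - x) + (x - d * w) ^+ 2) by field; rewrite gt_eqF.
    apply: mulr_ge0; first by rewrite invr_ge0 mulr_ge0// ltW.
    by apply: addr_ge0; [rewrite mulr_ge0// subr_ge0|exact: sqr_ge0].
move: h2; rewrite RintegralD; [|exact: mI|apply: rIZ => //; exact: mI
  |apply: rIZ => //; exact: mI].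
rewrite (RintegralZl _ mI idist) (RintegralZl _ mI (iu n)) => h2.
apply: (le_trans (ler_normD _ _)).
have h3 : (2 * d)^-1 * \int[leb]_(t in I01) `|\1_E t - q t| <= e / 4.
  apply: (@le_trans _ _ ((2 * d)^-1 * (e * d / 2))).
    by rewrite ler_wpM2l// invr_ge0 mulr_ge0// ltW.
  rewrite le_eqVlt; apply/orP; left; apply/eqP; field; by rewrite gt_eqF.
have h4 : d / 2 * \int[leb]_(t in I01) (u_ n t ^+ 2) <= e / 4.
  apply: (@le_trans _ _ (d / 2 * K)).
    by rewrite ler_wpM2l// divr_ge0// ltW.
  rewrite -dK; have -> : d * (2 * (K + 1)) / 4 = d / 2 * K + d / 2 by field.
  by rewrite lerDl divr_ge0// ltW.
apply: (le_trans (lerD hn (le_trans h2 (lerD h3 h4)))).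
have -> : e / 4 + (e / 4 + e / 4) = e - e / 4 by field.
by rewrite gerBl ltW.
Qed.

(** On a set where all [u_ n] are bounded by the same [M], dominated convergence carries the
    vanishing weak limit over to [y]. A convergent sequence is bounded, so countably many such sets
    exhaust the circle up to a null set. *)
Lemma weak_cvg_ae0 (u_ : nat -> R -> R) y (K : R) :
  (forall n, measurable_fun setT (u_ n)) ->
  (forall n, rI leb I01 (fun t => u_ n t ^+ 2)) ->
  (forall n, \int[leb]_(t in I01) (u_ n t ^+ 2) <= K) ->
  (forall q, rtrig q -> (\int[leb]_(t in I01) (q t * u_ n t)) @[n --> \oo] --> (0 : R)) ->
  {ae leb, forall t, I01 t -> u_ n t @[n --> \oo] --> y t} ->
  {ae leb, forall t, I01 t -> y t = 0}.
Proof.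
move=> mu iu uK uq [N [mN N0 Ncv]].
have cv t : (I01 `\` N) t -> u_ n t @[n --> \oo] --> y t.
  move=> [It Nt]; apply: contrapT => h; apply: Nt; apply: Ncv => /=.
  by move=> /(_ It).
have mD : measurable (I01 `\` N) by apply: measurableD => //; exact: mI.
(* Removing the null set [N] gives convergence everywhere on [A M], so [y] is measurable there as a
   pointwise limit. *)
pose A (M : nat) : set (measurableTypeR R) :=
  \bigcap_n ((I01 `\` N) `&` [set t | `|u_ n t| <= M%:R]).
have mA M : measurable (A M).
  apply: bigcapT_measurable => n.
  have -> : [set t | `|u_ n t| <= M%:R] = (Num.norm \o u_ n) @^-1` `]-oo, M%:R]%classic.
    by apply/seteqP; split => t /=; rewrite in_itv.
  have mc : measurable_fun (I01 `\` N) (Num.norm \o u_ n).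
    by apply: measurable_funTS; apply: measurableT_comp; [|exact: (mu n)].
  by apply: mc => //; exact: measurable_itv.
have AI M : A M `<=` I01 `\` N by move=> t /(_ 0%N I) [].
have zero M : {ae leb, forall t, A M t -> y t = 0}.
  have my : measurable_fun (A M) y.
    apply: (@measurable_fun_cvg _ _ _ _ u_); last by move=> t /AI; exact: cv.
    by move=> n; exact: (measurable_funTS (mu n)).
  have yM t : A M t -> `|y t| <= M%:R.
    move=> At; apply: (cvgn_le_cst (fun n => `|u_ n t|)).
      by apply: cvg_norm; apply: cv; exact: (AI M).
    by move=> n; case: (At n I).
  have Afin : (leb (A M) < +oo)%E.
    apply: le_lt_trans fI; apply: le_measure; rewrite ?inE//; first exact: mI.
    by move=> t /AI[].
  have iy : rI leb (A M) y.
    apply: (measurable_bounded_integrable (mA M)) => //.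
    exists M%:R; split; first by rewrite num_real.
    by move=> x Mx t At; apply: (le_trans (yM t At)); exact: ltW.
  have yE (E : set (measurableTypeR R)) : E `<=` A M -> measurable E ->
      (\int[leb]_(t in E) (y t)%:E = \int[leb]_(t in E) (cst 0) t)%E.
    move=> EA mE; have iyE : rI leb E y by exact: (integrableS (mA M) mE EA iy).
    rewrite [RHS]integral0_eq// rI_EFin//; congr EFin.
    have c1 : \int[leb]_(t in E) u_ n t @[n --> \oo] --> \int[leb]_(t in E) y t.
      apply: (Rintegral_dominated_cvg _ _ _ _ (fun _ => M%:R) mE mu).
      - by move=> t /EA /AI; exact: cv.
      - apply: rI_cst => //; apply: le_lt_trans Afin.
        by apply: le_measure; rewrite ?inE.
      - by move=> n t /EA /(_ n I)[].
    have EI : E `<=` I01 by move=> t /EA /AI[].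
    exact: (cvg_unique _ c1 (weak_cvg_indic u_ K E mE EI mu iu uK uq)).
  have := @integral_ae_eq _ _ _ leb (A M) (mA M) (cst 0%E) _ iy (measurable_cst _) yE.
  by apply: filterS => t h /h [].
have h1 := ae_foralln zero.
have h2 : {ae leb, forall t, ~ N t}.
  by exists N; split => // t /= /contrapT.
apply: filterS2 h1 h2 => t Ht Nt It.
have /cvg_seq_bounded : cvgn (u_ ^~ t) by apply/cvg_ex; exists (y t); exact: cv.
move=> [M [_ /(_ (M + 1))]]; rewrite ltrDl ltr01 => /(_ isT) hM.
apply: (Ht (Num.truncn (M + 1)).+1) => n _; split; first by split.
rewrite /= (le_trans (hM n I))// ltW//; exact: Num.Theory.truncnS_gt.
Qed.

End UniquenessTheorems.

(** * Szego's extremal problem and the F. and M. Riesz theorem *)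

Section RieszUniqueness.
Context {R : realType}.
Local Open Scope ring_scope.
Implicit Types (F G H B : R -> R[i]) (E : set (measurableTypeR R)) (j n : nat).
Local Notation mI := (@mI01 R).
Local Notation fI := (@leb_I01_fin R).
Local Notation ci := (cint leb I01).
Local Notation n2 := (nrm2 leb I01).

(** The case of a constant sequence in [weak_cvg_ae0], taken for the real and imaginary parts. *)
Lemma trig_orthogonal_ae0 B (C : R) : cmeasurable B -> (forall t, cabs2 (B t) <= C) ->
  (forall k : int, ci (fun t => B t * ek k t) = 0) ->
  {ae leb, forall t, I01 t -> B t = 0}.
Proof.
move=> mB BC B0; have B2 : L2 leb I01 B by apply: (L2_bounded _ _ _ C mI fI mB).
have Btrig f : trig f -> cI leb I01 (fun t => f t * B t) /\ ci (fun t => f t * B t) = 0.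
  elim=> [c k|h g _ [If f0] _ [Ig g0]].
    have -> : (fun t => c * ek k t * B t) = (fun t => c * (B t * ek k t)).
      by apply/funext => t; ring.
    have I1 : cI leb I01 (fun t => B t * ek k t).
      apply: (L2_cIM _ _ _ _ mI B2); apply: (L2_bounded _ _ _ 1 mI fI).
        exact: measurable_ek.
      by move=> t _; rewrite cabs2_ek.
    by split; [exact: cIZ mI I1|rewrite (cintZ _ _ _ _ mI I1) B0 mulr0].
  have -> : (fun t => (h t + g t) * B t) = (fun t => h t * B t + g t * B t).
    by apply/funext => t; ring.
  by split; [exact: cID mI If Ig|rewrite (cintD _ _ _ _ mI If Ig) f0 g0 addr0].
have [mB1 mB2] := mB; have iB := L2_rI _ _ _ mI B2.
have part (u : R -> R) : measurable_fun setT u ->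
    (forall t, u t ^+ 2 <= cabs2 (B t)) ->
    (forall q, rtrig q -> \int[leb]_(t in I01) (q t * u t) = 0) ->
    {ae leb, forall t, I01 t -> u t = 0}.
  move=> mu uB uq.
  have iu : rI leb I01 (fun t => u t ^+ 2).
    apply: (rI_dom _ _ _ _ mI _ iB); first exact: measurable_funX.
    by move=> t _; rewrite ger0_norm ?sqr_ge0.
  apply: (weak_cvg_ae0 (fun _ => u) u (n2 B)) => //.
  - move=> _; apply: le_Rintegral => //; exact: mI.
  - by move=> q tq; rewrite uq//; exact: cvg_cst.
  - by apply: aeW => t _; exact: cvg_cst.
have Re0 := part _ mB1; have Im0 := part _ mB2.
have {}Re0 : {ae leb, forall t, I01 t -> cRe (B t) = 0}.
  apply: Re0 => [t|q /Btrig[_ /(congr1 (@complex.Re R))] /= <-].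
    by rewrite cabs2E lerDl sqr_ge0.
  by apply: eq_Rintegral => t _; rewrite cReM /=; ring.
have {}Im0 : {ae leb, forall t, I01 t -> cIm (B t) = 0}.
  apply: Im0 => [t|q /Btrig[_ /(congr1 (@complex.Im R))] /= <-].
    by rewrite cabs2E lerDr sqr_ge0.
  by apply: eq_Rintegral => t _; rewrite cImM /=; ring.
by apply: filterS2 Re0 Im0 => t r i It; apply: complex_eq; [exact: r|exact: i].
Qed.

(* The functions [F (1 + p)] with [p] in the span of the [ek (- j)], [j > 0]:
   the least class closed under the two operations of the extremal argument. *)
Inductive szego_class F : (R -> R[i]) -> Prop :=
| szego_base : szego_class F F
| szego_mid G H : szego_class F G -> szego_class F H ->
    szego_class F (fun t => 2^-1 * (G t + H t))
| szego_pert G (c : R[i]) j : szego_class F G ->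
    szego_class F (fun t => G t + c * (G t * ek (- (j.+1%:Z)) t)).

Section Extremal.
Context (F : R -> R[i]) (C : R) (mF : cmeasurable F) (FC : forall t, cabs2 (F t) <= C).
Context (F0 : ci F != 0) (Fn : forall j, ci (fun t => F t * ek (- (j.+1%:Z)) t) = 0).

Let bnd G : Prop := cmeasurable G /\ exists M : R, forall t, cabs2 (G t) <= M.

Let bnd_L2 G : bnd G -> L2 leb I01 G.
Proof. by move=> [mG [M GM]]; apply: (L2_bounded _ _ _ M mI fI mG). Qed.

Let bnd_ek G k : bnd G -> bnd (fun t => G t * ek k t).
Proof.
move=> [mG [M GM]]; split; first exact: cmeasurableM mG (measurable_ek k).
by exists M => t; rewrite cabs2M cabs2_ek mulr1.
Qed.

Let bndZ G (c : R[i]) : bnd G -> bnd (fun t => c * G t).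
Proof.
move=> [mG [M GM]]; split; first exact: cmeasurableM (cmeasurable_cst _) mG.
by exists (cabs2 c * M) => t; rewrite cabs2M ler_wpM2l ?cabs2_ge0.
Qed.

Let bndD G H : bnd G -> bnd H -> bnd (fun t => G t + H t).
Proof.
move=> [mG [M GM]] [mH [N HN]]; split; first exact: cmeasurableD.
exists (2 * M + 2 * N) => t; apply: (le_trans (cabs2D_le _ _)).
by rewrite lerD// ler_pM2l.
Qed.

Let cI_bnd G : bnd G -> cI leb I01 G.
Proof. by move=> bG; apply: (L2_cI _ _ _ mI fI); exact: bnd_L2. Qed.

Let class_bnd G : szego_class F G -> bnd G.
Proof.
elim=> [|G1 G2 _ b1 _ b2|G1 c j _ b1].
- by split => //; exists C.
- by apply: bndZ; exact: bndD.
- by apply: bndD => //; apply: bndZ; exact: bnd_ek.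
Qed.

(** The frequencies of [F] are nonpositive, and a perturbation by [ek (- j.+1)] only pushes them
    further down; the mean is therefore the same throughout the class. *)
Let class_coef G : szego_class F G ->
  ci G = ci F /\ forall j, ci (fun t => G t * ek (- (j.+1%:Z)) t) = 0.
Proof.
elim=> [//|G1 G2 s1 [e1 h1] s2 [e2 h2]|G1 c j s1 [e1 h1]].
- have b1 := class_bnd _ s1; have b2 := class_bnd _ s2; split.
    rewrite (cintZ _ _ _ _ mI (cI_bnd _ (bndD _ _ b1 b2))).
    rewrite (cintD _ _ _ _ mI (cI_bnd _ b1) (cI_bnd _ b2)) e1 e2.
    by field.
  move=> j.
  have -> : (fun t => 2^-1 * (G1 t + G2 t) * ek (- (j.+1%:Z)) t) =
      (fun t => 2^-1 * (G1 t * ek (- (j.+1%:Z)) t + G2 t * ek (- (j.+1%:Z)) t)).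
    by apply/funext => t; ring.
  have d1 := bnd_ek _ (- (j.+1%:Z)) b1; have d2 := bnd_ek _ (- (j.+1%:Z)) b2.
  rewrite (cintZ _ _ _ _ mI (cI_bnd _ (bndD _ _ d1 d2))).
  by rewrite (cintD _ _ _ _ mI (cI_bnd _ d1) (cI_bnd _ d2)) h1 h2 addr0 mulr0.
- have b1 := class_bnd _ s1; have d k := bnd_ek _ k b1; split.
    rewrite (cintD _ _ _ _ mI (cI_bnd _ b1) (cI_bnd _ (bndZ _ c (d _)))).
    by rewrite (cintZ _ _ _ _ mI (cI_bnd _ (d _))) h1 mulr0 addr0.
  move=> i.
  have -> : (fun t => (G1 t + c * (G1 t * ek (- (j.+1%:Z)) t)) * ek (- (i.+1%:Z)) t) =
      (fun t => G1 t * ek (- (i.+1%:Z)) t + c * (G1 t * ek (- ((j + i).+1.+1%:Z)) t)).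
    apply/funext => t; rewrite mulrDl -!mulrA ekM.
    by congr (_ + c * (_ * ek _ _)); rewrite -opprD -PoszD addSn addnS.
  rewrite (cintD _ _ _ _ mI (cI_bnd _ (d _)) (cI_bnd _ (bndZ _ c (d _)))).
  by rewrite (cintZ _ _ _ _ mI (cI_bnd _ (d _))) !h1 mulr0 addr0.
Qed.

Let class_zero G t : szego_class F G -> F t = 0 -> G t = 0.
Proof.
move=> + Ft; elim=> [//|G1 G2 _ -> _ ->|G1 c j _ ->]; first by rewrite addr0 mulr0.
by rewrite mul0r mulr0 addr0.
Qed.

(** Expanding the squared norm of [G] minus its mean. As the mean of [F] is nonzero, the infimum [d]
    of the class is positive. *)
Let class_ge G : szego_class F G -> cabs2 (ci F) <= n2 G.
Proof.
move=> sG; have [eG _] := class_coef _ sG; have bG := class_bnd _ sG.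
have G2 := bnd_L2 _ bG.
have := nrm2_ge0 leb I01 (fun t => G t + - ci F).
rewrite (nrm2D _ _ _ _ mI G2 (L2_cst _ _ (- ci F) mI fI)).
have -> : n2 (fun _ => - ci F) = cabs2 (ci F).
  by rewrite /nrm2 cabs2N (Rintegral_cst1 _ _ _ mI leb_I01).
have -> : (fun t => G t * (- ci F)^*) = (fun t => (- ci F)^* * G t).
  by apply/funext => t; rewrite mulrC.
rewrite (cintZ _ _ _ _ mI (cI_bnd _ bG)) eG.
by rewrite cabs2E !cRIE; nra.
Qed.

Let vals := [set x : R | exists2 G, szego_class F G & x = n2 G].
Let d := inf vals.

Let d_le G : szego_class F G -> d <= n2 G.
Proof.
move=> sG; apply: ge_inf; last by exists G.
by exists (cabs2 (ci F)) => _ [H sH ->]; exact: class_ge.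
Qed.

Let d_gt0 : 0 < d.
Proof.
apply: (@lt_le_trans _ _ (cabs2 (ci F))).
  rewrite lt_neqAle cabs2_ge0 andbT eq_sym; apply: contra_neq F0; exact: cabs2_eq0.
apply: lb_le_inf; first by exists (n2 F); exists F => //; exact: szego_base.
by move=> _ [H sH ->]; exact: class_ge.
Qed.

Let minimizing : exists G : nat -> R -> R[i],
  forall n, szego_class F (G n) /\ n2 (G n) < d + n.+1%:R^-1.
Proof.
have h n : exists G, szego_class F G /\ n2 G < d + n.+1%:R^-1.
  have hi : has_inf vals.
    split; first by exists (n2 F); exists F => //; exact: szego_base.
    by exists (cabs2 (ci F)) => _ [H sH ->]; exact: class_ge.
  have [|_ [G sG ->] Gd] := inf_adherent _ hi (eps := n.+1%:R^-1).
    by rewrite invr_gt0.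
  by exists G.
by exists (fun n => sval (cid (h n))) => n; case: cid.
Qed.

(** Parallelogram law: the midpoint belongs to the class, so its squared norm is at least [d]. Hence
    a minimizing sequence is Cauchy. *)
Let class_close G H (e1 e2 : R) : szego_class F G -> szego_class F H ->
  n2 G < d + e1 -> n2 H < d + e2 -> n2 (fun t => G t + (-1) * H t) <= 2 * e1 + 2 * e2.
Proof.
move=> sG sH Ge He; have G2 := bnd_L2 _ (class_bnd _ sG).
have H2 := bnd_L2 _ (class_bnd _ sH); have H2' := L2Z _ _ (-1) _ mI H2.
have := d_le _ (szego_mid _ _ _ sG sH).
rewrite (nrm2Z _ _ _ _ mI (L2D _ _ _ _ mI G2 H2)) (nrm2D _ _ _ _ mI G2 H2).
rewrite (nrm2D _ _ _ _ mI G2 H2') (nrm2Z _ _ _ _ mI H2).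
have -> : (fun t => G t * (-1 * H t)^*) = (fun t => (-1) * (G t * (H t)^*)).
  by apply/funext => t; rewrite !conjE; ring.
rewrite (cintZ _ _ _ _ mI (L2_cIM _ _ _ _ mI G2 (L2J _ _ _ mI H2))).
have -> : cabs2 (2^-1 : R[i]) = 4^-1.
  by rewrite cabs2V -(rmorph_nat (real_complex R)) cabs2_real -natrX.
rewrite cabs2N cabs2_1 mulN1r cReN.
set x := cRe _ => h.
have : 4 * d <= n2 G + n2 H + 2 * x.
  have -> : n2 G + n2 H + 2 * x = 4 * (4^-1 * (n2 G + n2 H + 2 * x)).
    by field.
  by rewrite ler_pM2l.
lra.
Qed.

(** The best perturbation of [G] in the direction [G * ek (- j.+1)] has coefficient [c = - k / n2 G]
    and lowers the squared norm by [|k|^2 / n2 G]; this gain cannot exceed [n2 G - d < e]. *)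
Let class_moment G (e : R) j : szego_class F G -> n2 G < d + e -> e <= 1 ->
  cabs2 (ci (fun t => G t * (G t * ek (- (j.+1%:Z)) t)^*)) <= (d + 1) * e.
Proof.
move=> sG Ge e1; set k := ci _; have bG := class_bnd _ sG.
have G2 := bnd_L2 _ bG; have K2 := bnd_L2 _ (bnd_ek _ (- (j.+1%:Z)) bG).
have N0 : 0 < n2 G by exact: (lt_le_trans d_gt0 (d_le _ sG)).
pose c : R[i] := - (((n2 G)^-1)%:C * k).
have := d_le _ (szego_pert _ _ c j sG).
rewrite (nrm2D _ _ _ _ mI G2 (L2Z _ _ c _ mI K2)) (nrm2Z _ _ _ _ mI K2).
have -> : n2 (fun t => G t * ek (- (j.+1%:Z)) t) = n2 G.
  by congr fine; apply: eq_integral => t _; rewrite cabs2M cabs2_ek mulr1.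
have -> : (fun t => G t * (c * (G t * ek (- (j.+1%:Z)) t))^*) =
    (fun t => c^* * (G t * (G t * ek (- (j.+1%:Z)) t)^*)).
  by apply/funext => t; rewrite !conjcM; ring.
rewrite (cintZ _ _ _ _ mI (L2_cIM _ _ _ _ mI G2 (L2J _ _ _ mI K2))) -/k.
have -> : cRe (c^* * k) = - ((n2 G)^-1 * cabs2 k).
  by rewrite /c cabs2E !cRIE /=; ring.
have -> : cabs2 c * n2 G = (n2 G)^-1 * cabs2 k.
  by rewrite /c cabs2N cabs2M cabs2_real; field; rewrite gt_eqF.
move=> h; have {}h : (n2 G)^-1 * cabs2 k <= n2 G - d by lra.
have {}h : cabs2 k <= n2 G * (n2 G - d).
  by rewrite -[cabs2 k](mulVKf (lt0r_neq0 N0)) ler_pM2l.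
have := d_le _ sG; have := d_gt0; nra.
Qed.

(** Along a minimizing sequence [|G n|^2] tends weakly to the constant [d > 0], while every [G n]
    vanishes on [E]. Testing against a polynomial close to the indicator of [E] gives nearly
    [d * leb E] on one side and nearly [0] on the other. *)
Lemma szego_zero_set E : measurable E -> E `<=` I01 ->
  (forall t, E t -> F t = 0) -> leb E = 0%E.
Proof.
move=> mE EI EF; have [G Gm] := minimizing.
have sG n : szego_class F (G n) by case: (Gm n).
have bG n := class_bnd _ (sG n); have G2 n := bnd_L2 _ (bG n).
have e1 n : (n.+1%:R^-1 : R) <= 1 by rewrite invf_le1 ?ler1n ?ltr0n.
have harm : (n.+1%:R^-1 : R) @[n --> \oo] --> (0 : R) by exact: cvg_harmonic.
have Nd : n2 (G n) @[n --> \oo] --> d.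
  apply: (@squeeze_cvgr _ _ _ _ (fun _ => d) (fun n => d + n.+1%:R^-1)).
  - by apply: nearW => n; rewrite d_le//= ltW//; case: (Gm n).
  - exact: cvg_cst.
  - by rewrite -[X in _ --> X]addr0; apply: cvgD => //; exact: cvg_cst.
have mom j : ccvg \oo (fun n => ci (fun t => G n t * (G n t * ek (- (j.+1%:Z)) t)^*)) 0.
  apply: (ccvg0 _ _ (fun n => Num.sqrt ((d + 1) * n.+1%:R^-1))).
  - by move=> n; exact: sqrtr_ge0.
  - move=> n; rewrite sqr_sqrtr; last by rewrite mulr_ge0// addr_ge0// ltW// d_gt0.
    by apply: class_moment => //; case: (Gm n).
  - rewrite -sqrtr0; apply: (@continuous_cvg _ _ _ _ _ _ Num.sqrt); first exact: sqrt_continuous.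
    by rewrite -[X in _ --> X](mulr0 (d + 1)); apply: cvgM => //; exact: cvg_cst.
(* The zeroth Fourier coefficient of [|G n|^2] is [n2 (G n)], which tends to [d]; the others are the
   moments in [mom] or their conjugates, which tend to [0]. *)
have wk f : trig f ->
    (forall n, cI leb I01 (fun t => f t * (cabs2 (G n t))%:C)) /\
    ccvg \oo (fun n => ci (fun t => f t * (cabs2 (G n t))%:C)) (d%:C * ci f).
  elim=> [c k|f1 f2 t1 [I1 h1] t2 [I2 h2]]; last first.
    have E0 n : (fun t => (f1 t + f2 t) * (cabs2 (G n t))%:C) =
        (fun t => f1 t * (cabs2 (G n t))%:C + f2 t * (cabs2 (G n t))%:C).
      by apply/funext => t; rewrite mulrDl.
    have If (g : R -> R[i]) : trig g -> cI leb I01 g.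
      move=> tg; apply: (cI_bnd g); elim: tg => [c k|g1 g2 _ b1 _ b2]; last exact: bndD.
      apply: bndZ; split; first exact: measurable_ek.
      by exists 1 => t; rewrite cabs2_ek.
    split; first by move=> n; rewrite E0; exact: cID mI (I1 n) (I2 n).
    rewrite (cintD _ _ _ _ mI (If _ t1) (If _ t2)) mulrDr.
    under [X in ccvg _ X]eq_fun do rewrite E0 (cintD _ _ _ _ mI (I1 _) (I2 _)).
    exact: ccvgD.
  have E1 n : (fun t => c * ek k t * (cabs2 (G n t))%:C) =
      (fun t => c * (G n t * (G n t * ek (- k) t)^*)).
    by apply/funext => t; rewrite -mulcJE conjcM ekJ opprK; ring.
  have I1 n : cI leb I01 (fun t => G n t * (G n t * ek (- k) t)^*).
    exact: L2_cIM mI (G2 n) (L2J _ _ _ mI (bnd_L2 _ (bnd_ek _ _ (bG n)))).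
  split; first by move=> n; rewrite E1; exact: cIZ mI (I1 n).
  under [X in ccvg _ X]eq_fun do rewrite E1 (cintZ _ _ _ _ mI (I1 _)).
  have bek : bnd (ek k) by split; [exact: measurable_ek|exists 1 => t; rewrite cabs2_ek].
  rewrite (cintZ _ _ _ _ mI (cI_bnd _ bek)) cint_ek mulrCA.
  apply: ccvgM; first exact: ccvg_cst.
  case: k {E1 I1 bek} => [[|j]|j].
  - rewrite eqxx mulr1.
    have -> : (fun n => ci (fun t => G n t * (G n t * ek (- 0%:Z) t)^*)) =
        (fun n => (n2 (G n))%:C).
      apply/funext => n; rewrite -cint_mulJ; apply: eq_cint => t _.
      by rewrite oppr0 ek0 mulr1.
    by split => //=; exact: cvg_cst.
  - by rewrite mulr0; exact: mom.
  - rewrite mulr0 NegzE opprK -conj0.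
    have -> : (fun n => ci (fun t => G n t * (G n t * ek (j.+1%:Z) t)^*)) =
        (fun n => (ci (fun t => G n t * (G n t * ek (- (j.+1%:Z)) t)^*))^*).
      apply/funext => n; rewrite -cintJ; [|exact: mI|].
        apply: eq_cint => t _; rewrite !conjcM !ekJ opprK conjCK; ring.
      exact: L2_cIM mI (G2 n) (L2J _ _ _ mI (bnd_L2 _ (bnd_ek _ _ (bG n)))).
    by apply: ccvgJ; exact: mom.
apply/eqP; rewrite eq_le measure_ge0 andbT leNgt; apply/negP => Epos.
have Efin : (leb E < +oo)%E.
  by apply: le_lt_trans fI; apply: le_measure; rewrite ?inE//; exact: mI.
pose m : R := fine (leb E).
have mE' : leb E = m%:E by rewrite fineK// ge0_fin_numE.
have m0 : 0 < m by rewrite -lte_fin -mE'.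
have intE : \int[leb]_(t in I01) \1_E t = m.
  rewrite /Rintegral integral_indic//; last exact: mI.
  by rewrite setIidl.
clear Epos Efin mE'.
(* For [p >= N], [class_close] bounds the squared distance of [G p] and [G N] by [4 / N.+1]; twice
   this is at most [d * m / 4]. *)
pose N := Num.truncn (32 / (d * m)).
have hN : 8 * N.+1%:R^-1 <= d * m / 4.
  have h := Num.Theory.truncnS_gt (32 / (d * m)).
  have dm : 0 < d * m by rewrite mulr_gt0.
  rewrite ler_pdivrMr ?ltr0n// mulrAC ler_pdivlMr//.
  move: h; rewrite ltr_pdivrMr// => /ltW; rewrite -/N; lra.
(* The bounds of the [G n] need not be uniform in [n], so every later [G p] is compared with the
   single function [G N]. *)
have [_ [M GM]] := bG N.
have M0 : 0 <= M by exact: le_trans (cabs2_ge0 _) (GM 0).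
(* Chosen so that [(2 * M + d) * eta <= d * m / 4]; the final inequality then reads
   [d * m <= d * m / 2]. *)
pose eta : R := d * m / (8 * (M + 1) + 4 * d).
have den0 : 0 < 8 * (M + 1) + 4 * d by have := d_gt0; lra.
have eta0 : 0 < eta by rewrite divr_gt0// mulr_gt0.
have etaE : eta * (8 * (M + 1) + 4 * d) = d * m by rewrite /eta divfK// gt_eqF.
have [q [tq q01 qE]] := trig_approx_indic leb fI E mE eta eta0.
have uE := unit_valued_indic E mE; have mq := rtrig_measurable _ tq.
have d1 t : 0 <= `|\1_E t - q t| <= 1.
  rewrite normr_ge0 ler_norml; move: (q01 t) (uE.2 t) => /andP[? ?] /andP[? ?].
  by apply/andP; split; lra.
have idist : rI leb I01 (fun t => `|\1_E t - q t|).
  apply: (rI_bounded _ _ _ 1 mI fI) => [|t _].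
    by apply: measurableT_comp => //; apply: measurable_funB => //; case: uE.
  by rewrite normr_id; case/andP: (d1 t).
have iq : rI leb I01 q.
  apply: (rI_bounded _ _ _ 1 mI fI) => // t _; by rewrite ger0_norm; case/andP: (q01 t).
have iE : rI leb I01 \1_E.
  apply: (rI_bounded _ _ _ 1 mI fI) => [|t _]; first by case: uE.
  by rewrite ger0_norm; case/andP: (uE.2 t).
have qm : m - eta <= \int[leb]_(t in I01) q t.
  rewrite lerBlDl -lerBlDr -intE -(RintegralB mI iE iq) (le_trans _ qE)//.
  apply: le_Rintegral => //; [exact: mI|exact: rIB mI iE iq|].
  by move=> t _; exact: ler_norm.
have [Iq [wq _]] := wk _ tq.
have lim : d * \int[leb]_(t in I01) q t <= 2 * M * eta + d * m / 4.
  have -> : d * \int[leb]_(t in I01) q t = cRe (d%:C * ci (fun t => (q t)%:C)).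
    by rewrite cint_real !cRIE /=; ring.
  have wq' : (fun n => cRe (ci (fun t => (q t)%:C * (cabs2 (G (n + N)%N t))%:C))) @ \oo
      --> cRe (d%:C * ci (fun t => (q t)%:C)).
    by rewrite (cvg_shiftn N (fun n => cRe (ci (fun t => (q t)%:C * (cabs2 (G n t))%:C)))).
  apply: (cvgn_le_cst _ _ _ wq') => n.
  set p := (n + N)%N.
  have -> : cRe (ci (fun t => (q t)%:C * (cabs2 (G p t))%:C)) =
      \int[leb]_(t in I01) (q t * cabs2 (G p t)).
    by apply: eq_Rintegral => t _; rewrite cReM /= mul0r subr0.
  have iqG : rI leb I01 (fun t => q t * cabs2 (G p t)).
    have [+ _] := Iq p; rewrite /rI; congr (integrable _ _ _).
    by apply/funext => t; congr EFin; rewrite cReM /= mul0r subr0.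
  have GN2 := L2D _ _ _ _ mI (G2 p) (L2Z _ _ (-1) _ mI (G2 N)).
  have iGN := L2_rI _ _ _ mI GN2.
  have i1 := rIZ _ _ _ (2 * M) mI idist; have i2 := rIZ _ _ _ 2 mI iGN.
  apply: (@le_trans _ _ (\int[leb]_(t in I01) (2 * M * `|\1_E t - q t| +
      2 * cabs2 (G p t + (-1) * G N t)))).
    apply: le_Rintegral => //; [exact: mI|exact: rID mI i1 i2|].
    move=> t _.
    have tri : cabs2 (G p t) <= 2 * M + 2 * cabs2 (G p t + (-1) * G N t).
      have -> : G p t = G N t + (G p t + (-1) * G N t) by ring.
      apply: (le_trans (cabs2D_le _ _)); rewrite lerD ?ler_pM2l//.
      by have -> : G N t + (G p t + -1 * G N t) + -1 * G N t = G p t + -1 * G N t by ring.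
    have c0 := cabs2_ge0 (G p t); have c1 := cabs2_ge0 (G p t + (-1) * G N t).
    (* On [E] the function [G p] vanishes; off [E] the indicator does, and the two sides agree. *)
    have qd : q t * cabs2 (G p t) <= `|\1_E t - q t| * cabs2 (G p t).
      have [Et|nEt] := pselect (E t).
        by rewrite (class_zero _ t (sG p) (EF t Et)) cabs2_0 !mulr0.
      rewrite indicE memNset//= sub0r normrN ger0_norm//; by case/andP: (q01 t).
    apply: (le_trans qd); move: (d1 t) => /andP[a0 a1].
    by set a := `|_| in a0 a1 *; nra.
  rewrite (RintegralD mI i1 i2) (RintegralZl _ mI idist) (RintegralZl _ mI iGN).
  have := class_close _ _ _ _ (sG p) (sG N) (Gm p).2 (Gm N).2; rewrite /nrm2 => cl.
  have pN : (p.+1%:R^-1 : R) <= N.+1%:R^-1.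
    by rewrite lef_pV2 ?posrE ?ltr0n// ler_nat ltnS /p leq_addl.
  apply: lerD; first by rewrite ler_wpM2l// mulr_ge0.
  apply: le_trans hN; apply: (le_trans (ler_wpM2l _ cl)) => //.
  by move: pN; set x := _^-1; set y := _^-1 => ?; lra.
have dg := d_gt0; have Mm := mulr_ge0 M0 (ltW eta0).
have : d * (m - eta) <= 2 * M * eta + d * m / 4.
  by apply: le_trans lim; rewrite ler_pM2l.
have dm : 0 < d * m by rewrite mulr_gt0.
have de : 0 < d * eta by rewrite mulr_gt0.
move: etaE; rewrite mulrDr mulrBr; lra.
Qed.

End Extremal.

(** If some Fourier coefficient is nonzero, let [k] be least with [B * ek k] of nonzero mean. Then
    [B * ek k] has nonpositive frequencies and nonzero mean, so [szego_zero_set] forbids zeros on a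
    set of positive measure. *)
Lemma riesz_uniqueness B (C : R) E : cmeasurable B -> (forall t, cabs2 (B t) <= C) ->
  (forall n, ci (fun t => B t * ek (- n%:Z) t) = 0) ->
  measurable E -> E `<=` I01 -> (forall t, E t -> B t = 0) -> leb E != 0%E ->
  {ae leb, forall t, I01 t -> B t = 0}.
Proof.
move=> mB BC Bn mE EI EB En0.
have [[n n0]|nn] := pselect (exists n, ci (fun t => B t * ek n t) != 0); last first.
  apply: (trig_orthogonal_ae0 _ C) => // -[] n.
    by apply: contrapT => /eqP h; apply: nn; exists n.
  by rewrite NegzE; exact: Bn.
have ex : exists n, ci (fun t => B t * ek n t) != 0 by exists n.
case: (ex_minnP ex) => k k0 kmin.
exfalso; move/eqP : En0; apply.
apply: (szego_zero_set (fun t => B t * ek k t) C) => //.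
- exact: cmeasurableM mB (measurable_ek k).
- by move=> t; rewrite cabs2M cabs2_ek mulr1.
- move=> j; have -> : (fun t => B t * ek k t * ek (- (j.+1%:Z)) t) =
      (fun t => B t * ek (k%:Z - j.+1%:Z) t).
    by apply/funext => t; rewrite -mulrA ekM.
  have [jk|kj] := ltnP j k.
    rewrite subzn//; apply: contrapT => /eqP h.
    by have := kmin _ h; rewrite leqNgt ltn_subrL /= (leq_ltn_trans _ jk).
  by rewrite -opprB subzn ?leqW//; exact: Bn.
- by move=> t Et; rewrite EB// mul0r.
Qed.

End RieszUniqueness.

#[local] Instance ae_leb_filter (R : realType) :
  Filter (nbhs (almost_everywhere (@lebesgue_measure R))).
Proof. exact: ae_filter_ringOfSetsType. Qed.

(** * Abel means and radial limits of Cauchy integrals *)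

Section RadialLimits.
Context {R : realType}.
Local Open Scope ring_scope.
Local Notation mI := (@mI01 R).
Local Notation fI := (@leb_I01_fin R).
Local Notation ci := (cint leb I01).
Local Notation n2 := (nrm2 leb I01).
Implicit Types (G X : R -> R[i]) (w : R) (t : R).

Lemma cabs2_sub1_ge (x : R[i]) w : 0 <= w < 1 -> cabs2 x = w ^+ 2 ->
  (1 - w) ^+ 2 <= cabs2 (1 - x).
Proof.
move=> /andP[w0 w1]; rewrite !cabs2E !cRIE /= => h.
have : `|cRe x| <= w by apply: cRe_abs_le => //; rewrite cabs2E h.
by rewrite ler_norml => /andP[? ?]; nra.
Qed.

Lemma geometric_sumC (x : R[i]) N : x != 1 ->
  (1 - x)^-1 = \sum_(k < N) x ^+ k + x ^+ N / (1 - x).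
Proof.
move=> x1; have h : 1 - x != 0 by rewrite subr_eq0 eq_sym.
apply: (mulIf h); rewrite mulVf// mulrDl divfK// [X in _ = X + _]mulrC.
rewrite -[LHS](subrK (x ^+ N)); congr (_ + _).
rewrite -{1}(expr1n _ N) subrXX; congr (_ * _).
by apply: eq_bigr => i _; rewrite expr1n mul1r.
Qed.

Lemma L2_ek k : L2 leb (@I01 R) (ek k).
Proof.
apply: (L2_bounded _ _ _ 1 mI fI); first exact: measurable_ek.
by move=> t _; rewrite cabs2_ek.
Qed.

(** [G] minus the Abel mean of its Fourier series over the frequencies [0, -1, ..., 1 - N]. Treating
    one frequency at a time gives coefficients and norm by induction. *)
Fixpoint abel_rest G w N : R -> R[i] :=
  if N is M.+1 then
    fun t => abel_rest G w M t -
             (w ^+ M)%:C * ci (fun s => G s * ek M s) * ek (- M%:Z) t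
  else G.

Section Rest.
Context (G : R -> R[i]) (w : R) (G2 : L2 leb I01 G) (w01 : 0 <= w < 1).
Let a (k : int) := ci (fun s => G s * ek k s).

Lemma abel_rest_L2 N : L2 leb I01 (abel_rest G w N).
Proof.
elim: N => [//|N IH] /=; apply: (L2B _ _ _ _ mI IH).
exact: L2Z mI (L2_ek _).
Qed.

Let cIGk H k : L2 leb I01 H -> cI leb I01 (fun t => H t * ek k t).
Proof. by move=> H2; exact: L2_cIM mI H2 (L2_ek k). Qed.

Lemma abel_rest_coef N (j : int) : ci (fun t => abel_rest G w N t * ek j t) =
  (if (0 <= j) && (j < N%:Z) then (1 - w ^+ `|j|)%:C else 1) * a j.
Proof.
elim: N => [|N IH] /=.
  by rewrite ifF ?mul1r//; apply/negP => /andP[h1 h2]; lia.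
have -> : (fun t => (abel_rest G w N t - (w ^+ N)%:C * a N * ek (- N%:Z) t) * ek j t) =
    (fun t => abel_rest G w N t * ek j t - (w ^+ N)%:C * a N * ek (j - N%:Z) t).
  by apply/funext => t; rewrite mulrBl -!mulrA ekM [- N%:Z + j]addrC.
have Iek : cI leb I01 (@ek R (j - N%:Z)) by exact: L2_cI mI fI (L2_ek _).
rewrite (cintB _ _ _ _ mI (cIGk _ _ (abel_rest_L2 N)) (cIZ _ _ _ _ mI Iek)).
rewrite (cintZ _ _ _ _ mI Iek) cint_ek IH subr_eq0.
have [->|jN] := eqVneq j N%:Z.
  rewrite ltxx andbF mulr1 mul1r ifT; last by lia.
  by rewrite absz_nat rmorphB rmorph1 mulrBl mul1r.
rewrite mulr0n mulr0 subr0. have -> : (j < N.+1%:Z) = (j < N%:Z) by lia.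
by [].
Qed.

(** Each step multiplies one Fourier coefficient by [1 - w ^+ N], which lies in [[0, 1]], and leaves
    the others alone. *)
Lemma abel_rest_norm N : n2 (abel_rest G w N) <= n2 G.
Proof.
elim: N => [//|N IH] /=; set c := (w ^+ N)%:C * _.
have A2 := abel_rest_L2 N.
have -> : (fun t => abel_rest G w N t - c * ek (- N%:Z) t) =
    (fun t => abel_rest G w N t + - c * ek (- N%:Z) t).
  by apply/funext => t; rewrite mulNr.
rewrite (nrm2D _ _ _ _ mI A2 (L2Z _ _ _ _ mI (L2_ek _))) (nrm2Z _ _ _ _ mI (L2_ek _)).
have -> : n2 (@ek R (- N%:Z)) = 1.
  apply: etrans (Rintegral_cst1 leb I01 1 mI leb_I01).
  by apply: eq_Rintegral => t _; rewrite cabs2_ek.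
have -> : (fun t => abel_rest G w N t * (- c * ek (- N%:Z) t)^*) =
    (fun t => - c^* * (abel_rest G w N t * ek N t)).
  by apply/funext => t; rewrite !conjE ekJ opprK; ring.
rewrite (cintZ _ _ _ _ mI (cIGk _ _ A2)) abel_rest_coef ltxx andbF mul1r.
rewrite mulr1 cabs2N /c -/(a N) cabs2M cabs2_real.
have -> : cRe (- ((w ^+ N)%:C * a N)^* * a N) = - (w ^+ N * cabs2 (a N)).
  by rewrite cabs2E !cRIE /=; ring.
have wN : 0 <= w ^+ N <= 1.
  by case/andP: w01 => w0 w1; rewrite exprn_ge0//= exprn_ile1// ltW.
apply: le_trans IH; case/andP: wN => W0 W1.
have h1 : 0 <= w ^+ N * cabs2 (a N) by rewrite mulr_ge0 ?cabs2_ge0.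
have h2 : 0 <= (1 - w ^+ N) * (w ^+ N * cabs2 (a N)) by rewrite mulr_ge0// subr_ge0.
by rewrite -addrA gerDl; move: h1 h2; set W := w ^+ N; nra.
Qed.

Lemma abel_restE N t :
  abel_rest G w N t = G t - \sum_(k < N) (w%:C * (expi t)^*) ^+ k * a k.
Proof.
elim: N => [|N IH] /=; first by rewrite big_ord0 subr0.
rewrite IH big_ord_recr /= opprD addrA; congr (_ - _).
rewrite exprMn -rmorphXn -/(a N) mulrAC; congr (_ * _ * _).
by rewrite -(ekJ N) -ekX rmorphXn.
Qed.

(** The tail of the geometric series of the kernel has modulus at most [w ^+ N / (1 - w)], and
    [|G| <= 1 + |G|^2]. *)
Lemma cauchy_kernel_approx N t :
  let D := ci (fun s => G s / (1 - w%:C * (expi t)^* * expi s)) -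
           \sum_(k < N) (w%:C * (expi t)^*) ^+ k * a k in
  let e := w ^+ N / (1 - w) * (1 + n2 G) in `|cRe D| <= e /\ `|cIm D| <= e.
Proof.
case/andP: (w01) => w0 w1.
set y := w%:C * _; pose x s := y * expi s.
have cy : cabs2 y = w ^+ 2 by rewrite /y cabs2M cabs2_real cabs2J cabs2_expi mulr1.
have cx s : cabs2 (x s) = w ^+ 2 by rewrite /x cabs2M cy cabs2_expi mulr1.
have x1 s : x s != 1.
  apply/eqP => h; have := cx s; rewrite h cabs2_1 => /esym/eqP.
  by rewrite expr2; apply/negP; rewrite lt_eqF//; nra.
have w1' : 0 < 1 - w by rewrite subr_gt0.
have mx : cmeasurable x by apply: cmeasurableM; [exact: cmeasurable_cst|exact: measurable_expi].
have mX n : cmeasurable (fun s => x s ^+ n).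
  elim: n => [|n IH].
    by under eq_fun do rewrite expr0; exact: cmeasurable_cst.
  by under eq_fun do rewrite exprS; exact: cmeasurableM.
have cX n s : cabs2 (x s ^+ n) = w ^+ (2 * n).
  elim: n => [|n IH]; first by rewrite expr0 muln0 expr0 cabs2_1.
  by rewrite exprS cabs2M IH cx -exprD mulnS.
pose rest s := x s ^+ N / (1 - x s).
have mrest : cmeasurable rest.
  apply: cmeasurableM => //; apply: cmeasurableV.
  by apply: cmeasurableB => //; exact: cmeasurable_cst.
have crest s : cabs2 (rest s) <= (w ^+ N / (1 - w)) ^+ 2.
  rewrite cabs2M cabs2V cX mulnC exprM exprMn exprVn; apply: ler_wpM2l.
    by rewrite exprn_ge0// exprn_ge0.
  have h := cabs2_sub1_ge _ _ w01 (cx s).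
  have p0 : 0 < (1 - w) ^+ 2 by rewrite exprn_gt0.
  by rewrite lef_pV2 ?posrE// (lt_le_trans p0).
have I1 : cI leb I01 (fun s => G s * rest s).
  apply: L2_cIM mI G2 _.
  by apply: (L2_bounded _ _ _ _ mI fI mrest) => s _; exact: crest.
have Ik (k : nat) : cI leb I01 (fun s => G s * ek k s) by exact: cIGk.
have sumI M : cI leb I01 (fun s => \sum_(k < M) y ^+ k * (G s * ek k s)) /\
    ci (fun s => \sum_(k < M) y ^+ k * (G s * ek k s)) = \sum_(k < M) y ^+ k * a k.
  elim: M => [|M [IM EM]].
    have -> : (fun s => \sum_(k < 0) y ^+ k * (G s * ek k s)) = (fun _ => 0).
      by apply/funext => s; rewrite big_ord0.
    rewrite big_ord0; split; last exact: cint_cst mI leb_I01.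
    exact: L2_cI mI fI (L2_cst _ _ _ mI fI).
  have -> : (fun s => \sum_(k < M.+1) y ^+ k * (G s * ek k s)) =
      (fun s => \sum_(k < M) y ^+ k * (G s * ek k s) + y ^+ M * (G s * ek M s)).
    by apply/funext => s; rewrite big_ord_recr.
  split; first exact: cID mI IM (cIZ _ _ _ _ mI (Ik M)).
  rewrite (cintD _ _ _ _ mI IM (cIZ _ _ _ _ mI (Ik M))) (cintZ _ _ _ _ mI (Ik M)).
  by rewrite EM big_ord_recr.
have [Isum Esum] := sumI N.
have -> : (fun s => G s / (1 - w%:C * (expi t)^* * expi s)) =
    (fun s => \sum_(k < N) y ^+ k * (G s * ek k s) + G s * rest s).
  apply/funext => s; rewrite -/y -/(x s) (geometric_sumC _ N (x1 s)) mulrDr.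
  congr (_ + _); rewrite mulr_sumr; apply: eq_bigr => k _.
  by rewrite /x exprMn ekX mulrCA.
rewrite (cintD _ _ _ _ mI Isum I1) Esum addrAC subrr add0r /=.
have iG := L2_rI _ _ _ mI G2.
have i1 := rI_cst leb I01 (1 : R) mI fI.
have -> : w ^+ N / (1 - w) * (1 + n2 G) =
    \int[leb]_(s in I01) (w ^+ N / (1 - w) * (1 + cabs2 (G s))).
  rewrite (RintegralZl _ mI (rID _ _ _ _ mI i1 iG)) (RintegralD mI i1 iG).
  by rewrite (Rintegral_cst1 _ _ _ mI leb_I01).
apply: (cint_abs_le _ _ _ _ mI I1); first exact: rIZ mI (rID _ _ _ _ mI i1 iG).
move=> s _; have c0 := cabs2_ge0 (G s).
have p0 : 0 <= w ^+ N / (1 - w) by rewrite divr_ge0 ?exprn_ge0// ltW.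
split; first by rewrite mulr_ge0// addr_ge0.
rewrite cabs2M mulrC exprMn; apply: ler_pM => //; first exact: cabs2_ge0.
nra.
Qed.

End Rest.

(* A function with negative spectrum is the radial limit of its Cauchy integral:
   the damped Fourier sums are bounded in [L^2] and converge weakly to [G], so
   their pointwise limit, when it exists, can only be [G]. *)
Lemma cauchy_radial_limit G X (w : nat -> R) : L2 leb I01 G ->
  (forall n : nat, ci (fun t => G t * ek (- n%:Z) t) = 0) ->
  (forall n, 0 <= w n < 1) -> w n @[n --> \oo] --> (1 : R) ->
  {ae leb, forall t, I01 t -> ccvg \oo
     (fun n => ci (fun s => G s / (1 - (w n)%:C * (expi t)^* * expi s))) (X t)} ->
  {ae leb, forall t, I01 t -> G t = X t}.
Proof.
move=> G2 Gneg w01 w1 GX.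
(* The truncation depends on [w n]: long enough for the tail to be below [n.+1%:R^-1], and longer
   than [n], so that each fixed frequency is eventually among the damped ones. *)
have exN n : exists N, (n < N)%N /\ w n ^+ N / (1 - w n) * (1 + n2 G) <= n.+1%:R^-1.
  have [w0 wl1] := andP (w01 n).
  have : w n ^+ N / (1 - w n) * (1 + n2 G) @[N --> \oo] --> (0 : R).
    rewrite -[X in _ --> X](mul0r (1 + n2 G)); apply: cvgM; last exact: cvg_cst.
    rewrite -[X in _ --> X](mul0r (1 - w n)^-1); apply: cvgM; last exact: cvg_cst.
    by apply: cvg_expr; rewrite ger0_norm.
  have h0 : 0 < n.+1%:R^-1 :> R by rewrite invr_gt0.
  move/cvgrPdist_le => /(_ _ h0)[M _ hM]; exists (maxn n.+1 M).
  rewrite leq_maxl; split => //.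
  have := hM (maxn n.+1 M) (leq_maxr _ _); rewrite sub0r normrN.
  by apply: le_trans; exact: ler_norm.
pose N n := sval (cid (exN n)).
have Nn n : (n < N n)%N by rewrite /N; case: cid => ? [].
have Ne n : w n ^+ N n / (1 - w n) * (1 + n2 G) <= n.+1%:R^-1.
  by rewrite /N; case: cid => ? [].
pose D n := abel_rest G (w n) (N n).
have D2 n : L2 leb I01 (D n) by exact: abel_rest_L2.
have DX : {ae leb, forall t, I01 t -> ccvg \oo (fun n => D n t) (G t - X t)}.
  move: GX; apply: filterS => t Ht It; have {}Ht := Ht It.
  pose K n := ci (fun s => G s / (1 - (w n)%:C * (expi t)^* * expi s)).
  have -> : (fun n => D n t) = (fun n => G t - K n + (K n -
      \sum_(k < N n) ((w n)%:C * (expi t)^*) ^+ k * ci (fun s => G s * ek k s))).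
    by apply/funext => n; rewrite /D abel_restE addrA subrK.
  rewrite -[X in ccvg _ _ X]addr0; apply: ccvgD.
    by apply: ccvgB => //; exact: ccvg_cst.
  have harm : (n.+1%:R^-1 : R) @[n --> \oo] --> (0 : R) by exact: cvg_harmonic.
  have harmN : - (n.+1%:R^-1 : R) @[n --> \oo] --> (0 : R).
    by rewrite -oppr0; exact: cvgN.
  have [b1 b2] : (forall n, `|cRe (K n - \sum_(k < N n) ((w n)%:C * (expi t)^*) ^+ k *
         ci (fun s => G s * ek k s))| <= n.+1%:R^-1) /\
      (forall n, `|cIm (K n - \sum_(k < N n) ((w n)%:C * (expi t)^*) ^+ k *
         ci (fun s => G s * ek k s))| <= n.+1%:R^-1).
    by split=> n; have [h1 h2] := cauchy_kernel_approx G (w n) G2 (w01 n) (N n) t;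
      apply: le_trans (Ne n).
  split; apply: (@squeeze_cvgr _ _ _ _ (fun n => - n.+1%:R^-1) (fun n => n.+1%:R^-1)) => //;
    by apply: nearW => n; rewrite -ler_norml.
have wk f : trig f -> (forall n, cI leb I01 (fun t => f t * D n t)) /\
    ccvg \oo (fun n => ci (fun t => f t * D n t)) 0.
  elim=> [c k|f1 f2 _ [I1 h1] _ [I2 h2]]; last first.
    have E0 n : (fun t => (f1 t + f2 t) * D n t) = (fun t => f1 t * D n t + f2 t * D n t).
      by apply/funext => t; rewrite mulrDl.
    split; first by move=> n; rewrite E0; exact: cID mI (I1 n) (I2 n).
    under [X in ccvg _ X]eq_fun do rewrite E0 (cintD _ _ _ _ mI (I1 _) (I2 _)).
    by rewrite -[X in ccvg _ _ X]addr0; exact: ccvgD.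
  have E1 n : (fun t => c * ek k t * D n t) = (fun t => c * (D n t * ek k t)).
    by apply/funext => t; rewrite -mulrA [ek k t * _]mulrC.
  have I1 n : cI leb I01 (fun t => D n t * ek k t) by exact: L2_cIM mI (D2 n) (L2_ek k).
  split; first by move=> n; rewrite E1; exact: cIZ mI (I1 n).
  under [X in ccvg _ X]eq_fun do rewrite E1 (cintZ _ _ _ _ mI (I1 _)).
  rewrite -[X in ccvg _ _ X](mulr0 c); apply: ccvgM; first exact: ccvg_cst.
  have E2 n := abel_rest_coef G (w n) G2 (w01 n) (N n) k.
  have {E2} -> : (fun n => ci (fun t => D n t * ek k t)) = (fun n =>
      (if (0 <= k) && (k < (N n)%:Z) then (1 - w n ^+ `|k|)%:C else 1) *
      ci (fun s => G s * ek k s)) by apply/funext => n; exact: E2.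
  (* For negative [k] the coefficient of [G] is zero by hypothesis; otherwise it is eventually
     multiplied by [1 - w n ^+ k], which tends to [0]. *)
  case: k {E1 I1} => k; last first.
    rewrite NegzE Gneg; under [X in ccvg _ X]eq_fun do rewrite mulr0.
    exact: ccvg_cst.
  rewrite -[X in ccvg _ _ X](mul0r (ci (fun s => G s * ek k s))).
  apply: ccvgM; last exact: ccvg_cst.
  have lim : (1 - w n ^+ k) @[n --> \oo] --> (0 : R).
    rewrite -[X in _ --> X](subrr 1); apply: cvgB; first exact: cvg_cst.
    rewrite -[X in _ --> X](expr1n _ k).
    apply: (@continuous_cvg _ _ _ _ _ _ (fun x : R => x ^+ k)) => //.
    exact: exprn_continuous.
  have ev : \forall n \near \oo, (1 - w n ^+ k)%:C =
      (if (0 <= k%:Z) && (k%:Z < (N n)%:Z) then (1 - w n ^+ `|k%:Z|)%:C else 1).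
    exists k => // n /= kn; rewrite ifT ?absz_nat//=.
    by rewrite ltz_nat (leq_ltn_trans kn (Nn n)).
  split => /=.
    apply: cvg_trans lim; apply: near_eq_cvg.
    by apply: filterS ev => n <-.
  have c0 : (fun _ : nat => 0 : R) @ \oo --> (0 : R) by exact: cvg_cst.
  apply: cvg_trans c0; apply: near_eq_cvg.
  by apply: filterS ev => n <-.
have part (u : nat -> R -> R) (y : R -> R) : (forall n, measurable_fun setT (u n)) ->
    (forall n t, u n t ^+ 2 <= cabs2 (D n t)) ->
    (forall q, rtrig q -> \int[leb]_(t in I01) (q t * u n t) @[n --> \oo] --> (0 : R)) ->
    {ae leb, forall t, I01 t -> u n t @[n --> \oo] --> y t} ->
    {ae leb, forall t, I01 t -> y t = 0}.
  move=> mu uD uq uy.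
  have iu n : rI leb I01 (fun t => u n t ^+ 2).
    apply: (rI_dom _ _ _ _ mI _ (L2_rI _ _ _ mI (D2 n))); first exact: measurable_funX.
    by move=> t _; rewrite ger0_norm ?sqr_ge0.
  apply: (weak_cvg_ae0 u y (n2 G)) => // n.
  apply: le_trans (abel_rest_norm G (w n) G2 (w01 n) (N n)).
  apply: le_Rintegral; [exact: mI|exact: iu|exact: L2_rI mI (D2 n)|].
  by move=> t _; exact: uD.
have Re0 : {ae leb, forall t, I01 t -> cRe (G t - X t) = 0}.
  apply: (part (fun n t => cRe (D n t))).
  - by move=> n; case: (D2 n) => -[].
  - by move=> n t; rewrite cabs2E lerDl sqr_ge0.
  - move=> q /wk[_ [h _]]; apply: cvg_trans h; apply: near_eq_cvg; apply: nearW => n.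
    by apply: eq_Rintegral => t _; rewrite cReM /= mul0r subr0.
  - by apply: filterS DX => t /[apply] -[].
have Im0 : {ae leb, forall t, I01 t -> cIm (G t - X t) = 0}.
  apply: (part (fun n t => cIm (D n t))).
  - by move=> n; case: (D2 n) => -[].
  - by move=> n t; rewrite cabs2E lerDr sqr_ge0.
  - move=> q /wk[_ [_ h]]; apply: cvg_trans h; apply: near_eq_cvg; apply: nearW => n.
    by apply: eq_Rintegral => t _; rewrite cImM /= mul0r addr0.
  - by apply: filterS DX => t /[apply] -[].
apply: filterS2 Re0 Im0 => t r i It; apply/eqP; rewrite -subr_eq0; apply/eqP.
by apply: complex_eq; [exact: r|exact: i].
Qed.

End RadialLimits.

(** * Changing functions on null sets *)

Section AlmostEverywhereCongruence.
Import HBNNSimple.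
Context {R : realType}.
Local Open Scope ring_scope.
Implicit Types (nu : {measure set (measurableTypeR R) -> \bar R})
  (D : set (measurableTypeR R)).

Let ge0_integral_mono nu (f g : measurableTypeR R -> \bar R) :
  (forall x, 0 <= f x)%E -> (forall x, f x <= g x)%E ->
  (\int[nu]_x f x <= \int[nu]_x g x)%E.
Proof.
move=> f0 fg; rewrite !ge0_integralTE//; last by move=> x; exact: le_trans (fg x).
by apply: le_ereal_sup => _ [h hf <-]; exists h => // x; exact: le_trans (fg x).
Qed.

(** The integral is a supremum over simple functions, and these are measurable. One below [f], cut
    off on the null set, keeps its integral and lies below [g]. *)
Let ge0_integral_ae nu (f g : measurableTypeR R -> \bar R) N :
  measurable N -> nu N = 0%E -> (forall x, 0 <= f x)%E -> (forall x, 0 <= g x)%E ->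
  (forall x, ~ N x -> f x = g x) -> (\int[nu]_x f x <= \int[nu]_x g x)%E.
Proof.
move=> mN N0 f0 g0 fg; rewrite ge0_integralTE//; apply: ge_ereal_sup => _ [h hf <-].
have h0 x : (0 <= (h x)%:E)%E by rewrite lee_fin.
have -> : sintegral nu h = (\int[nu]_x (h x)%:E)%E.
  by rewrite integral_nnsfun// patch_setT.
rewrite (ge0_negligible_integral mN)//; last first.
  by apply/measurable_EFinP; exact: measurable_funP.
rewrite integral_mkcond; apply: ge0_integral_mono => x; rewrite patchE.
  by case: ifP.
by case: ifPn => // /set_mem[_ Nx]; rewrite -fg.
Qed.

(* Stated without measurability because the boundary function [thb] of the theorem
   is only known to agree almost everywhere with a measurable function. *)
Lemma integral_ae_congr nu D (f g : measurableTypeR R -> \bar R) :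
  {ae nu, forall t, D t -> f t = g t} ->
  (\int[nu]_(t in D) f t = \int[nu]_(t in D) g t)%E.
Proof.
move=> [N [mN N0 sub]].
have fg x : ~ N x -> (f \_ D) x = (g \_ D) x.
  move=> Nx; rewrite !patchE; case: ifPn => // /set_mem Dx.
  by apply: contrapT => h; apply: Nx; apply: sub => /= /(_ Dx).
rewrite [LHS]integral_mkcond [RHS]integral_mkcond [LHS]integralE [RHS]integralE.
have gf x : ~ N x -> (g \_ D) x = (f \_ D) x by move=> /fg.
congr (_ - _)%E; apply/eqP; rewrite eq_le; apply/andP; split;
  apply: (ge0_integral_ae nu _ _ N) => // x Nx; rewrite ?funeposE ?funenegE ?fg//.
Qed.

Lemma cint_ae_congr nu D (f g : R -> R[i]) :
  {ae nu, forall t, D t -> f t = g t} -> cint nu D f = cint nu D g.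
Proof.
move=> fg; apply: complex_eq; rewrite /=; congr fine; apply: integral_ae_congr;
  by apply: filterS fg => t /[apply] ->.
Qed.

Lemma Kmodel_ae_congr (th1 th2 : R -> R[i]) : aeeq th1 th2 -> Kmodel th1 = Kmodel th2.
Proof.
move=> e; apply/funext => p; apply/propext.
suff H (a b : R -> R[i]) : aeeq a b -> Kmodel a p -> Kmodel b p.
  by split; apply: H => //; apply: filterS e => t /[apply] ->.
move=> {}e [H1 [[L C] O]]; split => //; split.
  split => // eps /C[h [Lh hC]]; exists h; split => //.
  suff -> : (\int[leb]_(t in I01) (cabs2 (p.2 t - Delta b t * h t))%:E =
      \int[leb]_(t in I01) (cabs2 (p.2 t - Delta a t * h t))%:E)%E by [].
  by apply: integral_ae_congr; apply: filterS e => t /[apply]; rewrite /Delta => ->.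
move=> h /O <-; apply: cint_ae_congr; apply: filterS e => t /[apply] /=.
by rewrite /Delta => ->.
Qed.

Lemma is_Phi_ae_congr (mu : {measure set (measurableTypeR R) -> \bar R}) gam
    (th1 th2 : R -> R[i]) Phi :
  aeeq th1 th2 -> is_Phi mu gam th1 Phi -> is_Phi mu gam th2 Phi.
Proof.
move=> e [P1 P2 P3 P4 P5].
have eK := Kmodel_ae_congr _ _ e.
split => //.
- by move=> f Lf; rewrite -eK; exact: P3.
- by move=> g; rewrite -eK; exact: P4.
- move=> f Lf; have [[Kp pr] [[c1 c2] [d1 d2]]] := P5 f Lf; split.
    by split; [rewrite -eK|move=> k; rewrite -eK; exact: pr].
  split; split; [move: c1|move: c2|move: d1|move: d2]; apply: filterS2 e => t h1 h2 It;
    by rewrite h2//= /Delta h1.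
Qed.

End AlmostEverywhereCongruence.

(** The linear arithmetic of [ip2_Phi], with norms and inner products abstracted to real
    variables. *)
Lemma polarization_cancel (R : realType) (c m1 m2 m3 m4 x1 x2 x3 : R) :
  c * m1 + m2 + 2 * x1 + (c * m3 + m4 + 2 * x2) =
  c * (m1 + m3) + (m2 + m4) + 2 * x3 -> x1 + x2 = x3.
Proof. lra. Qed.

(** * The model operator seen through [minus_part] *)

Section ModelOperator.
Context {R : realType}.
Local Open Scope ring_scope.
Local Notation mI := (@mI01 R).
Local Notation fI := (@leb_I01_fin R).
Local Notation ci := (cint leb I01).
Local Notation n2 := (nrm2 leb I01).

Context (mu : {measure set (measurableTypeR R) -> \bar R}) (gam : R[i]).
Context (mu1 : mu setT = 1%E) (gam1 : cabs2 gam < 1).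
Context (th : R -> R[i]) (mth : cmeasurable th) (th1 : forall t, cabs2 (th t) <= 1).
Context (Phi : (R -> R[i]) -> (R -> R[i]) * (R -> R[i])).
Context (HPhi : is_Phi mu gam th Phi) (theta0 : theta mu gam 0 = - gam).

Let mT : measurable (setT : set (measurableTypeR R)). Proof. exact: measurableT. Qed.
Let fT : (mu setT < +oo)%E. Proof. by rewrite mu1 ltry. Qed.

(** The normalizing constant of both defect vectors, since [theta_gamma(0) = - gam]. *)
Definition defect_scale : R := Num.sqrt (1 - cabs2 gam).
Local Notation s := defect_scale.

Lemma sqrtC_real (x : R) : 0 <= x -> sqrtC x%:C = (Num.sqrt x)%:C.
Proof.
move=> x0; rewrite -{1}(sqr_sqrtr x0) rmorphXn; apply: sqrCK.
by rewrite ler0c sqrtr_ge0.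
Qed.

Let s_gt0 : 0 < s. Proof. by rewrite sqrtr_gt0 subr_gt0. Qed.

Let s2 : s%:C ^+ 2 = 1 - gam * gam^*.
Proof.
by rewrite -rmorphXn /= sqr_sqrtr ?subr_ge0 ?(ltW gam1)// rmorphB rmorph1 mulcJE.
Qed.

Let sn0 : s%:C != 0 :> R[i].
Proof. by rewrite eq_complex /= negb_and gt_eqF. Qed.

Let sqrt_theta0 : sqrtC (1 - `|theta mu gam 0| ^+ 2) = s%:C.
Proof.
rewrite theta0 normrN sqr_normE -(rmorph1 (real_complex R)) -rmorphB sqrtC_real//.
by rewrite subr_ge0 ltW.
Qed.

Definition real_Delta (t : R) : R := Num.sqrt (1 - cabs2 (th t)).
Local Notation dl := real_Delta.

Let DeltaE t : Delta th t = (dl t)%:C.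
Proof.
by rewrite /Delta sqr_normE -(rmorph1 (real_complex R)) -rmorphB sqrtC_real// subr_ge0.
Qed.

Let dl2 t : (dl t)%:C * (dl t)%:C = 1 - th t * (th t)^*.
Proof.
by rewrite -rmorphM -expr2 /= sqr_sqrtr ?subr_ge0// rmorphB rmorph1 mulcJE.
Qed.

Let mdl : cmeasurable (fun t => (dl t)%:C).
Proof.
apply: cmeasurable_real; apply: measurableT_comp.
  by apply: continuous_measurable_fun; exact: sqrt_continuous.
by apply: measurable_funB => //; exact: measurable_cabs2.
Qed.

Let dl_le1 t : cabs2 (dl t)%:C <= 1.
Proof.
by rewrite cabs2_real sqr_sqrtr ?subr_ge0// gerBl cabs2_ge0.
Qed.

Let L2th h : L2 leb I01 h -> L2 leb I01 (fun t => th t * h t).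
Proof. by apply: (L2_mul_bounded _ _ _ _ 1 mI mth). Qed.
Let L2thJ h : L2 leb I01 h -> L2 leb I01 (fun t => (th t)^* * h t).
Proof.
by apply: (L2_mul_bounded _ _ _ _ 1 mI (cmeasurableJ _ mth)) => t _; rewrite cabs2J.
Qed.
Let L2dl h : L2 leb I01 h -> L2 leb I01 (fun t => (dl t)%:C * h t).
Proof. by apply: (L2_mul_bounded _ _ _ _ 1 mI mdl). Qed.
Let L2e (h : R -> R[i]) : L2 leb I01 h -> L2 leb I01 (fun t => expi t * h t).
Proof.
by apply: (L2_mul_bounded _ _ _ _ 1 mI measurable_expi) => t _; rewrite cabs2_expi.
Qed.
Let L2one : L2 leb I01 (fun _ : R => 1). Proof. exact: L2_cst mI fI. Qed.
Let th_L2 : L2 leb I01 th.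
Proof. by have := L2th _ L2one; under eq_fun do rewrite mulr1. Qed.
Let dl_L2 : L2 leb I01 (fun t => (dl t)%:C).
Proof. by have := L2dl _ L2one; under eq_fun do rewrite mulr1. Qed.

(* It sends [(theta h, Delta h)] to [h], so that the model space consists of the
   pairs whose [minus_part] is orthogonal to [H^2]. *)
Definition minus_part (p : (R -> R[i]) * (R -> R[i])) (t : R) : R[i] :=
  (th t)^* * p.1 t + (dl t)%:C * p.2 t.

Lemma minus_partE (p : (R -> R[i]) * (R -> R[i])) t :
  minus_part p t = (th t)^* * p.1 t + Delta th t * p.2 t.
Proof. by rewrite DeltaE. Qed.

Lemma minus_part_L2 p : L2 leb I01 p.1 -> L2 leb I01 p.2 -> L2 leb I01 (minus_part p).
Proof. by move=> p1 p2; apply: (L2D _ _ _ _ mI); [exact: L2thJ|exact: L2dl]. Qed.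

Let K1 p : Kmodel th p -> L2 leb I01 p.1. Proof. by case=> -[]. Qed.
Let K2 p : Kmodel th p -> L2 leb I01 p.2. Proof. by case=> _ [[]]. Qed.
Let KPi p : Kmodel th p -> L2 leb I01 (minus_part p).
Proof. by move=> Kp; apply: minus_part_L2; [exact: K1|exact: K2]. Qed.

Let ip2E p h : ip2 p (fun t => th t * h t, fun t => Delta th t * h t) =
  ci (fun t => minus_part p t * (h t)^*).
Proof.
by apply: eq_cint => t _ /=; rewrite DeltaE !conjE conj_real /minus_part; ring.
Qed.

Let K_orth p h : Kmodel th p -> H2 h -> ci (fun t => minus_part p t * (h t)^*) = 0.
Proof. by move=> [_ [_ O]] Hh; rewrite -ip2E; exact: O. Qed.

Let H2_ek (n : nat) : H2 (@ek R n).
Proof.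
split; first exact: L2_ek.
move=> m m0; have -> : (fun t => ek n t * expi t ^+ m) = @ek R (n + m)%N%:Z.
  by apply/funext => t; rewrite ekX ekM.
rewrite cint_ek; case: eqP => // /eqP; lia.
Qed.

Lemma minus_part_spectrum p (n : nat) : Kmodel th p ->
  ci (fun t => minus_part p t * ek (- n%:Z) t) = 0.
Proof.
move=> Kp; rewrite -(K_orth p _ Kp (H2_ek n)).
by apply: eq_cint => t _; rewrite ekJ.
Qed.

Let ci_minus p : Kmodel th p -> ci (minus_part p) = 0.
Proof.
move=> Kp; rewrite -(minus_part_spectrum p 0 Kp).
by apply: eq_cint => t _; rewrite oppr0 ek0 mulr1.
Qed.

Let one_L2mu : L2mu mu (fun _ => 1). Proof. exact: L2_cst mT fT. Qed.
Let ebar_L2mu : L2mu mu (fun x => (expi x)^*).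
Proof.
apply: (L2_bounded _ _ _ 1 mT fT); first exact: cmeasurableJ measurable_expi.
by move=> t _; rewrite cabs2J cabs2_expi.
Qed.
Let emul_L2mu f : L2mu mu f -> L2mu mu (fun x => expi x * f x).
Proof.
by apply: (L2_mul_bounded _ _ _ _ 1 mT measurable_expi) => t _; rewrite cabs2_expi.
Qed.

Let PhiK f : L2mu mu f -> Kmodel th (Phi f).
Proof. by case: HPhi => _ _ P3 _ _ /P3[]. Qed.

Definition Aminus f := minus_part (Phi f).

Lemma Aminus_L2 f : L2mu mu f -> L2 leb I01 (Aminus f).
Proof. by move=> Lf; apply: KPi; exact: PhiK. Qed.

Lemma Aminus_spectrum f (n : nat) : L2mu mu f ->
  ci (fun t => Aminus f t * ek (- n%:Z) t) = 0.
Proof. by move=> Lf; apply: minus_part_spectrum; exact: PhiK. Qed.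

Lemma Aminus_linear (a : R[i]) f g : L2mu mu f -> L2mu mu g ->
  aeeq (Aminus (fun x => a * f x + g x)) (fun t => a * Aminus f t + Aminus g t).
Proof.
case: HPhi => _ P2 _ _ _ Lf Lg; have [h1 h2] := P2 a f g Lf Lg.
apply: filterS2 h1 h2 => t h1 h2 It.
rewrite /Aminus /minus_part h1// h2//=; ring.
Qed.

Let Phi_one : aeeq2 (Phi (fun _ => 1)) (cgam (theta mu gam 0) th).
Proof. by case: HPhi => _ _ _ _ /(_ _ one_L2mu)[_ []]. Qed.
Let Phi_ebar : aeeq2 (Phi (fun x => (expi x)^*)) (c1gam (theta mu gam 0) th).
Proof. by case: HPhi => _ _ _ _ /(_ _ one_L2mu)[_ []]. Qed.

Lemma Aminus_one : aeeq (Aminus (fun _ => 1)) (fun t => s%:C^-1 * ((th t)^* + gam^*)).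
Proof.
have [h1 h2] := Phi_one; apply: filterS2 h1 h2 => t h1 h2 It.
rewrite /Aminus /minus_part h1// h2//= sqrt_theta0 theta0 DeltaE !conjE.
have -> : (th t)^* * (s%:C^-1 * (1 - - gam^* * th t)) +
    (dl t)%:C * (s%:C^-1 * (- - gam^* * (dl t)%:C)) =
    s%:C^-1 * ((th t)^* + gam^* * (th t * (th t)^* + (dl t)%:C * (dl t)%:C)) by ring.
by rewrite dl2; ring.
Qed.

(** The first component of [Phi^* b_1 = c_1] lies in [H^2] because [Phi^*] maps into the model
    space, and it is a multiple of [z^-1 (theta - theta(0))]. *)
Let th_coef n : (0 < n)%N -> ci (fun t => th t * expi t ^+ n) = 0.
Proof.
move=> n0; have [[_ H] _] := PhiK _ ebar_L2mu; have [h1 _] := Phi_ebar.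
have E : ci (fun t => s%:C^-1 * (th t * expi t ^+ n + gam * ek n t)) = 0.
  rewrite -(H n.+1 isT); apply: cint_ae_congr; apply: filterS h1 => t h1 It.
  rewrite h1//= sqrt_theta0 theta0 -ekX exprS.
  have -> : s%:C^-1 * ((expi t)^-1 * (th t - - gam)) * (expi t * expi t ^+ n) =
    s%:C^-1 * ((th t + gam) * expi t ^+ n) * ((expi t)^-1 * expi t) by ring.
  by rewrite mulVf ?expi_neq0//; ring.
have I1 : cI leb I01 (fun t => th t * expi t ^+ n).
  have := L2_cIM _ _ _ _ mI th_L2 (L2_ek n).
  by under eq_fun do rewrite -ekX.
have I2 : cI leb I01 (fun t => gam * @ek R n t).
  exact: cIZ mI (L2_cI _ _ _ mI fI (L2_ek _)).
move: E; rewrite (cintZ _ _ _ _ mI (cID _ _ _ _ mI I1 I2)) => /eqP.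
rewrite mulf_eq0 invr_eq0 (negbTE sn0) /= (cintD _ _ _ _ mI I1 I2).
rewrite (cintZ _ _ _ _ mI (L2_cI _ _ _ mI fI (L2_ek _))) cint_ek.
have -> : (n%:Z == 0) = false by apply/eqP; lia.
by rewrite mulr0n mulr0 addr0 => /eqP.
Qed.

Let H2_th : H2 th. Proof. by split; [exact: th_L2|exact: th_coef]. Qed.

Let H2_lin (a : R[i]) g h : H2 g -> H2 h -> H2 (fun t => g t + a * h t).
Proof.
move=> [g2 gn] [h2 hn]; split; first exact: L2D mI g2 (L2Z _ _ _ _ mI h2).
move=> n n0.
have -> : (fun t => (g t + a * h t) * expi t ^+ n) =
    (fun t => g t * expi t ^+ n + a * (h t * expi t ^+ n)).
  by apply/funext => t; ring.
have I (f : R -> R[i]) : L2m f -> cI leb I01 (fun t => f t * expi t ^+ n).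
  move=> f2; have := L2_cIM _ _ _ _ mI f2 (L2_ek n).
  by under eq_fun do rewrite -ekX.
rewrite (cintD _ _ _ _ mI (I _ g2) (cIZ _ _ _ _ mI (I _ h2))).
by rewrite (cintZ _ _ _ _ mI (I _ h2)) gn// hn// mulr0 addr0.
Qed.

Let H2_shift (g : R -> R[i]) : H2 g -> H2 (fun t => expi t * g t).
Proof.
move=> [g2 gn]; split; first exact: L2e.
move=> n n0; rewrite -(gn n.+1 isT); apply: eq_cint => t _.
by rewrite exprS; ring.
Qed.

(** The backward shift, which writes [h] as its mean plus [z] times an element of [H^2]. *)
Let H2_unshift (h : R -> R[i]) : H2 h -> H2 (fun t => (expi t)^* * (h t - ci h)).
Proof.
move=> [h2 hn]; have I0 := L2_cI _ _ _ mI fI h2.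
have L0 : L2 leb I01 (fun t => h t - ci h) by exact: L2B mI h2 (L2_cst _ _ _ mI fI).
split.
  apply: (L2_mul_bounded _ _ _ _ 1 mI (cmeasurableJ _ measurable_expi)) => // t _.
  by rewrite cabs2J cabs2_expi.
case=> // n _.
have -> : (fun t => (expi t)^* * (h t - ci h) * expi t ^+ n.+1) =
    (fun t => h t * expi t ^+ n - ci h * ek n t).
  apply/funext => t; rewrite exprS -ekX.
  have -> : (expi t)^* * (h t - ci h) * (expi t * expi t ^+ n) =
    ((expi t)^* * expi t) * ((h t - ci h) * expi t ^+ n) by ring.
  by rewrite expiJM; ring.
have I1 : cI leb I01 (fun t => h t * expi t ^+ n).
  have := L2_cIM _ _ _ _ mI h2 (L2_ek n).
  by under eq_fun do rewrite -ekX.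
have I2 : cI leb I01 (@ek R n) by exact: L2_cI mI fI (L2_ek _).
rewrite (cintB _ _ _ _ mI I1 (cIZ _ _ _ _ mI I2)) (cintZ _ _ _ _ mI I2) cint_ek.
case: n I1 I2 => [|n] _ _; last by rewrite hn// mulr0n mulr0 subr0.
rewrite mulr1n mulr1; under eq_fun do rewrite expr0 mulr1.
by rewrite subrr.
Qed.

Let closDL2_lin (a b : R[i]) g h : cabs2 b <= 1 ->
  closDL2 (Delta th) g -> closDL2 (Delta th) h ->
  closDL2 (Delta th) (fun t => expi t * g t - a * (dl t)%:C - b * h t).
Proof.
move=> b1 [g2 gC] [h2 hC]; have LL : L2 leb I01 (fun t => expi t * g t - a * (dl t)%:C - b * h t).
  apply: (L2B _ _ _ _ mI); last exact: L2Z mI h2.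
  by apply: (L2B _ _ _ _ mI); [exact: L2e|exact: L2Z mI dl_L2].
split => // e e0.
have e40 : 0 < e / 4 by rewrite divr_gt0.
have [g' [Lg hg]] := gC _ e40; have [h' [Lh hh]] := hC _ e40.
(* The constant [a] reproduces the middle term exactly, so only the errors of [g'] and [h']
   remain. *)
pose k t := expi t * g' t - a - b * h' t.
have Lk : L2 leb I01 k.
  apply: (L2B _ _ _ _ mI); last exact: L2Z mI Lh.
  by apply: (L2B _ _ _ _ mI); [exact: L2e|exact: L2_cst mI fI].
exists k; split => //.
have Ldiff (u v : R -> R[i]) : L2m u -> L2m v -> L2 leb I01 (fun t => u t - Delta th t * v t).
  move=> Lu Lv; under eq_fun do rewrite DeltaE; apply: (L2B _ _ _ _ mI) => //.
  exact: L2dl.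
have iG := L2_rI _ _ _ mI (Ldiff _ _ g2 Lg); have iH := L2_rI _ _ _ mI (Ldiff _ _ h2 Lh).
have iK := L2_rI _ _ _ mI (Ldiff _ _ LL Lk).
move: hg hh; rewrite (rI_EFin _ _ _ mI iG) (rI_EFin _ _ _ mI iH) (rI_EFin _ _ _ mI iK).
rewrite !lte_fin => hg hh.
apply: (@le_lt_trans _ _ (\int[leb]_(t in I01) (2 * cabs2 (g t - Delta th t * g' t) +
   2 * cabs2 (h t - Delta th t * h' t)))).
  apply: (le_Rintegral mI iK); first exact: rID mI (rIZ _ _ _ _ mI iG) (rIZ _ _ _ _ mI iH).
  move=> t _; have -> : expi t * g t - a * (dl t)%:C - b * h t - Delta th t * k t =
    expi t * (g t - Delta th t * g' t) - b * (h t - Delta th t * h' t).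
    by rewrite DeltaE /k; ring.
  apply: (le_trans (cabs2B_le _ _)); rewrite !cabs2M cabs2_expi mul1r lerD2l ler_pM2l//.
  by rewrite ler_piMl// cabs2_ge0.
rewrite (RintegralD mI (rIZ _ _ _ _ mI iG) (rIZ _ _ _ _ mI iH)).
rewrite (RintegralZl _ mI iG) (RintegralZl _ mI iH); lra.
Qed.

(* [z g - c (theta, Delta) - p] for [p] in the model space, with [c] chosen so
   that the result is again in the model space: [z g_- - c] is orthogonal to
   [H^2]. *)
Let K_shift g p : Kmodel th g -> Kmodel th p -> let c := ci (fun t => expi t * minus_part g t) in
  Kmodel th (fun t => expi t * g.1 t - c * th t - p.1 t,
             fun t => expi t * g.2 t - c * (dl t)%:C - p.2 t).
Proof.
move=> Kg Kp c; split; last split.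
- have := H2_lin (-1) _ _ (H2_lin (- c) _ _ (H2_shift _ (proj1 Kg)) H2_th) (proj1 Kp).
  by move=> /=; under eq_fun do rewrite mulNr mulN1r.
- have [_ [cg _]] := Kg; have [_ [cp _]] := Kp.
  have := closDL2_lin c 1 _ _ _ cg cp; rewrite cabs2_1 => /(_ (lexx _)) /=.
  by under eq_fun do rewrite mul1r.
move=> h Hh; rewrite ip2E.
have [h2 hn] := Hh; have hJ := L2J _ _ _ mI h2.
have eq1 : (fun t => minus_part (fun t => expi t * g.1 t - c * th t - p.1 t,
             fun t => expi t * g.2 t - c * (dl t)%:C - p.2 t) t * (h t)^*) =
    (fun t => expi t * minus_part g t * (h t)^* - c * (h t)^* - minus_part p t * (h t)^*).
  apply/funext => t; rewrite /minus_part /=.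
  have -> : (th t)^* * (expi t * g.1 t - c * th t - p.1 t) +
     (dl t)%:C * (expi t * g.2 t - c * (dl t)%:C - p.2 t) =
     expi t * ((th t)^* * g.1 t + (dl t)%:C * g.2 t) -
     c * (th t * (th t)^* + (dl t)%:C * (dl t)%:C) -
     ((th t)^* * p.1 t + (dl t)%:C * p.2 t) by ring.
  by rewrite dl2; ring.
rewrite eq1.
have I1 : cI leb I01 (fun t => expi t * minus_part g t * (h t)^*).
  by apply: (L2_cIM _ _ _ _ mI _ hJ); apply: L2e; exact: KPi.
have I2 : cI leb I01 (fun t => (h t)^*) by exact: L2_cI mI fI hJ.
have I3 : cI leb I01 (fun t => minus_part p t * (h t)^*) by exact: L2_cIM mI (KPi _ Kp) hJ.
rewrite (cintB _ _ _ _ mI (cIB _ _ _ _ mI I1 (cIZ _ _ _ _ mI I2)) I3).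
rewrite (cintB _ _ _ _ mI I1 (cIZ _ _ _ _ mI I2)) (cintZ _ _ _ _ mI I2).
rewrite (K_orth _ _ Kp Hh) subr0 (cintJ _ _ _ mI (L2_cI _ _ _ mI fI h2)).
(* Writing [h = z h' + ci h], the part with [h'] is orthogonal to [g_-], and the mean of [h]
   contributes exactly what [c] subtracts. *)
pose h' t := (expi t)^* * (h t - ci h).
have Hh' : H2 h' by exact: H2_unshift.
have -> : (fun t => expi t * minus_part g t * (h t)^*) =
   (fun t => minus_part g t * (h' t)^* + (ci h)^* * (expi t * minus_part g t)).
  apply/funext => t; rewrite /h' !conjE conjCK; ring.
have J1 : cI leb I01 (fun t => minus_part g t * (h' t)^*).
  by apply: (L2_cIM _ _ _ _ mI (KPi _ Kg)); apply: (L2J _ _ _ mI); case: Hh'.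
have J2 : cI leb I01 (fun t => expi t * minus_part g t).
  by apply: (L2_cI _ _ _ mI fI); apply: L2e; exact: KPi.
rewrite (cintD _ _ _ _ mI J1 (cIZ _ _ _ _ mI J2)) (cintZ _ _ _ _ mI J2).
by rewrite (K_orth _ _ Kg Hh') -/c; ring.
Qed.

(** Projections are unique: the difference [d] of the candidate [z g - c (theta, Delta)] and [p]
    lies in the model space. Pairing [z g - p] with [d] gives the squared norm of [d], because the
    correction is [c] times the conjugate mean of [d_-], which is zero. *)
Lemma minus_part_model_operator g p : Kmodel th g ->
  isProjK th (fun t => expi t * g.1 t, fun t => expi t * g.2 t) p ->
  aeeq (minus_part p)
       (fun t => expi t * minus_part g t - ci (fun t => expi t * minus_part g t)).
Proof.
move=> Kg [Kp pr]; set c := ci _.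
pose d := (fun t => expi t * g.1 t - c * th t - p.1 t,
           fun t => expi t * g.2 t - c * (dl t)%:C - p.2 t).
have Kd : Kmodel th d by exact: K_shift.
have d1 := K1 _ Kd; have d2 := K2 _ Kd.
have := pr _ Kd; rewrite /ip2 /=.
have -> : (fun t => (expi t * g.1 t - p.1 t) * (d.1 t)^* + (expi t * g.2 t - p.2 t) * (d.2 t)^*) =
   (fun t => d.1 t * (d.1 t)^* + d.2 t * (d.2 t)^* + c * (minus_part d t)^*).
  by apply/funext => t; rewrite /minus_part !conjE conjCK conj_real /=; ring.
have I1 := L2_cIM _ _ _ _ mI d1 (L2J _ _ _ mI d1).
have I2 := L2_cIM _ _ _ _ mI d2 (L2J _ _ _ mI d2).
have I3 : cI leb I01 (minus_part d) by apply: (L2_cI _ _ _ mI fI); exact: KPi.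
have I3J := cIJ _ _ _ mI I3.
rewrite (cintD _ _ _ _ mI (cID _ _ _ _ mI I1 I2) (cIZ _ _ _ _ mI I3J)).
rewrite (cintD _ _ _ _ mI I1 I2) (cintZ _ _ _ _ mI I3J) (cintJ _ _ _ mI I3).
rewrite (ci_minus _ Kd) conj0 mulr0 addr0 !cint_mulJ -rmorphD => /(congr1 (@complex.Re R)) /= nd.
move/eqP: nd; rewrite paddr_eq0 ?nrm2_ge0// => /andP[/eqP z1 /eqP z2].
have a1 := nrm2_eq0 _ _ _ mI d1 z1; have a2 := nrm2_eq0 _ _ _ mI d2 z2.
apply: filterS2 a1 a2 => t e1 e2 It.
have {}e1 : p.1 t = expi t * g.1 t - c * th t.
  by apply/eqP; rewrite eq_sym -subr_eq0; apply/eqP; exact: e1.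
have {}e2 : p.2 t = expi t * g.2 t - c * (dl t)%:C.
  by apply/eqP; rewrite eq_sym -subr_eq0; apply/eqP; exact: e2.
rewrite /minus_part e1 e2.
have -> : (th t)^* * (expi t * g.1 t - c * th t) +
     (dl t)%:C * (expi t * g.2 t - c * (dl t)%:C) =
     expi t * ((th t)^* * g.1 t + (dl t)%:C * g.2 t) -
     c * (th t * (th t)^* + (dl t)%:C * (dl t)%:C) by ring.
by rewrite dl2; ring.
Qed.

Let iso f : L2mu mu f -> n2 (Phi f).1 + n2 (Phi f).2 = nrm2 mu setT f.
Proof.
move=> Lf; have Kf := PhiK _ Lf; case: HPhi => _ _ P3 _ _; have [_ E] := P3 f Lf.
have i1 := L2_rI _ _ _ mI (K1 _ Kf); have i2 := L2_rI _ _ _ mI (K2 _ Kf).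
move: E; rewrite (rI_EFin _ _ _ mI (rID _ _ _ _ mI i1 i2)).
rewrite (rI_EFin _ _ _ mT (L2_rI _ _ _ mT Lf)) => -[].
by rewrite (RintegralD mI i1 i2).
Qed.

(** Polarization of [iso] on [a f + g]: the choices [a = 1] and [a = - i] give the real and the
    imaginary part. *)
Let ip2_Phi f g : L2mu mu f -> L2mu mu g ->
  ip2 (Phi f) (Phi g) = cint mu setT (fun x => f x * (g x)^*).
Proof.
move=> Lf Lg; have Kf := PhiK _ Lf; have Kg := PhiK _ Lg.
have If := L2_cIM _ _ _ _ mT Lf (L2J _ _ _ mT Lg).
have J1 := L2_cIM _ _ _ _ mI (K1 _ Kf) (L2J _ _ _ mI (K1 _ Kg)).
have J2 := L2_cIM _ _ _ _ mI (K2 _ Kf) (L2J _ _ _ mI (K2 _ Kg)).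
have ipE : ip2 (Phi f) (Phi g) = ci (fun t => (Phi f).1 t * ((Phi g).1 t)^*) +
    ci (fun t => (Phi f).2 t * ((Phi g).2 t)^*).
  by rewrite -(cintD _ _ _ _ mI J1 J2).
have key (a : R[i]) : cRe (a * ip2 (Phi f) (Phi g)) =
    cRe (a * cint mu setT (fun x => f x * (g x)^*)).
  have Laf : L2mu mu (fun x => a * f x) by exact: L2Z mT Lf.
  have Lafg : L2mu mu (fun x => a * f x + g x) by exact: L2D mT Laf Lg.
  have := iso _ Lafg; case: HPhi => _ P2 _ _ _; have [h1 h2] := P2 a f g Lf Lg.
  have Kafg := PhiK _ Lafg.
  have nE (u v w : R -> R[i]) : L2 leb I01 u -> L2 leb I01 v -> L2 leb I01 w ->
      aeeq w (fun t => a * u t + v t) ->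
      n2 w = cabs2 a * n2 u + n2 v + 2 * cRe (a * ci (fun t => u t * (v t)^*)).
    move=> u2 v2 w2 e; have au2 := L2Z _ _ a _ mI u2.
    have auv2 := L2D _ _ _ _ mI au2 v2.
    have -> : n2 w = n2 (fun t => a * u t + v t).
      apply: (ae_eq_Rintegral _ _ _ _ mI).
      + by apply: measurable_cabs2; case: w2.
      + by apply: measurable_cabs2; case: auv2.
      + by apply: filterS e => t /[apply] ->.
    rewrite (nrm2D _ _ _ _ mI au2 v2) (nrm2Z _ _ _ _ mI u2).
    have -> : (fun t => a * u t * (v t)^*) = (fun t => a * (u t * (v t)^*)).
      by apply/funext => t; rewrite mulrA.
    by rewrite (cintZ _ _ _ _ mI (L2_cIM _ _ _ _ mI u2 (L2J _ _ _ mI v2))).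
  rewrite (nE _ _ _ (K1 _ Kf) (K1 _ Kg) (K1 _ Kafg) h1).
  rewrite (nE _ _ _ (K2 _ Kf) (K2 _ Kg) (K2 _ Kafg) h2).
  rewrite (nrm2D _ _ _ _ mT Laf Lg) (nrm2Z _ _ _ _ mT Lf) -(iso _ Lf) -(iso _ Lg).
  have -> : (fun x => a * f x * (g x)^*) = (fun x => a * (f x * (g x)^*)).
    by apply/funext => t; rewrite mulrA.
  rewrite (cintZ _ _ _ _ mT If) ipE [a * (_ + _)]mulrDr cReD.
  exact: polarization_cancel.
apply: complex_eq; first by have := key 1; rewrite !mul1r.
have := key (- 'i%C); rewrite !cReM /= !oppr0 !mul0r !sub0r.
by rewrite !mulN1r !opprK.
Qed.

(** The right side is [s] times the inner product of [Phi^* f] with [c_1]. Expanding [c_1] leaves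
    the left side plus a multiple of the mean of [z g_1], which vanishes for [g_1] in [H^2]. *)
Let shift_coef f : L2mu mu f -> ci (fun t => expi t * Aminus f t) =
  s%:C * cint mu setT (fun x => f x * expi x).
Proof.
move=> Lf; have Kf := PhiK _ Lf.
have -> : (fun x => f x * expi x) = (fun x => f x * ((expi x)^*)^*).
  by apply/funext => x; rewrite conjCK.
rewrite -(ip2_Phi _ _ Lf ebar_L2mu).
have [h1 h2] := Phi_ebar.
have I1 : cI leb I01 (fun t => expi t * Aminus f t).
  by apply: (L2_cI _ _ _ mI fI); apply: L2e; exact: Aminus_L2.
have I2 : cI leb I01 (fun t => (Phi f).1 t * expi t ^+ 1).
  have := L2_cIM _ _ _ _ mI (K1 _ Kf) (L2_ek 1).
  by under eq_fun do rewrite ek1 -[expi _]expr1.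
have -> : ip2 (Phi f) (Phi (fun x => (expi x)^*)) =
    ci (fun t => s%:C^-1 * (expi t * Aminus f t + gam^* * ((Phi f).1 t * expi t ^+ 1))).
  apply: cint_ae_congr; apply: filterS2 h1 h2 => t h1 h2 It.
  rewrite h1// h2//= sqrt_theta0 theta0 DeltaE expiV !conjE conjCK !conj_real.
  by rewrite /Aminus /minus_part expr1; ring.
rewrite (cintZ _ _ _ _ mI (cID _ _ _ _ mI I1 (cIZ _ _ _ _ mI I2))).
rewrite (cintD _ _ _ _ mI I1 (cIZ _ _ _ _ mI I2)) (cintZ _ _ _ _ mI I2).
have [[_ ->//] _] := Kf.
by rewrite mulr0 addr0 mulrA divff ?mul1r.
Qed.

(* [Phi^*] intertwines, and [U_gamma] is a rank-one perturbation of [M_xi]. *)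
Lemma Aminus_shift f : L2mu mu f ->
  aeeq (Aminus (fun x => expi x * f x))
       (fun t => expi t * Aminus f t + ((1 - gam) * Aminus (fun _ => 1) t - s%:C) *
                 cint mu setT (fun x => f x * expi x)).
Proof.
move=> Lf; case: (HPhi) => _ _ _ _ /(_ _ Lf)[pr _].
have := minus_part_model_operator _ _ (PhiK _ Lf) pr.
rewrite -/(Aminus f) (shift_coef _ Lf).
set J := cint _ _ _ => h1.
have U : Ugam mu gam f = (fun x => (gam - 1) * J * 1 + expi x * f x).
  apply/funext => x; rewrite /Ugam addrC; congr ((gam - 1) * _ * 1 + _).
  by rewrite /J; congr cint; apply/funext => y; rewrite conjCK.
have := Aminus_linear ((gam - 1) * J) _ _ one_L2mu (emul_L2mu _ Lf).
rewrite -U => h2; apply: filterS2 h1 h2 => t h1 h2 It.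
have := h2 It; rewrite /Aminus h1// -/(Aminus f t) => h.
have -> : minus_part (Phi (fun x => expi x * f x)) t =
    expi t * Aminus f t - s%:C * J - (gam - 1) * J * minus_part (Phi (fun _ => 1)) t.
  by rewrite h; ring.
by ring.
Qed.

End ModelOperator.

(** * Consequences of the shift relation alone: Cauchy integrals and moments *)

Section Resolvent.
Context {R : realType}.
Local Open Scope ring_scope.
Local Notation mI := (@mI01 R).
Local Notation fI := (@leb_I01_fin R).
Local Notation ci := (cint leb I01).

Context (mu : {measure set (measurableTypeR R) -> \bar R}) (gam : R[i]) (s : R).
Context (mu1 : mu setT = 1%E) (s0 : s%:C != 0 :> R[i]).
Context (A : (R -> R[i]) -> (R -> R[i])).
Context (A2 : forall f, L2mu mu f -> L2 leb I01 (A f)).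
Context (Aspec : forall f (n : nat), L2mu mu f ->
  ci (fun t => A f t * ek (- n%:Z) t) = 0).
Context (Alin : forall (a : R[i]) f g, L2mu mu f -> L2mu mu g ->
  aeeq (A (fun x => a * f x + g x)) (fun t => a * A f t + A g t)).
Context (Ashift : forall f, L2mu mu f ->
  aeeq (A (fun x => expi x * f x))
       (fun t => expi t * A f t + ((1 - gam) * A (fun _ => 1) t - s%:C) *
                 cint mu setT (fun x => f x * expi x))).

Let mT : measurable (setT : set (measurableTypeR R)). Proof. exact: measurableT. Qed.
Let fT : (mu setT < +oo)%E. Proof. by rewrite mu1 ltry. Qed.
Let one_L2mu : L2mu mu (fun _ => 1). Proof. exact: L2_cst mT fT. Qed.
Let beta t := (1 - gam) * A (fun _ => 1) t - s%:C.
Let beta2 : L2 leb I01 beta.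
Proof. by apply: L2B mI (L2Z _ _ _ _ mI (A2 _ one_L2mu)) (L2_cst _ _ _ mI fI). Qed.

(** This is [l / (l - z)] at [z = expi u], for the exterior point [l = expi t / w]. *)
Let ker (w t u : R) : R[i] := (1 - w%:C * (expi t)^* * expi u)^-1.

Section Point.
Context (w t : R) (w01 : 0 < w < 1).

Let cabs2_y u : cabs2 (w%:C * (expi t)^* * expi u) = w ^+ 2.
Proof. by rewrite !cabs2M cabs2_real cabs2J !cabs2_expi !mulr1. Qed.

Let w01' : 0 <= w < 1. Proof. by case/andP: w01 => /ltW ->. Qed.

Let one_w0 : 0 < (1 - w) ^+ 2.
Proof. by case/andP: w01 => _ w1; rewrite exprn_gt0// subr_gt0. Qed.

Let ker_den u : 1 - w%:C * (expi t)^* * expi u != 0.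
Proof.
apply/eqP => h; have := cabs2_sub1_ge _ _ w01' (cabs2_y u).
by rewrite h cabs2_0 leNgt one_w0.
Qed.

Let mker : cmeasurable (ker w t).
Proof.
apply: cmeasurableV; apply: cmeasurableB; first exact: cmeasurable_cst.
by apply: cmeasurableM; [exact: cmeasurable_cst|exact: measurable_expi].
Qed.

Let ker_bound u : cabs2 (ker w t u) <= ((1 - w) ^+ 2)^-1.
Proof.
have h := cabs2_sub1_ge _ _ w01' (cabs2_y u).
by rewrite cabs2V lef_pV2 ?posrE// (lt_le_trans one_w0).
Qed.

Let ker_mul_L2 (f : R -> R[i]) : L2 leb I01 f -> cI leb I01 (fun u => f u * ker w t u).
Proof.
move=> f2; apply: (L2_cIM _ _ _ _ mI f2).
by apply: (L2_bounded _ _ _ _ mI fI mker) => u _; exact: ker_bound.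
Qed.

(** Only the constant term of the geometric series has nonzero mean, and the tail estimate of
    [cauchy_kernel_approx] tends to [0]. *)
Let ci_ker : ci (ker w t) = 1.
Proof.
have h N := cauchy_kernel_approx (fun _ : R => 1) w (L2_cst _ _ _ mI fI) w01' N t.
have E : ci (fun u => 1 / (1 - w%:C * (expi t)^* * expi u)) = ci (ker w t).
  by apply: eq_cint => u _; rewrite mul1r.
have S N : \sum_(k < N.+1) (w%:C * (expi t)^*) ^+ k * ci (fun u : R => 1 * ek k u) = 1.
  rewrite big_ord_recl big1 ?addr0.
    rewrite expr0 mul1r; have -> : (fun u : R => 1 * ek (ord0 : 'I_N.+1) u) = @ek R 0.
      by apply/funext => u; rewrite mul1r.
    by rewrite cint_ek.
  move=> i _; have -> : (fun u : R => 1 * ek (lift ord0 i) u) = @ek R (lift ord0 i)%:Z.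
    by apply/funext => u; rewrite mul1r.
  by rewrite cint_ek /= mulr0.
pose C := (1 - w)^-1 * (1 + nrm2 leb I01 (fun _ : R => 1)).
have lim : - (w ^+ N.+1 * C) @[N --> \oo] --> (0 : R).
  rewrite -oppr0 -(mul0r C); apply: cvgN; apply: cvgM; last exact: cvg_cst.
  rewrite (cvg_shiftS (fun n => w ^+ n)); apply: cvg_expr.
  by case/andP: w01' => ? ?; rewrite ger0_norm.
have zero (x : R) : (forall N, `|x| <= w ^+ N.+1 * C) -> x = 0.
  move=> xN; apply/eqP; rewrite -normr_le0 -oppr_ge0 -[X in X <= _]oppr0.
  rewrite lerN2; apply: (@le_trans _ _ (- 0)); last by rewrite oppr0.
  have lim' : `|x| - w ^+ N.+1 * C @[N --> \oo] --> `|x| + 0.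
    by apply: cvgD => //; exact: cvg_cst.
  by rewrite oppr0 -[X in X <= _]addr0; apply: (cvgn_le_cst _ _ _ lim') => N; rewrite subr_le0.
apply/eqP; rewrite -subr_eq0; apply/eqP.
by apply: complex_eq; apply: zero => N; have := h N.+1; rewrite E S -mulrA => -[].
Qed.

(* With [h = F / (xi - lambda)], [lambda = e(t) / w], the shift relation gives
   [A F = (z - lambda) A h + beta T F(lambda)], and the Cauchy integral at
   [lambda] annihilates [(z - lambda) A h]. *)
Let cauchy_A F : L2mu mu F ->
  ci (fun u => A F u * ker w t u) =
  Tr mu w^-1 F (expi t) * ci (fun u => beta u * ker w t u).
Proof.
move=> LF; case/andP: (w01) => w0 w1; pose l := w^-1%:C * expi t.
have wn0 : w%:C != 0 :> R[i] by rewrite eq_complex /= negb_and gt_eqF.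
have wl : w%:C * (expi t)^* * l = 1.
  rewrite /l; have -> : w%:C * (expi t)^* * (w^-1%:C * expi t) =
    (w%:C * w^-1%:C) * ((expi t)^* * expi t) by ring.
  by rewrite expiJM fmorphV mulfV// mulr1.
have fact u : expi u - l = - l * (1 - w%:C * (expi t)^* * expi u).
  rewrite mulrBr mulr1 mulNr opprK.
  have -> : l * (w%:C * (expi t)^* * expi u) = (w%:C * (expi t)^* * l) * expi u by ring.
  by rewrite wl mul1r addrC.
have ln0 : l != 0 by apply: contraTneq isT => l0; move: wl; rewrite l0 mulr0 => /eqP;
  rewrite eq_sym oner_eq0.
have den u : expi u - l != 0 by rewrite fact mulf_neq0 ?oppr_eq0.
pose h u := (expi u - l)^-1 * F u.
have Lh : L2mu mu h.
  apply: (L2_mul_bounded _ _ _ _ ((cabs2 l)^-1 * ((1 - w) ^+ 2)^-1) mT _ _ LF).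
    apply: cmeasurableV; apply: cmeasurableB; first exact: measurable_expi.
    exact: cmeasurable_cst.
  move=> u _; rewrite cabs2V fact cabs2M cabs2N invfM ler_wpM2l ?invr_ge0 ?cabs2_ge0//.
  by have := ker_bound u; rewrite cabs2V.
have Leh : L2mu mu (fun u => expi u * h u).
  by apply: (L2_mul_bounded _ _ _ _ 1 mT measurable_expi _ Lh) => u _; rewrite cabs2_expi.
have FE : F = (fun u => (- l) * h u + expi u * h u).
  apply/funext => u; rewrite -mulrDl addrC /h mulrA mulfV ?mul1r//; exact: den.
have TE : cint mu setT (fun u => h u * expi u) = Tr mu w^-1 F (expi t).
  apply: eq_cint => u _; rewrite /h mulrAC mulrC; congr (_ * _).
  have -> : expi u - l = expi u * (1 - w^-1%:C * (expi u)^* * expi t).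
    rewrite mulrBr mulr1 /l; congr (_ - _).
    have -> : expi u * (w^-1%:C * (expi u)^* * expi t) =
      ((expi u)^* * expi u) * (w^-1%:C * expi t) by ring.
    by rewrite expiJM mul1r.
  by rewrite invfM mulrAC mulVf ?mul1r// expi_neq0.
have AF : aeeq (A F) (fun u => (expi u - l) * A h u + beta u * Tr mu w^-1 F (expi t)).
  have h1 := Alin (- l) _ _ Lh Leh; have h2 := Ashift _ Lh.
  rewrite -FE in h1; apply: filterS2 h1 h2 => u h1 h2 Iu.
  by rewrite h1// h2// TE /beta; ring.
have -> : ci (fun u => A F u * ker w t u) =
    ci (fun u => (- l) * A h u + Tr mu w^-1 F (expi t) * (beta u * ker w t u)).
  apply: cint_ae_congr; apply: filterS AF => u AF Iu; rewrite AF// fact /ker.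
  have kd := ker_den u; rewrite mulrDl; congr (_ + _); last by ring.
  by rewrite [- l * _ * _]mulrAC mulfK.
have I1 : cI leb I01 (A h) by exact: L2_cI mI fI (A2 _ Lh).
have I2 := ker_mul_L2 _ beta2.
rewrite (cintD _ _ _ _ mI (cIZ _ _ _ _ mI I1) (cIZ _ _ _ _ mI I2)).
rewrite (cintZ _ _ _ _ mI I1) (cintZ _ _ _ _ mI I2).
have -> : ci (A h) = 0.
  rewrite -(Aspec h 0 Lh); apply: eq_cint => u _.
  by rewrite oppr0 ek0 mulr1.
by rewrite mulr0 add0r.
Qed.

Lemma cauchy_integral_A F : L2mu mu F ->
  ci (fun u => A F u / (1 - w%:C * (expi t)^* * expi u)) =
  Tr mu w^-1 F (expi t) * (- s%:C / (1 - (1 - gam) * Tr mu w^-1 (fun _ => 1) (expi t))).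
Proof.
move=> LF; rewrite -[LHS]/(ci (fun u => A F u * ker w t u)) (cauchy_A _ LF); congr (_ * _).
set b := ci _; set T1 := Tr _ _ _ _.
have I1 := ker_mul_L2 _ (A2 _ one_L2mu).
have Ik : cI leb I01 (ker w t).
  have := ker_mul_L2 _ (L2_cst leb I01 1 mI fI).
  by under eq_fun do rewrite mul1r.
(* [beta] itself contains [A 1], so [cauchy_A] for the function [1] turns the definition of [b] into
   a linear equation for [b]. *)
have bE : b = (1 - gam) * (T1 * b) - s%:C.
  rewrite /T1 /b -(cauchy_A _ one_L2mu).
  have -> : (fun u => beta u * ker w t u) =
    (fun u => (1 - gam) * (A (fun _ => 1) u * ker w t u) - s%:C * ker w t u).
    by apply/funext => u; rewrite /beta; ring.
  rewrite (cintB _ _ _ _ mI (cIZ _ _ _ _ mI I1) (cIZ _ _ _ _ mI Ik)).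
  by rewrite (cintZ _ _ _ _ mI I1) (cintZ _ _ _ _ mI Ik) ci_ker mulr1.
have bD : b * (1 - (1 - gam) * T1) = - s%:C.
  rewrite mulrBr mulr1 {1}bE; ring.
have D0 : 1 - (1 - gam) * T1 != 0.
  apply/eqP => D0; move: bD; rewrite D0 mulr0 => /eqP.
  by rewrite eq_sym oppr_eq0 (negbTE s0).
by rewrite -bD mulfK.
Qed.

End Point.

(** Induction on the power: if [A] kills [1] and [z^n], the shift relation makes [A z^(n+1)] the
    constant [- s] times the next moment. Its mean is zero, so that moment vanishes and the
    induction continues. *)
Lemma moments_zero : aeeq (A (fun _ => 1)) (fun _ => 0) ->
  forall n : nat, cint mu setT (fun x => ek n.+1 x) = 0.
Proof.
move=> A1.
have L (n : nat) : L2mu mu (ek n).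
  apply: (L2_bounded _ _ _ 1 mT fT (measurable_ek n)) => x _.
  by rewrite cabs2_ek.
have step (n : nat) : aeeq (A (ek n)) (fun _ => 0) ->
    cint mu setT (fun x => ek n.+1 x) = 0 /\ aeeq (A (ek n.+1)) (fun _ => 0).
  move=> An; have := Ashift _ (L n).
  have -> : (fun x => expi x * ek n x) = @ek R n.+1.
    by apply/funext => x; rewrite -ek1 ekM intS.
  have -> : (fun x => ek n x * expi x) = @ek R n.+1.
    by apply/funext => x; rewrite -ek1 ekM intS addrC.
  set m := cint mu setT _ => h.
  have {}h : aeeq (A (ek n.+1)) (fun _ => - (s%:C * m)).
    apply: filterS3 An A1 h => t h1 h2 h3 It.
    by rewrite h3// h1// h2//; ring.
  have m0 : m = 0.
    have := Aspec _ 0 (L n.+1).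
    rewrite (cint_ae_congr _ _ _ (fun _ => - (s%:C * m))); last first.
      by apply: filterS h => t ht It; rewrite ht// oppr0 ek0 mulr1.
    rewrite (cint_cst _ _ _ mI leb_I01) => /eqP.
    by rewrite oppr_eq0 mulf_eq0 (negbTE s0) => /eqP.
  split => //; apply: filterS h => t h It.
  by rewrite h// m0 mulr0 oppr0.
have zero (n : nat) : aeeq (A (ek n)) (fun _ => 0).
  elim: n => [|n IH]; last by have [] := step n IH.
  have -> : @ek R 0 = (fun _ => 1) by apply/funext => t; rewrite ek0.
  exact: A1.
by move=> n; have [] := step n (zero n).
Qed.

End Resolvent.

(** * A measure on the circle with the moments of Lebesgue measure *)

Section MomentProblem.
Context {R : realType}.
Local Open Scope ring_scope.
Local Notation mI := (@mI01 R).
Local Notation fI := (@leb_I01_fin R).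

Lemma moments_determine_lebesgue (mu : {measure set (measurableTypeR R) -> \bar R}) :
  mu setT = 1%E -> mu (~` I01) = 0%E ->
  (forall n : nat, cint mu setT (fun x => ek n.+1 x) = 0) ->
  forall E : set (measurableTypeR R), measurable E -> mu E = leb (E `&` I01).
Proof.
move=> mu1 muI mom E mE.
have mT : measurable (setT : set (measurableTypeR R)) by exact: measurableT.
have mCI : measurable (~` @I01 R) by apply: measurableC; exact: mI.
have muEI (B : set (measurableTypeR R)) : measurable B -> mu B = mu (B `&` I01).
  move=> mB; rewrite -[in LHS](setIT B) -(setUv I01) setIUr measureU.
  - apply: etrans (adde0 _); congr (_ + _)%E.
    apply/eqP; rewrite -measure_le0 -muI; apply: le_measure; rewrite ?inE//.
    exact: measurableI.
  - by apply: measurableI => //; exact: mI.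
  - exact: measurableI.
  - by rewrite -setIIr setICr setI0.
have muI1 : mu I01 = 1%E by rewrite -mu1 (muEI setT)// setTI.
have muIfin : (mu I01 < +oo)%E by rewrite muI1 ltry.
have muTfin : (mu setT < +oo)%E by rewrite mu1 ltry.
have aeI : {ae mu, forall x, I01 x}.
  by exists (~` I01); split => // x /= h.
have trigE f : trig f -> (cI mu I01 f /\ cI leb I01 f) /\ cint mu I01 f = cint leb I01 f.
  have Iek (nu : {measure set (measurableTypeR R) -> \bar R}) k :
      (nu I01 < +oo)%E -> cI nu I01 (@ek R k).
    move=> fn; apply: (L2_cI _ _ _ mI fn).
    apply: (L2_bounded _ _ _ 1 mI fn (measurable_ek k)) => x _.
    by rewrite cabs2_ek.
  have momI k : cint mu I01 (@ek R k) = cint mu setT (@ek R k).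
    apply: complex_eq; rewrite /= /Rintegral; congr fine; rewrite [LHS]integral_mkcond;
    apply: integral_ae_congr; by apply: filterS aeI => x Ix _; rewrite patchE mem_set.
  have momJ k : cint mu I01 (@ek R (- k)) = (cint mu I01 (@ek R k))^*.
    rewrite -(cintJ _ _ _ mI (Iek mu k muIfin)).
    by apply: eq_cint => x _; rewrite ekJ.
  elim=> [c k|g h _ [[g1 g2] gE] _ [[h1 h2] hE]]; last first.
    split; first by split; [exact: cID mI g1 h1|exact: cID mI g2 h2].
    by rewrite (cintD _ _ _ _ mI g1 h1) (cintD _ _ _ _ mI g2 h2) gE hE.
  have i1 := Iek mu k muIfin; have i2 := Iek leb k fI.
  split; first by split; [exact: cIZ mI i1|exact: cIZ mI i2].
  rewrite (cintZ _ _ _ _ mI i1) (cintZ _ _ _ _ mI i2) cint_ek; congr (_ * _).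
  case: k {i1 i2} => [[|n]|n].
  - rewrite eqxx mulr1n; apply: etrans (cint_cst _ _ 1 mI muI1).
    by apply: eq_cint => x _; rewrite ek0.
  - by rewrite momI; exact: mom.
  - by rewrite NegzE momJ momI mom conj0.
(* One polynomial has to approximate the indicator for [mu] and for Lebesgue measure at once. *)
pose nu := measure_add mu leb.
have nufin : (nu I01 < +oo)%E.
  by rewrite /nu measure_addE lte_add_pinfty//; exact: fI.
have uE := unit_valued_indic E mE.
have key (e : R) : 0 < e ->
    `|\int[mu]_(t in I01) \1_E t - \int[leb]_(t in I01) \1_E t| <= e.
  move=> e0; have [q [tq q01 qE]] := trig_approx_indic nu nufin E mE e e0.
  have mq := rtrig_measurable _ tq.
  have [[[q1 _] [q2 _]] /(congr1 (@complex.Re R)) /= qq] := trigE _ tq.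
  have iE (n : {measure set (measurableTypeR R) -> \bar R}) : (n I01 < +oo)%E -> rI n I01 \1_E.
    move=> fn; apply: (rI_bounded _ _ _ 1 mI fn) => [|t _]; first by case: uE.
    by rewrite ger0_norm; case/andP: (uE.2 t).
  have md : measurable_fun setT (fun t => `|\1_E t - q t|).
    by apply: measurableT_comp => //; apply: measurable_funB => //; case: uE.
  have id (n : {measure set (measurableTypeR R) -> \bar R}) : (n I01 < +oo)%E ->
      rI n I01 (fun t => `|\1_E t - q t|).
    move=> fn; apply: (rI_bounded _ _ _ 1 mI fn) => // t _.
    rewrite normr_id ler_norml; move: (q01 t) (uE.2 t) => /andP[? ?] /andP[? ?].
    by apply/andP; split; lra.
  have i1 := iE mu muIfin; have i2 := iE leb fI.
  have -> : \int[mu]_(t in I01) \1_E t - \int[leb]_(t in I01) \1_E t =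
      \int[mu]_(t in I01) (\1_E t - q t) - \int[leb]_(t in I01) (\1_E t - q t).
    rewrite (RintegralB mI i1 q1) (RintegralB mI i2 q2) qq; ring.
  apply: (le_trans (ler_normB _ _)).
  have d1 := le_normr_Rintegral mI (rIB _ _ _ _ mI i1 q1).
  have d2 := le_normr_Rintegral mI (rIB _ _ _ _ mI i2 q2).
  apply: (le_trans (lerD d1 d2)); apply: le_trans qE.
  rewrite [leRHS]/Rintegral ge0_integral_measure_add//; last 2 first.
  - exact: mI.
  - by apply/measurable_EFinP; exact: measurable_funTS.
  rewrite (rI_EFin _ _ _ mI (id mu muIfin)).
  by rewrite (rI_EFin _ _ _ mI (id leb fI)) -EFinD /=.
have EE : \int[mu]_(t in I01) \1_E t = \int[leb]_(t in I01) \1_E t.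
  apply/eqP; rewrite -subr_eq0 -normr_le0; apply/ler_addgt0Pr => e e0.
  by rewrite add0r; exact: key.
have mEI : measurable (E `&` I01) by apply: measurableI => //; exact: mI.
have f1 : (mu (E `&` I01) < +oo)%E.
  by apply: le_lt_trans muIfin; apply: le_measure; rewrite ?inE//; exact: mI.
have f2 : (leb (E `&` I01) < +oo)%E.
  by apply: le_lt_trans fI; apply: le_measure; rewrite ?inE//; exact: mI.
rewrite (muEI _ mE).
have h1 : (\int[mu]_(t in I01) (\1_E t)%:E = mu (E `&` I01))%E.
  by rewrite integral_indic//; exact: mI.
have h2 : (\int[leb]_(t in I01) (\1_E t)%:E = leb (E `&` I01))%E.
  by rewrite integral_indic//; exact: mI.
move: EE; rewrite /Rintegral h1 h2 => EE.
by rewrite -(fineK (x := mu _)) ?ge0_fin_numE// EE fineK// ge0_fin_numE.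
Qed.

End MomentProblem.

(** * Reflection of Cauchy integrals across the circle *)

Section BoundaryValues.
Context {R : realType}.
Local Open Scope ring_scope.
Context (mu : {measure set (measurableTypeR R) -> \bar R}) (mu1 : mu setT = 1%E).

Let mT : measurable (setT : set (measurableTypeR R)). Proof. exact: measurableT. Qed.
Let fT : (mu setT < +oo)%E. Proof. by rewrite mu1 ltry. Qed.

Section Exterior.
Context (w t : R) (w01 : 0 < w < 1).

Let p (x : R) : R[i] := (expi x)^* * (w%:C * expi t).

Let cabs2_p x : cabs2 (p x) = w ^+ 2.
Proof. by rewrite /p !cabs2M cabs2J !cabs2_expi cabs2_real mul1r mulr1. Qed.

Let den x : 1 - p x != 0.
Proof.
case/andP: w01 => w0 w1; have w01' : 0 <= w < 1 by rewrite ltW.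
apply/eqP => h; have := cabs2_sub1_ge _ _ w01' (cabs2_p x).
by rewrite h cabs2_0 leNgt exprn_gt0// subr_gt0.
Qed.

Let T1_kernel x : 1 / (1 - w^-1%:C * (expi x)^* * expi t) = - (p x)^* / (1 - (p x)^*).
Proof.
have wn0 : w%:C != 0 :> R[i].
  by rewrite eq_complex /= negb_and gt_eqF//; case/andP: w01.
have pn0 : (p x)^* != 0.
  by rewrite /p !conjE conjCK conj_real !mulf_neq0// ?expi_neq0// -expiN expi_neq0.
have -> : w^-1%:C * (expi x)^* * expi t = ((p x)^*)^-1.
  rewrite /p !conjE conjCK conj_real !invfM -!expiV invrK expiV fmorphV; ring.
have dJ : 1 - (p x)^* != 0 by rewrite -conj1 -rmorphB conjC_eq0 den.
have -> : 1 - ((p x)^*)^-1 = - ((1 - (p x)^*) / (p x)^*).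
  by rewrite mulrBl mul1r mulfV//; ring.
by rewrite mul1r invrN invfM invrK mulNr mulrC.
Qed.

Let T1_cI : cI mu setT (fun x => 1 / (1 - w^-1%:C * (expi x)^* * expi t)).
Proof.
apply: (L2_cI _ _ _ mT fT); apply: (L2_bounded _ _ _ (w ^+ 2 * ((1 - w) ^+ 2)^-1) mT fT).
  under eq_fun do rewrite mul1r.
  apply: cmeasurableV; apply: cmeasurableB; first exact: cmeasurable_cst.
  apply: cmeasurableM; last exact: cmeasurable_cst.
  by apply: cmeasurableM; [exact: cmeasurable_cst|exact: cmeasurableJ measurable_expi].
case/andP: w01 => w0 w1; have w01' : 0 <= w < 1 by rewrite ltW.
have p0 : 0 < (1 - w) ^+ 2 by rewrite exprn_gt0// subr_gt0.
move=> x _; rewrite T1_kernel cabs2M cabs2N cabs2V cabs2J cabs2_p ler_wpM2l ?sqr_ge0//.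
have h := cabs2_sub1_ge _ _ w01' (cabs2_p x).
have -> : 1 - (p x)^* = (1 - p x)^* by rewrite !conjE.
by rewrite cabs2J lef_pV2 ?posrE// (lt_le_trans p0).
Qed.

(** At the reflected point [expi t / w] the kernel of [T 1] becomes [- conj p / (1 - conj p)], and
    [(1 + p) / (1 - p) = 1 + 2 p / (1 - p)]. *)
Lemma R2_reflection :
  R2 mu (w%:C * expi t) = 1 - 2 * (Tr mu w^-1 (fun _ => 1) (expi t))^*.
Proof.
rewrite /Tr -(cintJ _ _ _ mT T1_cI).
rewrite -[X in X - _](cint_cst mu setT 1 mT mu1).
have I1 := cIJ _ _ _ mT T1_cI; have I0 := L2_cI _ _ _ mT fT (L2_cst mu setT 1 mT fT).
rewrite -(cintZ _ _ _ _ mT I1) -(cintB _ _ _ _ mT I0 (cIZ _ _ _ _ mT I1)).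
apply: eq_cint => x _; rewrite T1_kernel.
have K (q : R[i]) : (- q^* / (1 - q^*))^* = - q / (1 - q) by rewrite !conjE !conjCK.
rewrite {}K -/(p x); have := den x; move: (p x) => q d; by field.
Qed.

(** Through the reflection this is the positivity of the Poisson kernel; pointwise it reduces to
    [|p| <= 1]. *)
Lemma Re_T1_le : cRe (Tr mu w^-1 (fun _ => 1) (expi t)) <= 2^-1.
Proof.
have [i1 _] := T1_cI; rewrite -(Rintegral_cst1 mu setT 2^-1 mT mu1) /=.
apply: (le_Rintegral mT i1); first exact: rI_cst mT fT.
move=> x _; rewrite T1_kernel.
have -> : 1 - (p x)^* = (1 - p x)^* by rewrite !conjE.
have := den x; set q := p x; have q2 := cabs2_p x; rewrite -/q in q2.
move=> d; rewrite mulNr cReN cReM cReV cImV !cReJ !cImJ cabs2J.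
have c0 : 0 < cabs2 (1 - q).
  by rewrite lt_neqAle cabs2_ge0 andbT eq_sym; apply: contra_neq d; exact: cabs2_eq0.
have w2 : cabs2 q <= 1.
  case/andP: w01 => w0 w1; rewrite q2 expr_le1//; exact: ltW.
rewrite -(ler_pM2r c0).
have -> : - (cRe q * (cRe (1 - q) * (cabs2 (1 - q))^-1) -
   - cIm q * - (- cIm (1 - q) * (cabs2 (1 - q))^-1)) * cabs2 (1 - q) =
   - (cRe q * cRe (1 - q) + cIm q * cIm (1 - q)).
  by field; rewrite gt_eqF.
by move: w2; rewrite !cabs2E !cRIE /=; nra.
Qed.

End Exterior.

Lemma theta_at0 (g : R[i]) : theta mu g 0 = - g.
Proof.
have -> : theta mu g 0 = ((1 - g) * 1 - (1 + g)) / ((1 - g^*) * 1 + (1 + g^*)).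
  rewrite /theta; have -> : R2 mu 0 = 1; last by [].
  rewrite /R2 -[RHS](cint_cst mu setT 1 mT mu1); apply: eq_cint => x _.
  by rewrite mulr0 addr0 subr0 divr1.
have -> : (1 - g) * 1 - (1 + g) = 2 * (- g) by ring.
have -> : (1 - g^*) * 1 + (1 + g^*) = 2 by ring.
by rewrite mulrAC divff ?mul1r// pnatr_eq0.
Qed.

End BoundaryValues.

(** * The Moebius relation between [theta_gamma] and [T_- 1] *)

Section Moebius.
Context {R : realType}.
Local Open Scope ring_scope.
Implicit Types (g a b tau : R[i]).

Lemma moebius_cabs2 g a b :
  cabs2 (a - g^* * b) - cabs2 (b - g * a) = (1 - cabs2 g) * (cabs2 a - cabs2 b).
Proof. by rewrite !cabs2E !cRIE; ring. Qed.

(* [theta_gamma] in terms of [tau = T_- 1], through [R_2 = 1 - 2 conj(tau)]. *)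
Definition theta_of (g tau : R[i]) : R[i] :=
  ((1 - g) * (1 - 2 * tau^*) - (1 + g)) / ((1 - g^*) * (1 - 2 * tau^*) + (1 + g^*)).

(** With [a = r + 1] and [b = r - 1] the denominator is [a - conj(g) b] and the numerator [b - g a],
    while [|a|^2 - |b|^2 = 4 Re r >= 0]. A zero denominator would give [|a| = |g| |b|], against
    [|b| <= |a|] and [|a| >= 1]. *)
Lemma theta_of_den g tau : cabs2 g < 1 -> cRe tau <= 2^-1 ->
  (1 - g^*) * (1 - 2 * tau^*) + (1 + g^*) != 0 /\
  cabs2 ((1 - g) * (1 - 2 * tau^*) - (1 + g)) <=
  cabs2 ((1 - g^*) * (1 - 2 * tau^*) + (1 + g^*)).
Proof.
move=> g1 t2; set r := 1 - 2 * tau^*.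
have r0 : 0 <= cRe r by rewrite /r !cRIE /=; lra.
have -> : (1 - g) * r - (1 + g) = (r - 1) - g * (r + 1) by ring.
have -> : (1 - g^*) * r + (1 + g^*) = (r + 1) - g^* * (r - 1) by ring.
have h := moebius_cabs2 g (r + 1) (r - 1).
have e : cabs2 (r + 1) - cabs2 (r - 1) = 4 * cRe r by rewrite !cabs2E !cRIE /=; ring.
have le : cabs2 ((r - 1) - g * (r + 1)) <= cabs2 ((r + 1) - g^* * (r - 1)).
  rewrite -subr_ge0 h e mulr_ge0 ?mulr_ge0// subr_ge0; exact: ltW.
split => //; apply/eqP => z.
have : cabs2 (r + 1) = cabs2 g * cabs2 (r - 1).
  by rewrite -(cabs2J g) -cabs2M; congr cabs2; apply/eqP; rewrite -subr_eq0 z.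
have c1 : 1 <= cabs2 (r + 1) by rewrite cabs2E !cRIE /=; nra.
have := cabs2_ge0 g; have := cabs2_ge0 (r - 1); nra.
Qed.

Lemma theta_of_le1 g tau : cabs2 g < 1 -> cRe tau <= 2^-1 ->
  cabs2 (theta_of g tau) <= 1.
Proof.
move=> g1 t2; have [d le] := theta_of_den g tau g1 t2.
have c0 : 0 < cabs2 ((1 - g^*) * (1 - 2 * tau^*) + (1 + g^*)).
  by rewrite lt_neqAle cabs2_ge0 andbT eq_sym; apply: contra_neq d; exact: cabs2_eq0.
by rewrite /theta_of cabs2M cabs2V ler_pdivrMr// mul1r.
Qed.

Lemma resolvent_den g tau : cabs2 g < 1 -> cRe tau <= 2^-1 ->
  1 - (1 - g) * tau != 0.
Proof.
move=> g1 t2; have [d _] := theta_of_den g tau g1 t2.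
apply: contra_neq d => z.
have -> : (1 - g^*) * (1 - 2 * tau^*) + (1 + g^*) = 2 * (1 - (1 - g) * tau)^*.
  by rewrite !conjE; ring.
by rewrite z conj0 mulr0.
Qed.

Lemma one_sub_neq0 tau : cRe tau <= 2^-1 -> 1 - tau != 0.
Proof.
move=> t2; have := resolvent_den 0 tau _ t2; rewrite cabs2_0 subr0 mul1r; exact.
Qed.

(** The factor [tau] on the right serves twice: it is the [T_- 1] divided out in the first formula,
    and it makes [conj theta + conj gam] vanish wherever [T_- 1] does. *)
Lemma theta_of_conjD g tau : cabs2 g < 1 -> cRe tau <= 2^-1 ->
  (theta_of g tau)^* + g^* = - (1 - g * g^*) * tau / (1 - (1 - g) * tau).
Proof.
move=> g1 t2; have D := resolvent_den g tau g1 t2.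
have -> : (theta_of g tau)^* = ((1 - g^*) * (1 - 2 * tau) - (1 + g^*)) /
    ((1 - g) * (1 - 2 * tau) + (1 + g)).
  by rewrite /theta_of !conjE !conjCK; congr (_ / _); ring.
have -> : (1 - g) * (1 - 2 * tau) + (1 + g) = 2 * (1 - (1 - g) * tau) by ring.
have n2 : 2 * (1 - (1 - g) * tau) != 0 by rewrite mulf_neq0 ?pnatr_eq0.
apply: (mulIf n2); rewrite mulrDl divfK//.
by rewrite [in RHS]mulrCA divfK//; ring.
Qed.

Lemma theta_of0_conj tau : cRe tau <= 2^-1 -> (theta_of 0 tau)^* = - tau / (1 - tau).
Proof.
move=> t2; have := theta_of_conjD 0 tau _ t2; rewrite cabs2_0 => /(_ ltr01).
by rewrite conj0 addr0 mul0r !subr0 mul1r mulN1r.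
Qed.

End Moebius.

(** * Radial limits along a sequence of radii *)

Section RadialSequences.
Context {R : realType}.
Local Open Scope ring_scope.

(** One sequence serves both sides of the circle: [radius] increases to [1] from [1/2], and its
    inverses approach [1] from the right. *)
Definition radius (n : nat) : R := 1 - n.+2%:R^-1.

Lemma radius01 n : 0 < radius n < 1.
Proof.
have h : 0 < (n.+2%:R^-1 : R) < 1 by rewrite invr_gt0 ltr0n invf_lt1 ?ltr1n ?ltr0n.
by case/andP: h => h0 h1; rewrite /radius subr_gt0 h1 gtrBl h0.
Qed.

Lemma radius_cvg : radius n @[n --> \oo] --> (1 : R).
Proof.
rewrite /radius -[X in _ --> X]subr0; apply: cvgB; first exact: cvg_cst.
by rewrite (cvg_shiftS (fun n => n.+1%:R^-1 : R)); exact: cvg_harmonic.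
Qed.

Lemma radiusV_cvg : (radius n)^-1 @[n --> \oo] --> (1 : R).
Proof. by rewrite -[X in _ --> X]invr1; apply: cvgV; [exact: oner_neq0|exact: radius_cvg]. Qed.

Lemma ccvg_left_radius (F : R -> R[i]) l : ccvg_left F l ->
  ccvg \oo (fun n => F (radius n)) l.
Proof.
have h : (forall n, radius n < 1) /\ radius n @[n --> \oo] --> (1 : R).
  by split; [move=> n; case/andP: (radius01 n)|exact: radius_cvg].
by move=> [/cvg_at_leftP f1 /cvg_at_leftP f2]; split; [exact: f1|exact: f2].
Qed.

Lemma ccvg_right_radius (F : R -> R[i]) l : ccvg_right F l ->
  ccvg \oo (fun n => F (radius n)^-1) l.
Proof.
have h : (forall n, (radius n)^-1 > 1) /\ (radius n)^-1 @[n --> \oo] --> (1 : R).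
  split; last exact: radiusV_cvg.
  by move=> n; case/andP: (radius01 n) => h0 h1; rewrite invf_gt1.
by move=> [/cvg_at_rightP f1 /cvg_at_rightP f2]; split; [exact: f1|exact: f2].
Qed.

Lemma boundary_values (mu : {measure set (measurableTypeR R) -> \bar R}) (g : R[i])
    (thb T1 : R -> R[i]) t : mu setT = 1%E -> cabs2 g < 1 ->
  ccvg_left (fun r => theta mu g (r%:C * expi t)) (thb t) ->
  ccvg_right (fun r => Tr mu r (fun _ => 1) (expi t)) (T1 t) ->
  cRe (T1 t) <= 2^-1 /\ thb t = theta_of g (T1 t).
Proof.
move=> mu1 g1 /ccvg_left_radius ct /ccvg_right_radius cT.
have T2 : cRe (T1 t) <= 2^-1.
  apply: (cvgn_le_cst _ _ _ cT.1) => n; exact: Re_T1_le mu1 _ _ (radius01 n).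
split => //; apply: (ccvg_unique _ _ _ _ ct).
have E n : theta mu g ((radius n)%:C * expi t) =
    theta_of g (Tr mu (radius n)^-1 (fun _ => 1) (expi t)).
  by rewrite /theta (R2_reflection mu mu1 _ t (radius01 n)).
under [X in ccvg _ X]eq_fun do rewrite E.
have cR : ccvg \oo (fun n => 1 - 2 * (Tr mu (radius n)^-1 (fun _ => 1) (expi t))^*)
    (1 - 2 * (T1 t)^*).
  apply: ccvgB; first exact: ccvg_cst.
  by apply: ccvgM; [exact: ccvg_cst|exact: ccvgJ].
apply: ccvg_div; first by case: (theta_of_den g _ g1 T2).
- by apply: ccvgB; [apply: ccvgM => //|]; exact: ccvg_cst.
- by apply: ccvgD; [apply: ccvgM => //|]; exact: ccvg_cst.
Qed.

End RadialSequences.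

(** * A measurable representative of the boundary function *)

Section MeasurableVersion.
Context {R : realType}.
Local Open Scope ring_scope.

(* [theta] can be read off the defect vector [Phi^* b_1 = c_1], which is
   measurable. *)
Lemma measurable_bounded_version (mu : {measure set (measurableTypeR R) -> \bar R})
    (gam : R[i]) (thb : R -> R[i]) Phi : mu setT = 1%E -> cabs2 gam < 1 ->
  is_Phi mu gam thb Phi -> {ae leb, forall t, I01 t -> cabs2 (thb t) <= 1} ->
  exists th : R -> R[i],
    [/\ cmeasurable th, forall t, cabs2 (th t) <= 1 & aeeq thb th].
Proof.
move=> mu1 g1 HPhi thb1.
have mT : measurable (setT : set (measurableTypeR R)) by exact: measurableT.
have fT : (mu setT < +oo)%E by rewrite mu1 ltry.
have Lb : L2mu mu (fun x => (expi x)^*).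
  apply: (L2_bounded _ _ _ 1 mT fT); first exact: cmeasurableJ measurable_expi.
  by move=> t _; rewrite cabs2J cabs2_expi.
case: HPhi => _ _ P3 _ P5; have [[[[mP _] _] _] _] := P3 _ Lb.
have [_ [_ [c1 _]]] := P5 _ Lb.
pose S := sqrtC (1 - `|theta mu gam 0| ^+ 2).
have S0 : S != 0.
  rewrite sqrtC_eq0 theta_at0// normrN sqr_normE -(rmorph1 (real_complex R)) -rmorphB.
  by rewrite eq_complex /= negb_and subr_eq0 gt_eqF.
pose v t := S * (expi t * (Phi (fun x => (expi x)^*)).1 t) + theta mu gam 0.
have mv : cmeasurable v.
  apply: cmeasurableD; last exact: cmeasurable_cst.
  apply: cmeasurableM; first exact: cmeasurable_cst.
  by apply: cmeasurableM => //; exact: measurable_expi.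
have vE : aeeq v thb.
  apply: filterS c1 => t h It; rewrite /v h//= -/S.
  have -> : S * (expi t * (S^-1 * ((expi t)^-1 * (thb t - theta mu gam 0)))) =
    (S * S^-1) * ((expi t)^-1 * expi t) * (thb t - theta mu gam 0) by ring.
  by rewrite mulfV// mulVf ?expi_neq0// !mul1r subrK.
(* Setting the function to [0] off [U] makes the bound hold everywhere and changes it only on a null
   set of the circle. *)
pose U : set (measurableTypeR R) := [set t | cabs2 (v t) <= 1].
have mU : measurable U.
  rewrite -[X in measurable X]setTI.
  have -> : U = (cabs2 \o v) @^-1` `]-oo, 1]%classic.
    by apply/seteqP; split => t /=; rewrite in_itv.
  by apply: (measurable_cabs2 _ mv).
exists (fun t => (\1_U t)%:C * v t); split.
- apply: cmeasurableM => //; apply: cmeasurable_real; exact: measurable_indic.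
- move=> t; rewrite cabs2M cabs2_real indicE.
  case: (boolP (t \in U)) => [/set_mem|_]; first by rewrite expr1n mul1r.
  by rewrite expr0n mul0r.
- apply: filterS2 vE thb1 => t h1 h2 It; rewrite indicE mem_set ?mul1r ?h1//.
  by rewrite /U /= h1//; exact: h2.
Qed.

End MeasurableVersion.

Theorem theorem4p3 (R : realType) (mu : {measure set (measurableTypeR R) -> \bar R}) (gam : R[i])
  (mu1 : mu setT = 1%E) (mu_supp : mu (~` I01) = 0%E)
  (mu_not_leb : exists A : set (measurableTypeR R), measurable A /\ mu A <> leb (A `&` I01))
  (gam_lt1 : `|gam| < 1)
  (thb th0b : R -> R[i])
  (Hthb : is_boundary (theta mu gam) thb) (Hth0b : is_boundary (theta mu 0) th0b)
  (Phi : (R -> R[i]) -> (R -> R[i]) * (R -> R[i]))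
  (HPhi : is_Phi mu gam thb Phi)
  (f : R -> R[i]) (Hf : L2mu mu f)
  (Tf T1 : R -> R[i]) (HTf : is_Tminus mu f Tf) (HT1 : is_Tminus mu (fun _ => 1) T1) :
  {ae leb, forall t, I01 t ->
     let gm := (thb t)^* * (Phi f).1 t + Delta thb t * (Phi f).2 t in
     gm = (sqrtC (1 - `|gam| ^+ 2))^-1 * ((thb t)^* + gam^*) * (Tf t / T1 t) /\
     gm = sqrtC (1 - `|gam| ^+ 2) * (th0b t)^* / (1 - gam * (th0b t)^*) * (Tf t / T1 t)}.
Proof.
have g1 : cabs2 gam < 1 by exact: cabs2_lt1.
have z1 : cabs2 (0 : R[i]) < 1 by rewrite cabs2_0.
have bv : {ae leb, forall t, I01 t -> cRe (T1 t) <= 2^-1 /\ thb t = theta_of gam (T1 t)}.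
  by apply: filterS2 Hthb HT1 => t h1 h2 It; apply: boundary_values mu1 g1 (h1 It) (h2 It).
have bv0 : {ae leb, forall t, I01 t -> th0b t = theta_of 0 (T1 t)}.
  apply: filterS2 Hth0b HT1 => t h1 h2 It.
  by have [] := boundary_values mu 0 th0b T1 t mu1 z1 (h1 It) (h2 It).
have thb1 : {ae leb, forall t, I01 t -> cabs2 (thb t) <= 1}.
  by apply: filterS bv => t h It; have [h1 ->] := h It; exact: theta_of_le1.
have [th [mth th1 thE]] := measurable_bounded_version mu gam thb Phi mu1 g1 HPhi thb1.
have HPhi' := is_Phi_ae_congr mu gam thb th Phi thE HPhi.
have t0 := theta_at0 mu mu1 gam.
pose A := Aminus th Phi; pose s := defect_scale gam.
have s_gt0 : 0 < s by rewrite sqrtr_gt0 subr_gt0.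
have sn0 : s%:C != 0 :> R[i] by rewrite eq_complex /= negb_and gt_eqF.
have sE : sqrtC (1 - `|gam| ^+ 2) = s%:C.
  by rewrite sqr_normE -(rmorph1 (real_complex R)) -rmorphB sqrtC_real// subr_ge0 ltW.
have s2 : 1 - gam * gam^* = s%:C * s%:C.
  rewrite -expr2 -rmorphXn /= sqr_sqrtr ?subr_ge0 ?(ltW g1)// mulcJE.
  by rewrite rmorphB rmorph1.
have A2 := Aminus_L2 mu gam th mth th1 Phi HPhi'.
have Aspec := Aminus_spectrum mu gam mu1 g1 th th1 Phi HPhi'.
have Alin := Aminus_linear mu gam th Phi HPhi'.
have Ash := Aminus_shift mu gam mu1 g1 th mth th1 Phi HPhi' t0.
have A1 := Aminus_one mu gam mu1 g1 th th1 Phi HPhi' t0.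
have L1 : L2mu mu (fun _ => 1).
  by apply: (L2_cst _ _ _ measurableT); rewrite mu1 ltry.
(* The resolvent formula at [expi t / radius n] supplies the pointwise limit that
   [cauchy_radial_limit] asks for. *)
have Af : aeeq (A f) (fun t => Tf t * (- s%:C / (1 - (1 - gam) * T1 t))).
  apply: (cauchy_radial_limit _ _ radius); first exact: A2.
  - by move=> n; exact: Aspec.
  - by move=> n; case/andP: (radius01 (R := R) n) => /ltW -> ->.
  - exact: radius_cvg.
  apply: filterS3 HTf HT1 bv => t h1 h2 h3 It.
  have [T2 _] := h3 It; have c1 := ccvg_right_radius _ _ (h1 It).
  have c2 := ccvg_right_radius _ _ (h2 It).
  under [X in ccvg _ X]eq_fun => n do rewrite
    (cauchy_integral_A mu gam s mu1 sn0 A A2 Aspec Alin Ash _ t (radius01 n) _ Hf).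
  apply: ccvgM => //; apply: ccvg_div; [exact: resolvent_den|exact: ccvg_cst|].
  by apply: ccvgB; [|apply: ccvgM => //]; exact: ccvg_cst.
have T1n0 : {ae leb, forall t, I01 t -> T1 t != 0}.
  pose B t := (th t)^* + gam^*.
  have mB : cmeasurable B.
    by apply: cmeasurableD; [exact: cmeasurableJ|exact: cmeasurable_cst].
  have B4 t : cabs2 (B t) <= 4.
    apply: (le_trans (cabs2D_le _ _)); rewrite !cabs2J.
    by have := th1 t; move: g1; lra.
  (* The zero set of [B] replaces that of [T1]: it contains the latter up to a null set and is
     measurable because [th] is. *)
  pose E : set (measurableTypeR R) := I01 `&` [set t | cabs2 (B t) = 0].
  have mE : measurable E.
    have -> : E = I01 `&` (cabs2 \o B) @^-1` [set 0] by [].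
    by apply: (measurable_funTS (measurable_cabs2 _ mB)) => //; exact: mI01.
  have EB t : E t -> B t = 0 by move=> [_]; exact: cabs2_eq0.
  have T1B : {ae leb, forall t, I01 t -> T1 t = 0 -> B t = 0}.
    apply: filterS2 bv thE => t h1 h2 It T0; rewrite /B -h2//.
    by have [T2 ->] := h1 It; rewrite theta_of_conjD// T0 mulr0 mul0r.
  have [E0|En0] := eqVneq (leb E) 0%E.
    have nE : {ae leb, forall t, ~ E t} by exists E; split => // t /contrapT.
    apply: filterS2 T1B nE => t h1 h2 It; apply/eqP => T0; apply: h2; split => //=.
    by rewrite (h1 It T0) cabs2_0.
  have B0 : {ae leb, forall t, I01 t -> B t = 0}.
    apply: (riesz_uniqueness B 4 E) => //; last by move=> t [].
    move=> n; have := Aspec _ n L1.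
    rewrite (cint_ae_congr _ _ _ (fun t => s%:C^-1 * (B t * ek (- n%:Z) t))); last first.
      by apply: filterS A1 => t h It; rewrite h// mulrA.
    have B2 : L2 leb I01 B.
      by apply: (L2_bounded _ _ _ 4 (@mI01 R) (@leb_I01_fin R) mB) => t _; exact: B4.
    rewrite (cintZ _ _ _ _ (@mI01 R) (L2_cIM _ _ _ _ (@mI01 R) B2 (L2_ek _))) => /eqP.
    by rewrite mulf_eq0 invr_eq0 (negbTE sn0) => /eqP.
  have A10 : aeeq (A (fun _ => 1)) (fun _ => 0).
    by apply: filterS2 A1 B0 => t h1 h2 It; rewrite /A h1// -/(B t) h2// mulr0.
  have [D [mD nD]] := mu_not_leb; exfalso; apply: nD.
  apply: moments_determine_lebesgue => //.
  exact: moments_zero mu gam s mu1 sn0 A Aspec Ash A10.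
have main : {ae leb, forall t, I01 t ->
    (thb t)^* * (Phi f).1 t + Delta thb t * (Phi f).2 t =
    Tf t * (- s%:C / (1 - (1 - gam) * T1 t))}.
  apply: filterS2 thE Af => t h1 h2 It.
  by rewrite -h2// /A /Aminus minus_partE// /Delta h1.
have mainT : {ae leb, forall t, I01 t ->
    (thb t)^* * (Phi f).1 t + Delta thb t * (Phi f).2 t =
    Tf t * (- s%:C / (1 - (1 - gam) * T1 t)) /\ T1 t != 0}.
  by apply: filterS2 main T1n0 => t h1 h2 It; split; [exact: h1|exact: h2].
apply: filterS3 mainT bv bv0 => t h1 h2 h3 It.
have [-> x0] := h1 It; have [T2 tE] := h2 It.
have D0 := resolvent_den gam _ g1 T2; have x1 := one_sub_neq0 _ T2.
have thJ := theta_of_conjD gam _ g1 T2.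
rewrite /= sE h3// theta_of0_conj// tE thJ s2.
have -> : 1 - gam * (- T1 t / (1 - T1 t)) = (1 - (1 - gam) * T1 t) / (1 - T1 t).
  by field.
split; first by field; rewrite x0 D0 sn0.
by field; rewrite x0 D0 x1.
Qed.
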